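(* Let $\mu_\star$ be a (possibly singular) Gaussian measure on $\mathbb R^d$. For any (possibly singular) Gaussian measure $\mu$ on $\mathbb R^d$, the vector field $\nabla(f_{\mu,\mu_\star}-f_\mu)$ belongs to the Wasserstein subdifferential $\partial_W\big(S_\varepsilon(\cdot,\mu_\star)\big)(\mu)$ of the functional $S_\varepsilon(\cdot,\mu_\star):\mathcal P_2(\mathbb R^d)\to\mathbb R$ at $\mu$.
   Context: Fix $d\ge1$ and $\varepsilon>0$. $\mathcal P_2(\mathbb R^d)$ is the set of Radon probability measures with finite second moment. $\Pi(\mu,\nu)$ is the set of couplings of $\mu,\nu$, $W_2^2(\mu,\nu)=\min_{\pi\in\Pi(\mu,\nu)}\int\|x-y\|^2d\pi$, and $\Pi_{\mathrm o}(\mu,\nu)$ is the set of minimizers. Entropic OT: $\mathrm{OT}_\varepsilon(\mu,\nu)=\min_{\pi\in\Pi(\mu,\nu)}\int\|x-y\|^2d\pi+\varepsilon\,\mathrm{KL}(\pi|\mu\otimes\nu)$, where $\mathrm{KL}(\pi|\gamma)=\int\log(d\pi/d\gamma)d\pi$ if $\pi\ll\gamma$ and $+\infty$ otherwise. Sinkhorn divergence: $S_\varepsilon(\mu,\nu)=\mathrm{OT}_\varepsilon(\mu,\nu)-\frac12\mathrm{OT}_\varepsilon(\mu,\mu)-\frac12\mathrm{OT}_\varepsilon(\nu,\nu)$. Schrödinger potentials: $(f_{\mu,\nu},g_{\mu,\nu})$ are the functions on $\mathbb R^d$, unique up to shifts $(f+\lambda,g-\lambda)$, $\lambda\in\mathbb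 R$, solving $f_{\mu,\nu}=T_\varepsilon(g_{\mu,\nu},\nu)$ and $g_{\mu,\nu}=T_\varepsilon(f_{\mu,\nu},\mu)$ everywhere, where $T_\varepsilon(f,\mu)(y)=-\varepsilon\log\int\exp\big(\tfrac1\varepsilon(f(x)-\|x-y\|^2)\big)d\mu(x)$. When $\mu=\nu$ one chooses the shift so that $f_{\mu,\mu}=g_{\mu,\mu}=:f_\mu$. Wasserstein subdifferential: for $F:\mathcal P_2(\mathbb R^d)\to\mathbb R\cup\{+\infty\}$ and $\mu$ with $F(\mu)<\infty$, a vector field $\xi\in L^2_\mu(\mathbb R^d)$ belongs to $\partial_WF(\mu)$ if for every $\nu\in\mathcal P_2(\mathbb R^d)$ there exists $\pi\in\Pi_{\mathrm o}(\mu,\nu)$ such that $F(\nu)-F(\mu)\ge\int\langle\xi(x),y-x\rangle d\pi(x,y)+o(W_2(\mu,\nu))$, the remainder being understood as $\nu\to\mu$ in $W_2$. *)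

(* Defs.v *)
From HB Require Import structures.
From mathcomp Require Import all_boot all_order all_algebra.
From mathcomp Require Import all_classical all_reals all_analysis.

Set Implicit Arguments.
Unset Strict Implicit.
Unset Printing Implicit Defensive.

Import Order.TTheory GRing.Theory Num.Theory.
Import numFieldNormedType.Exports.

Local Open Scope classical_set_scope.
Local Open Scope ring_scope.

(* R^d is 'rV[R]_d with its Borel sigma-algebra.  The library norm `|x| on row
   vectors is the sup norm, so the Euclidean structure is given by dot. *)
HB.instance Definition _ (R : realType) (d : nat) :=
  @isMeasurable.Build (sigma_display (@open 'rV[R]_d)) 'rV[R]_d
    <<s @open 'rV[R]_d >> (@sigma_algebra0 _ setT _) (@sigma_algebraC _ _)
    (@sigma_algebra_bigcup _ setT _).

Section Euclidean.
Context {R : realType} {d : nat}.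
Implicit Types x y : 'rV[R]_d.

Definition dot x y : R := \sum_(i < d) x 0 i * y 0 i.

Definition sqnorm x : R := dot x x.

Definition gradient (h : 'rV[R]_d -> R) x : 'rV[R]_d :=
  \row_(i < d) 'D_(delta_mx 0 i) h x.

End Euclidean.

(* 'd P '/d Q is only determined Q-a.e.; when P << Q its nonpositive values
   (where lne is -oo) form a P-null set. *)
Definition KL {dT : measure_display} {T : measurableType dT} {R : realType}
    (P Q : probability T R) : \bar R :=
  if `[< P `<< Q >]
  then (\int[P]_z lne (Radon_Nikodym (charge_of_finite_measure P) Q z))%E
  else +oo%E.

Section OptimalTransport.
Context {R : realType} {d : nat}.
Local Notation E := 'rV[R]_d.
Local Notation prob := (probability E R).
Local Notation plan := (probability (E * E)%type R).
Implicit Types (mu nu : prob) (pi : plan) (eps : R).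

Definition P2 mu : Prop := (\int[mu]_x (sqnorm x)%:E < +oo)%E.

Definition coupling mu nu pi : Prop :=
  forall A : set E, measurable A ->
    pushforward pi fst A = mu A /\ pushforward pi snd A = nu A.

Definition transport_cost pi : \bar R :=
  (\int[pi]_z (sqnorm (z.1 - z.2))%:E)%E.

Definition W2sq mu nu : \bar R :=
  ereal_inf [set transport_cost pi | pi in coupling mu nu].

(* W2sq is finite on P2, the only place where W2 is used. *)
Definition W2 mu nu : R := Num.sqrt (fine (W2sq mu nu)).

Definition optimal_coupling mu nu pi : Prop :=
  coupling mu nu pi /\ transport_cost pi = W2sq mu nu.

Definition OT eps mu nu : \bar R :=
  ereal_inf [set (transport_cost pi + eps%:E * KL pi (mu \x nu))%E
            | pi in coupling mu nu].

Definition sinkhorn_divergence eps mu nu : \bar R :=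
  (OT eps mu nu - 2^-1%:E * OT eps mu mu - 2^-1%:E * OT eps nu nu)%E.

(* Extended-real valued, since the integral may be infinite. *)
Definition sinkhorn_transform eps (f : E -> R) mu (y : E) : \bar R :=
  (- (eps%:E *
      lne (\int[mu]_x (expR (eps^-1 * (f x - sqnorm (x - y))))%:E)))%E.

(* Measurability is implicit in the integrals of the Schrodinger system; the
   library integral of a non-measurable function is not meaningful. *)
Definition schrodinger_potentials eps mu nu (f g : E -> R) : Prop :=
  [/\ measurable_fun [set: E] f, measurable_fun [set: E] g,
      forall x, (f x)%:E = sinkhorn_transform eps g nu x &
      forall y, (g y)%:E = sinkhorn_transform eps f mu y].

Definition in_L2 mu (xi : E -> E) : Prop :=
  measurable_fun [set: E] xi /\ (\int[mu]_x (sqnorm (xi x))%:E < +oo)%E.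

Definition little_o_W2 mu (r : prob -> R) : Prop :=
  forall eta : R, 0 < eta -> exists2 delta : R, 0 < delta &
    forall nu, P2 nu -> W2 mu nu < delta -> `|r nu| <= eta * W2 mu nu.

(* Only the values of F on P2 matter. *)
Definition wasserstein_subdifferential (F : prob -> \bar R) mu
    (xi : E -> E) : Prop :=
  [/\ P2 mu, F mu \is a fin_num, in_L2 mu xi &
      exists2 r : prob -> R, little_o_W2 mu r &
        forall nu, P2 nu -> exists2 pi : plan, optimal_coupling mu nu pi &
          (\int[pi]_z (dot (xi z.1) (z.2 - z.1))%:E + (r nu)%:E
             <= F nu - F mu)%E].

(* The law of d independent standard normal variables. *)
Definition standard_gaussian mu : Prop :=
  forall A : 'I_d -> set R, (forall i, measurable (A i)) ->
    mu [set x | forall i, A i (x 0 i)] =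
    (\prod_(i < d) normal_prob 0 1 (A i))%E.

(* The normal law with mean m and covariance M^T *m M; M need not be
   invertible, so singular covariances (and Dirac masses) are included. *)
Definition gaussian mu : Prop :=
  exists gamma : prob, standard_gaussian gamma /\
  exists (m : E) (M : 'M[R]_d), forall A : set E, measurable A ->
    mu A = pushforward gamma (fun z => m + z *m M) A.

End OptimalTransport.

(* Main.v *)
Require Import Defs.
From HB Require Import structures.
From mathcomp Require Import all_boot all_order all_algebra.
From mathcomp Require Import all_classical all_reals all_analysis.
From mathcomp Require Import measurable_realfun ring lra.
Import Order.TTheory GRing.Theory Num.Theory.
Import numFieldNormedType.Exports.
Set Implicit Arguments.
Unset Strict Implicit.
Unset Printing Implicit Defensive.
Local Open Scope classical_set_scope.
Local Open Scope ring_scope.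

(* Gaussian measures enter only through the bound E exp<a,x> <= exp(k + lam |a|^2).

   Under potentials f, g of (mu, mu_star), the density
   p(x,y) = exp((f x + g y - |x-y|^2)/eps) makes each p(x,.) mu_star a probability,
   with mean m(x).  Evaluating the system at x+v shows that
   |v|^2 + 2<x,v> + f x - f(x+v) is eps times the cumulant generating function of
   this law at 2v/eps.  Jensen's inequality gives the semiconcavity bound
   f(x+v) - f x <= |v|^2 + <xi x, v> with xi x = 2(x - m x); a second order expansion,
   uniform for bounded x, gives the reverse bound up to O(|v|^2).  Hence grad f = xi,
   and integrating along an optimal plan pi from mu to nu gives
   int f dnu - int f dmu >= int <xi, y-x> dpi - o(W2).

   The potentials stay admissible in the dual of OT_eps(nu, mu_star), which gives the
   lower bound OT(nu, mu_star) - OT(mu, mu_star) >= int f dnu - int f dmu.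
   For the self-transport terms an upper bound is needed: moving both marginals of
   the optimal entropic plan of (mu, mu) along pi yields a competitor whose entropy
   does not increase, so that
   OT(nu, nu) - OT(mu, mu) <= 2 int <xi_mu, y-x> dpi + 4 W2^2. *)

(** * Borel sets and regularity in R^d *)

Section RowVectors.
Context {R : realType} {d : nat}.
Local Notation E := 'rV[R]_d.

(** The sign of each term decides which side of the duality is usable. OT(nu, nu) enters S with a
    minus sign and no potentials of nu are at hand, so it can only be bounded by a primal competitor
    built from the potentials of mu. The same competitor with nothing moved gives OT(mu, mu_star) <=
    int f dmu + int g dmu_star, so strong duality is never invoked, and OT(mu, mu) >= 2 int f_mu dmu
    is weak duality. All estimates are integrated along one and the same optimal plan, whose
    existence is obtained by compactness. The obstacle is that nu ranges over all measures of finite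
    second moment, while the second-order expansion is uniform for bounded x only. Large x are
    handled by quadratic growth of the potentials and by the small second-moment tail of mu, whence
    a remainder o(W2) instead of O(W2^2). The growth bound itself rests on a cancellation:
    semiconcavity bounds a potential above by |y|^2 plus linear terms, with the very coefficient of
    the cost, so that only exponentials of linear forms have to be integrated. *)

Lemma rat_ball_subset (U : set E) (x : E) : open U -> U x ->
  exists (q : 'rV[rat]_d) (n : nat),
    ball (map_mx ratr q : E) n.+1%:R^-1 x /\
    ball (map_mx ratr q : E) n.+1%:R^-1 `<=` U.
Proof.
move=> oU Ux; have /nbhs_ballP[e /= e0 eU] : nbhs x U by exact: open_nbhs_nbhs.
(* Half of e, because passing from x to y through the rational centre doubles the radius. *)
have [n n_e] : exists n : nat, n.+1%:R^-1 < e / 2.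
  have /ltr_add_invr [n] : 0 < e / 2 by rewrite divr_gt0.
  by rewrite add0r => ?; exists n.
have r0 : 0 < n.+1%:R^-1 :> R by rewrite invr_gt0.
have [r rE] : exists r : R, r = n.+1%:R^-1 by exists n.+1%:R^-1.
rewrite -rE in n_e r0.
have /choice[q qx] : forall i, exists q : rat, `|ratr q - x 0 i| < r.
  move=> i.
  have /rat_in_itvoo[q] : x 0 i - r < x 0 i + r by lra.
  rewrite in_itv /= => /andP[q1 q2]; exists q.
  by rewrite ltr_norml; apply/andP; split; lra.
have bqx : ball (map_mx ratr (\row_i q i) : E) r x.
  by split=> // i j; rewrite !mxE ord1 /ball /= qx.
exists (\row_i q i), n; rewrite -rE; split=> // y qy; apply: eU.
by have := ball_triangle (ball_sym bqx) qy; apply: le_ball; lra.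
Qed.

Lemma measurable_open (U : set E) : open U -> measurable U.
Proof. by move=> oU; exact: sub_sigma_algebra. Qed.

Lemma measurable_closed (C : set E) : closed C -> measurable C.
Proof.
by move=> cC; rewrite -(setCK C); apply: measurableC; apply: measurable_open; rewrite openC.
Qed.

Lemma measurable_coord i : measurable_fun [set: E] (fun x : E => x 0 i).
Proof.
apply: (measurability _ (RGenOInfty.measurableE R)) => // _ [_ [a ->] <-].
rewrite setTI; apply: measurable_open.
by apply: open_comp => // x _; exact: coord_continuous.
Qed.

(** An open set is a countable union of balls with rational data, and a sup-norm ball is a finite
    intersection of coordinate slabs; so the coordinates decide Borel measurability. *)
Lemma measurable_fun_rV {dT} {T : measurableType dT} (h : T -> E) :
  (forall i, measurable_fun [set: T] (fun t => h t 0 i)) ->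
  measurable_fun [set: T] h.
Proof.
move=> mh; apply: (@measurability _ _ _ _ _ _ (@open E : set (set E))) => //.
move=> _ [U oU <-]; rewrite setTI.
pose D := [set k : 'rV[rat]_d * nat |
  ball (map_mx ratr k.1 : E) k.2.+1%:R^-1 `<=` U].
have -> : U = \bigcup_(k in D) ball (map_mx ratr k.1 : E) k.2.+1%:R^-1.
  apply/seteqP; split=> [x Ux|x [k Dk]]; last exact: Dk.
  by have [q [n [qx qU]]] := rat_ball_subset oU Ux; exists (q, n).
rewrite bigcup_mkcond preimage_bigcup; apply: countable_bigcupT_measurable => //.
move=> [q n] /=; case: ifP => _; last by rewrite preimage_set0.
have -> : h @^-1` ball (map_mx ratr q : E) n.+1%:R^-1 =
    \bigcap_(i : 'I_d) (fun t => h t 0 i) @^-1` ball (ratr (q 0 i) : R) n.+1%:R^-1.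
  apply/seteqP; split=> [t [_ bt] i _|t bt].
    by have := bt 0 i; rewrite mxE.
  split; first by rewrite invr_gt0.
  by move=> i j; rewrite mxE ord1; exact: bt.
apply: fin_bigcap_measurable => // i _; rewrite -[X in measurable X]setTI.
by apply: mh => //; exact: measurable_ball.
Qed.

Lemma measurable_fun_coord {dT} {T : measurableType dT} (h : T -> E) i :
  measurable_fun [set: T] h -> measurable_fun [set: T] (fun t => h t 0 i).
Proof. by move=> mh; exact: measurableT_comp (measurable_coord i) mh. Qed.

Lemma measurable_dot {dT} {T : measurableType dT} (u v : T -> E) :
  measurable_fun [set: T] u -> measurable_fun [set: T] v ->
  measurable_fun [set: T] (fun t => dot (u t) (v t)).
Proof.
move=> mu mv; apply: measurable_sum => i.
by apply: measurable_funM; exact: measurable_fun_coord.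
Qed.

Lemma measurable_sqnorm {dT} {T : measurableType dT} (u : T -> E) :
  measurable_fun [set: T] u -> measurable_fun [set: T] (fun t => sqnorm (u t)).
Proof. by move=> mu; exact: measurable_dot. Qed.

Lemma measurable_funD_rV {dT} {T : measurableType dT} (u v : T -> E) :
  measurable_fun [set: T] u -> measurable_fun [set: T] v ->
  measurable_fun [set: T] (fun t => u t + v t).
Proof.
move=> mu mv; apply: measurable_fun_rV => i.
under eq_fun do rewrite mxE.
by apply: measurable_funD; exact: measurable_fun_coord.
Qed.

Lemma measurable_funB_rV {dT} {T : measurableType dT} (u v : T -> E) :
  measurable_fun [set: T] u -> measurable_fun [set: T] v ->
  measurable_fun [set: T] (fun t => u t - v t).
Proof.
move=> mu mv; apply: measurable_fun_rV => i.
under eq_fun do rewrite !mxE.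
by apply: measurable_funB; exact: measurable_fun_coord.
Qed.

End RowVectors.

Lemma geometric_nneseries_le {R : realType} (e : R) : 0 <= e ->
  (\sum_(0 <= n <oo) (e / (2 ^ n.+1)%:R)%:E <= e%:E)%E.
Proof.
move=> e0; have := @epsilon_trick R (fun=> 0%E) e xpredT (fun=> lexx _) e0.
under eq_eseriesr do rewrite add0e.
by rewrite [X in (_ <= X + _)%E]eseries0 // add0e.
Qed.

Section MeasureLimits.
Context {dT} {T : measurableType dT} {R : realType} (mu : probability T R).
Local Open Scope ereal_scope.

Lemma nonincreasing_mu_lt (F : (set T)^nat) (e : \bar R) :
  (forall i, measurable (F i)) ->
  (forall n m, (n <= m)%N -> F m `<=` F n) ->
  mu (\bigcap_n F n) < e -> exists n, mu (F n) < e.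
Proof.
move=> mF dF lte.
have cvgF : mu \o F @ \oo --> mu (\bigcap_n F n).
  apply: nonincreasing_cvg_mu => //.
  - by rewrite (le_lt_trans (probability_le1 _ (mF _)))// ltry.
  - exact: bigcap_measurable.
  - by move=> n m nm; apply/subsetPset; exact: dF.
have : nbhs (mu (\bigcap_n F n)) [set x | x < e].
  by apply: open_nbhs_nbhs; split=> //; exact: open_ereal_lt_ereal.
by move=> /cvgF [n _ /(_ n (leqnn n))] ?; exists n.
Qed.

End MeasureLimits.

Section Regularity.
Context {R : realType} {d : nat}.
Local Notation E := 'rV[R]_d.
Implicit Types mu : probability E R.

(** Approximation from both sides makes the class stable under complements, so that it is a
    sigma-algebra; compact sets come in only afterwards. *)
Definition closed_open_regular mu (A : set E) :=
  forall e : R, 0 < e -> exists C U : set E,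
    [/\ closed C, open U, C `<=` A, A `<=` U & (mu (U `\` C) < e%:E)%E].

(** The points at distance at least 1/(n+1) from the complement form closed sets that exhaust U. *)
Lemma open_closed_open_regular mu (U : set E) : open U ->
  closed_open_regular mu U.
Proof.
move=> oU e e0.
pose C n := \bigcap_(y in ~` U) [set x : E | n.+1%:R^-1 <= `|x - y|].
have cC n : closed (C n).
  apply: closed_bigI => y _; apply: (@closed_comp _ _ (fun x : E => `|x - y|)
    [set r | n.+1%:R^-1 <= r]).
    move=> x _; apply: (@cvg_norm _ E _ (nbhs x)); apply: cvgB; [exact: cvg_id|exact: cvg_cst].
  exact: closed_ge.
have CU n : C n `<=` U.
  move=> x Cx; apply: contrapT => nUx.
  by have := Cx x nUx; rewrite /= subrr normr0 leNgt invr_gt0 ltr0n.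
have [| | |n mun] := @nonincreasing_mu_lt _ _ _ mu (fun n => U `\` C n) e%:E.
- by move=> i; apply: measurableD; [exact: measurable_open|exact: measurable_closed].
- move=> n m nm x [Ux nCx]; split=> // Cx; apply: nCx => y Uy /=.
  apply: (le_trans _ (Cx y Uy)).
  by rewrite lef_pV2 ?posrE ?ltr0n// ler_nat.
- suff -> : \bigcap_n (U `\` C n) = set0 by rewrite measure0 lte_fin.
  apply/seteqP; split=> // x CUx.
  have [Ux _] := CUx 0%N I.
  have /nbhs_ballP[r /= r0 rU] : nbhs x U by exact: open_nbhs_nbhs.
  have [n n_r] : exists n : nat, n.+1%:R^-1 < r.
    by have /ltr_add_invr [n] := r0; rewrite add0r => ?; exists n.
  have [_ ] := CUx n I; apply=> y nUy /=; rewrite leNgt; apply/negP => xy.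
  apply: nUy; apply: rU; rewrite mx_norm_ball /ball_ /=.
  exact: lt_trans xy n_r.
by exists (C n), U; split; rewrite ?cC.
Qed.

Lemma measurable_closed_open_regular mu (A : set E) : measurable A ->
  closed_open_regular mu A.
Proof.
move: A; apply: smallest_sub; last first.
  by move=> U oU; exact: open_closed_open_regular.
split.
- move=> e e0; exists set0, set0; split=> //; do ?[exact: closed0|exact: open0].
  by rewrite setD0 measure0 lte_fin.
- move=> A Areg e /Areg[C [U [cC oU CA AU mUC]]]; rewrite setTD.
  exists (~` U), (~` C); split; [by rewrite closedC|by rewrite openC| | |].
  - exact: subsetC.
  - exact: subsetC.
  - by rewrite setDE setCK setIC -setDE.
move=> F Freg e e0.
have /choice[CU CUP] : forall n, exists CU : set E * set E,
    [/\ closed CU.1, open CU.2, CU.1 `<=` F n, F n `<=` CU.2 &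
      (mu (CU.2 `\` CU.1) < (e / 2 / (2 ^ n.+1)%:R)%:E)%E].
  move=> n; have [|C [U [? ? ? ? ?]]] := Freg n (e / 2 / (2 ^ n.+1)%:R).
    by rewrite !divr_gt0// ltr0n expn_gt0.
  by exists (C, U).
pose U := \bigcup_n (CU n).2.
have oU : open U by apply: bigcup_open => n _; have [] := CUP n.
have mC n : measurable (CU n).1 by apply: measurable_closed; have [] := CUP n.
have mU n : measurable (CU n).2 by apply: measurable_open; have [] := CUP n.
have mbU : measurable U by exact: measurable_open.
(* A countable union of closed sets need not be closed, so only the first N are kept, the loss being
   small by continuity from above. The individual errors sum to e/2, strictly below e, as the limit
   requires. *)
have [| | |N muN] := @nonincreasing_mu_lt _ _ _ mu
    (fun N => U `\` \big[setU/set0]_(n < N) (CU n).1) e%:E.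
- by move=> N; apply: measurableD => //; exact: bigsetU_measurable.
- move=> N M NM; apply: setDS.
  rewrite -!(bigcup_mkord _ (fun n => (CU n).1)) => x [k /= kN Ck]; exists k => //=.
  exact: leq_trans kN NM.
- apply: (@le_lt_trans _ _ (mu (\bigcup_n ((CU n).2 `\` (CU n).1)))).
    apply: le_measure.
    + by rewrite inE; apply: bigcap_measurable => // N _; apply: measurableD => //;
        exact: bigsetU_measurable.
    + by rewrite inE; apply: bigcup_measurable => n _; exact: measurableD.
    + move=> x Ux; have [[n _ xUn] _] := Ux 0%N I; exists n => //; split=> // xCn.
      have [_] := Ux n.+1 I; apply; rewrite -(bigcup_mkord _ (fun n => (CU n).1)).
      by exists n => /=.
  apply: (@le_lt_trans _ _ (\sum_(n <oo) (e / 2 / (2 ^ n.+1)%:R)%:E)%E).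
    pose D n := (CU n).2 `\` (CU n).1.
    have mD n : measurable (D n) by exact: measurableD.
    have mbD : measurable (\bigcup_n D n) by exact: bigcup_measurable.
    apply: le_trans (measure_sigma_subadditive mu mD mbD (@subset_refl _ _)) _.
    by apply: lee_nneseries => // n _; apply: ltW; have [] := CUP n.
  apply: le_lt_trans (geometric_nneseries_le _) _; last by rewrite lte_fin; lra.
  by rewrite divr_ge0 // ltW.
exists (\big[setU/set0]_(n < N) (CU n).1), U; split=> //.
- by apply: closed_bigsetU => n _; have [] := CUP n.
- rewrite -(bigcup_mkord _ (fun n => (CU n).1)) => x [n _ xC]; exists n => //.
  by have [_ _ + _ _] := CUP n; exact.
- by move=> x [n _ Fx]; exists n => //; have [_ _ _ + _] := CUP n; exact.
Qed.

Lemma open_approx mu (A : set E) (e : R) : measurable A -> 0 < e ->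
  exists U, [/\ open U, A `<=` U & (mu (U `\` A) < e%:E)%E].
Proof.
move=> mA /(measurable_closed_open_regular mu mA)[C [U [cC oU CA AU mUC]]].
exists U; split=> //; apply: le_lt_trans mUC; apply: le_measure; rewrite ?inE.
- by apply: measurableD => //; exact: measurable_open.
- by apply: measurableD; [exact: measurable_open|exact: measurable_closed].
- exact: setDS.
Qed.

Lemma compact_approx mu (A : set E) (e : R) : measurable A -> 0 < e ->
  exists K, [/\ compact K, K `<=` A & (mu (A `\` K) < e%:E)%E].
Proof.
move=> mA e0.
have [C [U [cC oU CA AU mUC]]] := measurable_closed_open_regular mu mA e0.
(* Cutting with growing closed balls loses no mass in the limit, and bounded closed sets of R^d are
   compact. *)
pose K n := C `&` [set x : E | `|x| <= n%:R].
have cK n : closed (K n).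
  apply: closedI => //; apply: (@closed_comp _ _ (fun x : E => `|x|) [set r | r <= n%:R]).
    by move=> x _; exact: norm_continuous.
  exact: closed_le.
have mC : measurable C by exact: measurable_closed.
have [| | |n mun] := @nonincreasing_mu_lt _ _ _ mu (fun n => A `\` K n) e%:E.
- by move=> n; apply: measurableD => //; exact: measurable_closed.
- move=> n m nm; apply: setDS => x [Cx xn]; split=> //.
  by apply: (le_trans xn); rewrite ler_nat.
- apply: le_lt_trans mUC; apply: le_measure; rewrite ?inE.
  + by apply: bigcap_measurable => // n _; apply: measurableD => //; exact: measurable_closed.
  + by apply: measurableD => //; exact: measurable_open.
  + move=> x Kx; have [Ax _] := Kx 0%N I; split; first exact: AU.
    move=> Cx; have [_] := Kx (Num.truncn `|x|).+1 I; apply; split=> //=.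
    by apply: ltW; exact: truncnS_gt.
exists (K n); split=> //; last by move=> x [/CA].
apply: bounded_closed_compact => //; exists n%:R; split=> // r nr x [_ /= xn].
exact: le_trans xn (ltW nr).
Qed.

End Regularity.

(** * Existence of optimal transport plans *)

Lemma probability_setUI {dT} {T : measurableType dT} {R : realType}
    (P : probability T R) (A B : set T) : measurable A -> measurable B ->
  (P (A `|` B) = P A + P B - P (A `&` B))%E.
Proof.
by move=> mA mB; rewrite measureUfinl // ltey_eq fin_num_measure.
Qed.

Lemma ler_eps {R : realFieldType} (x y : R) :
  (forall e : R, 0 < e -> x <= y + e) -> x <= y.
Proof. by move=> H; apply/ler_addgt0Pr => e; exact: H. Qed.

(** Tychonoff's theorem in [0,1]^X. X will be the family of all sets of pairs, too large for a
    diagonal subsequence; what survives is agreement at finitely many points for arbitrarily late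
    indices. *)
Lemma pointwise_cluster {R : realType} {X : choiceType} (u : nat -> X -> R) :
  (forall n x, 0 <= u n x <= 1) ->
  exists l : X -> R, forall (s : seq X) (e : R) (N : nat), 0 < e ->
    exists2 n, (N <= n)%N & forall x, x \in s -> `|u n x - l x| < e.
Proof.
move=> u01.
have := @tychonoff X (fun=> R) (fun=> `[0, 1]%classic) (fun=> @segment_compact R 0 1).
set A := [set _ | _] => cA.
have uA : (u n @[n --> \oo]) A.
  by exists 0%N => // n _ x; rewrite /= in_itv /= u01.
have [l [_ ul]] := cA _ _ uA.
exists l => s e N e0.
have ls : nbhs l [set f : X -> R | forall x, x \in s -> `|f x - l x| < e].
  elim: s => [|x s IHs]; first by apply: filterS filterT => f _ x.
  have lx : nbhs l [set f : X -> R | `|f x - l x| < e].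
    have -> : [set f : X -> R | `|f x - l x| < e] = @proj X (fun=> R) x @^-1` ball (l x) e.
      by apply/funext => f; rewrite /= -ball_normE /= distrC.
    exact: (@proj_continuous X (fun=> R) x l _ (nbhsx_ballx (l x) e e0)).
  by apply: filterS2 lx IHs => f fx fs y; rewrite inE => /predU1P[->//|/fs].
have uN : (u n @[n --> \oo]) (u @` [set n | (N <= n)%N]).
  by exists N => // n Nn; exists n.
by have [f [[n Nn <-] fs]] := ul _ _ uN ls; exists n.
Qed.

Section OpenProduct.
Context {R : realType} {d : nat}.
Local Notation E := 'rV[R]_d.

(** Products of rational balls, enumerated through their codes; an index that is no code, or whose
    product leaves G, yields the empty rectangle. *)
Lemma open_bigcup_rectangles (G : set (E * E)) : open G ->
  exists r : nat -> set E * set E,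
    (forall n, measurable (r n).1 /\ measurable (r n).2) /\
    G = \bigcup_n ((r n).1 `*` (r n).2).
Proof.
move=> oG.
pose b (k : 'rV[rat]_d * nat) : set E := ball (map_mx ratr k.1 : E) k.2.+1%:R^-1.
have mb k : measurable (b k) by apply: measurable_open; exact: ball_open.
pose r n : set E * set E :=
  if (unpickle n : option (('rV[rat]_d * nat) * ('rV[rat]_d * nat))) is Some k then
    if `[< b k.1 `*` b k.2 `<=` G >] then (b k.1, b k.2) else (set0, set0)
  else (set0, set0).
have rP n : r n = (set0, set0) \/
    exists2 k, b k.1 `*` b k.2 `<=` G & r n = (b k.1, b k.2).
  rewrite /r; case: unpickle => [k|]; last by left.
  have [bG|nbG] := pselect (b k.1 `*` b k.2 `<=` G).
    by right; exists k; rewrite ?asboolT.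
  by left; rewrite asboolF.
exists r; split.
  move=> n; have [->|[k _ ->]] := rP n; last by split; exact: mb.
  by split; exact: measurable0.
apply/seteqP; split=> [[x y] Gxy|z [n _]]; last first.
  by have [->|[k bG ->]] := rP n; [case|exact: bG].
have [[A B] /= [Ax By] ABG] : nbhs (x, y) G by exact: open_nbhs_nbhs.
have [q [n [qx qA]]] := rat_ball_subset (@open_interior _ A) Ax.
have [q' [n' [qy qB]]] := rat_ball_subset (@open_interior _ B) By.
exists (pickle ((q, n), (q', n'))); first exact: I.
rewrite /r pickleK asboolT //= => z [/qA zA /qB zB].
by apply: ABG; split; exact: interior_subset.
Qed.

Lemma measurable_open_prod (G : set (E * E)) : open G -> measurable G.
Proof.
move=> /open_bigcup_rectangles[r [mr ->]]; apply: bigcup_measurable => n _.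
by have [? ?] := mr n; exact: measurableX.
Qed.

(** Finite unions of rectangles are the sets on which the cluster plan will be computed exactly;
    this makes them reach open sets from inside. *)
Lemma open_rectangles_approx (P : probability (E * E)%type R) (G : set (E * E))
    (e : R) : open G -> 0 < e ->
  exists s : seq (set E * set E),
    [/\ forall r, r \in s -> measurable r.1 /\ measurable r.2,
       \big[setU/set0]_(r <- s) (r.1 `*` r.2) `<=` G &
       (P (G `\` \big[setU/set0]_(r <- s) (r.1 `*` r.2)) < e%:E)%E].
Proof.
move=> oG e0; have mG := measurable_open_prod oG.
have [r [mr Gr]] := open_bigcup_rectangles oG.
have mR n : measurable ((r n).1 `*` (r n).2 : set (E * E)).
  by have [? ?] := mr n; exact: measurableX.
have [| | |n Pn] := @nonincreasing_mu_lt _ _ _ P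
    (fun N => G `\` \big[setU/set0]_(n < N) ((r n).1 `*` (r n).2)) e%:E.
- by move=> n; apply: measurableD => //; exact: bigsetU_measurable.
- move=> n m nm; apply: setDS.
  rewrite -!(bigcup_mkord _ (fun n => (r n).1 `*` (r n).2)) => x [k /= kN Ck].
  by exists k => //=; exact: leq_trans kN nm.
- suff -> : \bigcap_N (G `\` \big[setU/set0]_(n < N) ((r n).1 `*` (r n).2)) = set0.
    by rewrite measure0 lte_fin.
  apply/seteqP; split=> // z Gz; have [] := Gz 0%N I; rewrite {1}Gr => -[n _ zn] _.
  have [_] := Gz n.+1 I; apply; rewrite -(bigcup_mkord _ (fun n => (r n).1 `*` (r n).2)).
  by exists n => /=.
exists [seq r k | k <- iota 0 n]; rewrite big_map -[n in iota 0 n]subn0 -/(index_iota 0 n).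
rewrite big_mkord; split=> //.
- by move=> _ /mapP[k _ ->].
- by rewrite -(bigcup_mkord _ (fun n => (r n).1 `*` (r n).2)) Gr => z [k _ zk]; exists k.
Qed.

End OpenProduct.

(* An alias of the product, which carries the semiring of measurable rectangles
   instead of the product sigma-algebra. *)
Definition rectangle_type (T1 T2 : Type) : Type := (T1 * T2)%type.
Definition rectangle_display d1 d2 (T1 : measurableType d1)
  (T2 : measurableType d2) : measure_display := (d1, d2).-prod%mdisp.

Section Rectangles.
Context {d1 d2} {T1 : measurableType d1} {T2 : measurableType d2}.
Local Notation rT := (rectangle_type T1 T2).

HB.instance Definition _ := Pointed.on rT.

Definition rectangles : set (set rT) :=
  [set A `*` B | A in measurable & B in measurable].

Let rectangles0 : rectangles set0.
Proof. by exists set0 => //; exists set0 => //; rewrite set0X. Qed.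

Let rectanglesI : setI_closed rectangles.
Proof.
move=> _ _ [A mA [B mB <-]] [C mC [D mD <-]]; rewrite -setXI.
exists (A `&` C); first exact: measurableI.
by exists (B `&` D) => //; exact: measurableI.
Qed.

Let rectanglesD : semi_setD_closed rectangles.
Proof.
move=> _ _ [A mA [B mB <-]] [C mC [D mD <-]].
exists [set (A `\` C) `*` B; (A `&` C) `*` (B `\` D)]; split.
- exact: finite_set2.
- move=> _ [->|->]; [exists (A `\` C)|exists (A `&` C)].
  + exact: measurableD.
  + by exists B.
  + exact: measurableI.
  + by exists (B `\` D) => //; exact: measurableD.
- rewrite bigcup_setU !bigcup_set1; apply/seteqP; split=> [[x y]|[x y]] /=.
    move=> [[Ax By] nCD]; have [Cx|nCx] := pselect (C x); last by left.
    by right; split=> //; split=> // Dy; exact: nCD.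
  by move=> [[[Ax nCx] By]|[[Ax Cx] [By nDy]]]; split=> // -[].
- move=> _ _ [->|->] [->|->]//.
  + by move=> [[x y] /= [[[_ nCx] _] [[_ Cx] _]]].
  + by move=> [[x y] /= [[[_ Cx] _] [[_ nCx] _]]].
Qed.

HB.instance Definition _ := @isSemiRingOfSets.Build
  (rectangle_display T1 T2) rT rectangles rectangles0 rectanglesI rectanglesD.

End Rectangles.

Lemma open_setX {X Y : topologicalType} (U : set X) (V : set Y) :
  open U -> open V -> open (U `*` V).
Proof.
move=> oU oV.
have -> : U `*` V = fst @^-1` U `&` snd @^-1` V by [].
apply: openI; apply: open_comp => // x _; [exact: cvg_fst|exact: cvg_snd].
Qed.

Section CouplingRectangles.
Context {R : realType} {d : nat}.
Local Notation E := 'rV[R]_d.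
Variables (mu nu : probability E R) (pi : probability (E * E)%type R).
Hypothesis cpi : coupling mu nu pi.

(** A point outside Y1 x Y2 is outside in one coordinate, so the loss is controlled by the marginals
    alone, hence uniformly over all couplings. *)
Lemma coupling_rectangle_le (X1 X2 Y1 Y2 : set E) (a b : R) :
  measurable X1 -> measurable X2 -> measurable Y1 -> measurable Y2 ->
  (mu (X1 `\` Y1) < a%:E)%E -> (nu (X2 `\` Y2) < b%:E)%E ->
  fine (pi (X1 `*` X2)) <= fine (pi (Y1 `*` Y2)) + (a + b).
Proof.
move=> mX1 mX2 mY1 mY2 mua nub.
have mD1 : measurable (X1 `\` Y1) by exact: measurableD.
have mD2 : measurable (X2 `\` Y2) by exact: measurableD.
have [e1 _] := cpi mD1; have [_ e2] := cpi mD2.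
have m1 : measurable (fst @^-1` (X1 `\` Y1) : set (E * E)).
  by rewrite -[X in measurable X]setTI; exact: measurable_fst.
have m2 : measurable (snd @^-1` (X2 `\` Y2) : set (E * E)).
  by rewrite -[X in measurable X]setTI; exact: measurable_snd.
have mX : measurable (X1 `*` X2) by exact: measurableX.
have mY : measurable (Y1 `*` Y2) by exact: measurableX.
rewrite -lee_fin !EFinD !fineK ?fin_num_measure //.
apply: (@le_trans _ _ (pi (Y1 `*` Y2 `|` (fst @^-1` (X1 `\` Y1) `|` snd @^-1` (X2 `\` Y2))))).
  apply: le_measure; rewrite ?inE //.
    by apply: measurableU => //; exact: measurableU.
  move=> [x y] [/= Xx Xy]; have [Yx|nYx] := pselect (Y1 x); last by right; left.
  by have [Yy|nYy] := pselect (Y2 y); [left|right; right].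
apply: le_trans (measureU2 _ mY (measurableU _ _ m1 m2)) _.
rewrite leeD2l //; apply: le_trans (measureU2 _ m1 m2) _.
by rewrite -e1 in mua; rewrite -e2 in nub; apply: leeD; exact: ltW.
Qed.

End CouplingRectangles.

(* The masses p n S have a cluster point in [0,1]^(sets).  It is additive on rectangles;
   countable additivity there follows from the regularity of the two fixed marginals,
   and Caratheodory's extension gives a coupling. *)
Section ClusterPlan.
Context {R : realType} {d : nat}.
Local Notation E := 'rV[R]_d.
Local Notation plan := (probability (E * E)%type R).
Variables (mu nu : probability E R) (p : nat -> plan).
Hypothesis p_coupling : forall n, coupling mu nu (p n).

(** The value 0 on non-measurable sets keeps the masses in [0,1] on every set, as Tychonoff's
    theorem requires. *)
Let mass n (S : set (E * E)) : R :=
  if `[< measurable S >] then fine (p n S) else 0.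

Let mass01 n S : 0 <= mass n S <= 1.
Proof.
rewrite /mass; case: asboolP => [mS|_]; last by rewrite lexx ler01.
rewrite fine_ge0 //= -lee_fin fineK; last exact: fin_num_measure.
exact: probability_le1.
Qed.

Definition cluster_mass : set (E * E) -> R := sval (cid (pointwise_cluster mass01)).

Lemma cluster_massP (s : seq (set (E * E))) (e : R) (N : nat) : 0 < e ->
  (forall S, S \in s -> measurable S) ->
  exists2 n, (N <= n)%N & forall S, S \in s -> `|fine (p n S) - cluster_mass S| < e.
Proof.
move=> e0 ms; have [n Nn nP] := (svalP (cid (pointwise_cluster mass01))) s e N e0.
exists n => // S Ss; have := nP S Ss.
by rewrite /mass; case: asboolP => // nS; have := nS (ms S Ss).
Qed.

Lemma cluster_mass_ge0 S : 0 <= cluster_mass S.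
Proof.
apply: ler_eps => e e0.
have [n _ /(_ S)] := (svalP (cid (pointwise_cluster mass01))) [:: S] e 0%N e0.
rewrite inE eqxx => /(_ isT); rewrite ltr_norml => /andP[_ +].
have /andP[+ _] := mass01 n S; rewrite /cluster_mass; lra.
Qed.

Lemma cluster_mass_additive (F : nat -> set (E * E)) N :
  (forall k, measurable (F k)) -> trivIset [set: nat] F ->
  cluster_mass (\big[setU/set0]_(k < N) F k) = \sum_(k < N) cluster_mass (F k).
Proof.
move=> mF tF; set U := \big[setU/set0]_(k < N) F k.
have mU : measurable U by exact: bigsetU_measurable.
apply/eqP; rewrite -subr_eq0 -normr_le0; apply: ler_eps => e e0; rewrite add0r.
(* N + 1 masses are compared at one common index: that of U and those of the N pieces. *)
have e'0 : 0 < e / N.+1%:R by rewrite divr_gt0.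
have [|n _ nP] := @cluster_massP (U :: [seq F k | k <- iota 0 N]) _ 0%N e'0.
  by move=> S; rewrite inE => /predU1P[->//|/mapP[k _ ->]].
have nF k : (k < N)%N -> `|fine (p n (F k)) - cluster_mass (F k)| <= e / N.+1%:R.
  move=> kN; apply/ltW/nP; rewrite inE; apply/orP; right; apply: map_f.
  by rewrite mem_iota.
have -> : cluster_mass U - \sum_(k < N) cluster_mass (F k) =
    - (fine (p n U) - cluster_mass U) +
    \sum_(k < N) (fine (p n (F k)) - cluster_mass (F k)).
  have -> : fine (p n U) = \sum_(k < N) fine (p n (F k)).
    apply: EFin_inj; rewrite -sumEFin fineK ?fin_num_measure //.
    rewrite /U measure_semi_additive //.
    by apply: eq_bigr => k _; rewrite fineK // fin_num_measure.
  rewrite sumrB; ring.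
apply: (le_trans (ler_normD _ _)); rewrite normrN.
have eE : e = e / N.+1%:R + \sum_(k < N) (e / N.+1%:R).
  by rewrite sumr_const card_ord -mulrS -[RHS]mulr_natr divfK // pnatr_eq0.
rewrite [leRHS]eE lerD //; first by apply/ltW/nP; rewrite inE eqxx.
apply: (le_trans (ler_norm_sum _ _ _)); apply: ler_sum => k _; exact: nF.
Qed.

Definition cluster_content (S : set (rectangle_type E E)) : \bar R :=
  (cluster_mass S)%:E.

Let measurable_rectangle (S : set (rectangle_type E E)) :
  measurable S -> measurable (S : set (E * E)).
Proof. by move=> [A mA [B mB <-]]; exact: measurableX. Qed.

Let content_ge0 S : (0 <= cluster_content S)%E.
Proof. by rewrite lee_fin cluster_mass_ge0. Qed.

Let content_additive : measure_function.semi_additive cluster_content.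
Proof.
move=> F N mF tF _; rewrite /cluster_content cluster_mass_additive ?sumEFin //.
by move=> k; exact: measurable_rectangle.
Qed.

HB.instance Definition _ := isContent.Build _ _ _ cluster_content
  content_ge0 content_additive.

(** Compactness makes the countable cover finite: A1 x A2 is shrunk to a compact rectangle, each F n
    is enlarged to an open one, and subadditivity is applied to a single p n close to the cluster
    mass. Regularity of mu and nu prices these changes uniformly over the p n. *)
Let content_sigma_subadditive :
  measurable_subset_sigma_subadditive cluster_content.
Proof.
move=> _ F mF [A1 mA1 [A2 mA2 <-]] AF; rewrite -/(A1 `*` A2).
(* Six shares: one to pass from the cluster mass of A1 x A2 to p n, two for the compact sides K1 and
   K2, two for the open sides U and V, one to return to the cluster masses of the F k. *)
apply/lee_addgt0Pr => /= e e0; set h := e / 6.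
have h0 : 0 < h by rewrite divr_gt0.
have [K1 [cK1 KA1 muK1]] := compact_approx mu mA1 h0.
have [K2 [cK2 KA2 muK2]] := compact_approx nu mA2 h0.
have hn0 n : 0 < h / (2 ^ n.+1)%:R by rewrite divr_gt0 // ltr0n expn_gt0.
have /choice[B BP] : forall n, exists B : set E * set E,
    [/\ measurable B.1, measurable B.2 & B.1 `*` B.2 = F n].
  by move=> n; have [B1 mB1 [B2 mB2 BF]] := mF n; exists (B1, B2).
have /choice[U UP] : forall n, exists U : set E,
    [/\ open U, (B n).1 `<=` U & (mu (U `\` (B n).1) < (h / (2 ^ n.+1)%:R)%:E)%E].
  by move=> n; have [mB _ _] := BP n; exact: open_approx.
have /choice[V VP] : forall n, exists V : set E,
    [/\ open V, (B n).2 `<=` V & (nu (V `\` (B n).2) < (h / (2 ^ n.+1)%:R)%:E)%E].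
  by move=> n; have [_ mB _] := BP n; exact: open_approx.
have mU n : measurable (U n) by apply: measurable_open; have [] := UP n.
have mV n : measurable (V n) by apply: measurable_open; have [] := VP n.
have [D _ KD] : finite_subset_cover setT (fun n => U n `*` V n) (K1 `*` K2).
  pose EE : ptopologicalType := HB.pack (E * E)%type.
  have := compact_setX cK1 cK2; rewrite (@compact_cover EE); apply.
    by move=> n _; apply: open_setX; [have [] := UP n|have [] := VP n].
  move=> [x y] [/KA1 Ax /KA2 Ay]; have [//|n _] := AF (x, y).
  have [_ _ <-] := BP n => -[Bx By]; exists n => //.
  by split; [have [_ + _] := UP n; exact|have [_ + _] := VP n; exact].
pose N := (\max_(i <- finmap.enum_fset D) i).+1.
have {}KD : K1 `*` K2 `<=` \big[setU/set0]_(n < N) (U n `*` V n).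
  move=> z /KD[n /= nD UVz]; rewrite -(bigcup_mkord _ (fun n => U n `*` V n)).
  by exists n => //=; rewrite ltnS; exact: (@leq_bigmax_seq _ _ xpredT id).
have d0 : 0 < h / N.+1%:R by rewrite divr_gt0.
have [|n _ nP] := @cluster_massP ((A1 `*` A2) :: [seq F k | k <- iota 0 N]) _ 0%N d0.
  move=> S; rewrite inE => /predU1P[->|/mapP[k _ ->]]; first exact: measurableX.
  by apply: measurable_rectangle; exact: mF.
have lA : cluster_mass (A1 `*` A2) <= fine (p n (A1 `*` A2)) + h.
  have := nP (A1 `*` A2); rewrite inE eqxx => /(_ isT).
  rewrite ltr_norml => /andP[+ _].
  have : h / N.+1%:R <= h by rewrite ler_pdivrMr // ler_peMr ?ler1n // ltW.
  move: (h / N.+1%:R) (fine _) (cluster_mass _) => *; lra.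
have pF (k : 'I_N) : fine (p n (F k)) <= cluster_mass (F k) + h / N.+1%:R.
  have /nP : F k \in (A1 `*` A2) :: [seq F k | k <- iota 0 N].
    by rewrite inE; apply/orP; right; apply: map_f; rewrite mem_iota /=.
  rewrite ltr_norml => /andP[_].
  move: (h / N.+1%:R) (fine _) (cluster_mass _) => *; lra.
have pA : fine (p n (A1 `*` A2)) <= fine (p n (K1 `*` K2)) + (h + h).
  by apply: (coupling_rectangle_le (p_coupling n)) => //; apply: measurable_closed;
    apply: compact_closed => //; exact: norm_hausdorff.
have pK : fine (p n (K1 `*` K2)) <= \sum_(k < N) fine (p n (U k `*` V k)).
  rewrite -lee_fin -sumEFin fineK; last first.
    apply: fin_num_measure; apply: measurableX; apply: measurable_closed;
    by apply: compact_closed => //; exact: norm_hausdorff.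
  have mUV k : measurable (U k `*` V k) by exact: measurableX.
  under eq_bigr do rewrite (fineK (fin_num_measure (p n) _ (mUV _))).
  apply: le_trans (Boole_inequality (p n) (fun k _ => mUV k)).
  apply: le_measure; rewrite ?inE //.
    apply: measurableX; apply: measurable_closed;
    by apply: compact_closed => //; exact: norm_hausdorff.
  by apply: bigsetU_measurable => k _; exact: measurableX.
have pU (k : 'I_N) : fine (p n (U k `*` V k)) <=
    fine (p n (F k)) + (h / (2 ^ k.+1)%:R + h / (2 ^ k.+1)%:R).
  have [m1 m2 <-] := BP k; have [_ _ ?] := UP k; have [_ _ ?] := VP k.
  exact: (coupling_rectangle_le (p_coupling n)).
have geo : \sum_(k < N) h / (2 ^ k.+1)%:R <= h.
  rewrite -lee_fin -sumEFin; apply: le_trans (geometric_nneseries_le (ltW h0)).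
  rewrite -(big_mkord xpredT (fun k => (h / (2 ^ k.+1)%:R)%:E)).
  by apply: nneseries_lim_ge => k _ _; rewrite lee_fin ltW.
have sumF : \sum_(k < N) (h / N.+1%:R) <= h.
  rewrite sumr_const card_ord -mulrnAl -mulr_natr -mulrA ler_piMr ?(ltW h0) //.
  by rewrite ler_pdivrMr // mul1r ler_nat.
have fin : cluster_mass (A1 `*` A2) <= \sum_(k < N) cluster_mass (F k) + e.
  have : \sum_(k < N) fine (p n (U k `*` V k)) <= \sum_(k < N)
      (cluster_mass (F k) + h / N.+1%:R + (h / (2 ^ k.+1)%:R + h / (2 ^ k.+1)%:R)).
    by apply: ler_sum => k _; apply: le_trans (pU k) _; rewrite lerD2r.
  rewrite !big_split /=.
  have -> : e = h * 6 by rewrite /h divfK.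
  lra.
apply: (@le_trans _ _ (\sum_(0 <= k < N) cluster_content (F k) + e%:E)%E).
  by rewrite /cluster_content sumEFin -EFinD lee_fin big_mkord.
rewrite leeD2r //; apply: nneseries_lim_ge => k _ _; exact: content_ge0.
Qed.

HB.instance Definition _ := Content_SigmaSubAdditive_isMeasure.Build _ _ _
  cluster_content content_sigma_subadditive.

Definition cluster_plan (S : set (E * E)) : \bar R :=
  measure_extension cluster_content S.

Let measurable_prodE (S : set (E * E)) : measurable S ->
  measurable (S : set (g_sigma_algebraType (@measurable _ (rectangle_type E E)))).
Proof. by rewrite measurable_prod_measurableType. Qed.

Let plan0 : cluster_plan set0 = 0%E.
Proof. exact: measure0. Qed.

Let plan_ge0 S : (0 <= cluster_plan S)%E.
Proof. exact: measure_ge0. Qed.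

Let plan_sigma_additive : semi_sigma_additive cluster_plan.
Proof.
move=> F mF tF mUF;
apply: (@measure_semi_sigma_additive _ _ _ (measure_extension cluster_content)) => //.
- by move=> n; apply: measurable_prodE.
- exact: measurable_prodE.
Qed.

HB.instance Definition _ := isMeasure.Build _ _ _ cluster_plan
  plan0 plan_ge0 plan_sigma_additive.

Lemma cluster_plan_rectangle (A B : set E) : measurable A -> measurable B ->
  cluster_plan (A `*` B) = (cluster_mass (A `*` B))%:E.
Proof.
move=> mA mB; apply: (@measurable_mu_extE _ _ _ cluster_content).
by exists A => //; exists B.
Qed.

Lemma cluster_mass_const (S : set (E * E)) (r : R) : measurable S ->
  (forall n, p n S = r%:E) -> cluster_mass S = r.
Proof.
move=> mS pS.
have H e : 0 < e -> `|r - cluster_mass S| < e.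
  move=> e0; have [|n _ /(_ S)] := @cluster_massP [:: S] _ 0%N e0.
    by move=> S'; rewrite inE => /eqP ->.
  by rewrite inE eqxx pS; exact.
apply/eqP; rewrite eq_sym -subr_eq0 -normr_le0; apply: ler_eps => e e0.
by rewrite add0r ltW // H.
Qed.

Let plan_setT : cluster_plan setT = 1%E.
Proof.
rewrite -setXTT cluster_plan_rectangle // (cluster_mass_const (r := 1)) //.
  by rewrite setXTT.
by move=> n; rewrite setXTT probability_setT.
Qed.

HB.instance Definition _ :=
  Measure_isProbability.Build _ _ _ cluster_plan plan_setT.

Lemma cluster_plan_coupling : coupling mu nu cluster_plan.
Proof.
move=> A mA; split; rewrite /pushforward.
- transitivity (cluster_mass (A `*` setT))%:E.
    by rewrite -setXT; exact: cluster_plan_rectangle.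
  rewrite (cluster_mass_const (r := fine (mu A))) ?fineK ?fin_num_measure //.
    exact: measurableX.
  by move=> n; rewrite setXT; have [<-] := p_coupling n mA.
- transitivity (cluster_mass (setT `*` A))%:E.
    by rewrite -setTX; exact: cluster_plan_rectangle.
  rewrite (cluster_mass_const (r := fine (nu A))) ?fineK ?fin_num_measure //.
    exact: measurableX.
  by move=> n; rewrite setTX; have [_ <-] := p_coupling n mA.
Qed.

Lemma cluster_massUI (A B : set (E * E)) : measurable A -> measurable B ->
  cluster_mass (A `|` B) =
  cluster_mass A + cluster_mass B - cluster_mass (A `&` B).
Proof.
move=> mA mB; have mAB := measurableU _ _ mA mB; have mI := measurableI _ _ mA mB.
apply/eqP; rewrite -subr_eq0 -normr_le0; apply: ler_eps => e e0; rewrite add0r.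
have e4 : 0 < e / 4 by rewrite divr_gt0.
have [|n _ nP] := @cluster_massP [:: A; B; A `|` B; A `&` B] _ 0%N e4.
  by move=> S; rewrite !inE => /or4P[] /eqP ->.
have pU : fine (p n (A `|` B)) =
    fine (p n A) + fine (p n B) - fine (p n (A `&` B)).
  apply: EFin_inj; rewrite EFinB EFinD !fineK ?fin_num_measure //.
  by rewrite probability_setUI.
have := nP A; have := nP B; have := nP (A `|` B); have := nP (A `&` B).
rewrite !inE !eqxx !orbT !orTb => /(_ isT) + /(_ isT) + /(_ isT) + /(_ isT).
rewrite pU !ltr_norml ler_norml => /andP[? ?] /andP[? ?] /andP[? ?] /andP[? ?].
apply/andP; split; lra.
Qed.

Lemma cluster_plan_bigcup (s : seq (set E * set E)) :
  (forall r, r \in s -> measurable r.1 /\ measurable r.2) ->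
  cluster_plan (\big[setU/set0]_(r <- s) (r.1 `*` r.2)) =
  (cluster_mass (\big[setU/set0]_(r <- s) (r.1 `*` r.2)))%:E.
Proof.
move=> ms.
have mbig s' : (forall r, r \in s' -> measurable r.1 /\ measurable r.2) ->
    measurable (\big[setU/set0]_(r <- s') (r.1 `*` r.2) : set (E * E)).
  move=> ms'; rewrite big_seq_cond; apply: bigsetU_measurable => r /andP[rs _].
  by have [? ?] := ms' r rs; exact: measurableX.
(* Inclusion-exclusion meets the intersection of the head rectangle with the remaining union, so the
   induction carries an arbitrary intersecting rectangle. *)
suff H (A B : set E) : measurable A -> measurable B ->
    cluster_plan ((A `*` B) `&` \big[setU/set0]_(r <- s) (r.1 `*` r.2)) =
    (cluster_mass ((A `*` B) `&` \big[setU/set0]_(r <- s) (r.1 `*` r.2)))%:E.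
  by have := H setT setT measurableT measurableT; rewrite setXTT setTI.
elim: s ms A B => [|[C D] s IHs] ms A B mA mB.
  rewrite big_nil setI0 measure0 (cluster_mass_const (r := 0)) // => n.
  by rewrite measure0.
have [mC mD] : measurable C /\ measurable D by apply: (ms (C, D)); rewrite inE eqxx.
have {}ms r : r \in s -> measurable r.1 /\ measurable r.2.
  by move=> rs; apply: ms; rewrite inE rs orbT.
rewrite big_cons setIUr /=.
have ABCD : A `*` B `&` C `*` D = (A `&` C) `*` (B `&` D) by rewrite setXI.
set U := \big[setU/set0]_(r <- s) _ in IHs *.
have mU : measurable U by exact: mbig.
have mAC := measurableI _ _ mA mC; have mBD := measurableI _ _ mB mD.
have mR1 : measurable ((A `&` C) `*` (B `&` D) : set (E * E)) by exact: measurableX.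
have mR2 : measurable (A `*` B `&` U : set (E * E)).
  by apply: measurableI => //; exact: measurableX.
have II : (A `&` C) `*` (B `&` D) `&` (A `*` B `&` U) =
    (A `&` C) `*` (B `&` D) `&` U.
  by rewrite -ABCD; apply/seteqP; split=> z [[? ?]] => [[? ?]|?].
rewrite ABCD cluster_massUI // probability_setUI // II.
by rewrite /= cluster_plan_rectangle // !IHs // EFinB EFinD.
Qed.

(** A finite union of rectangles inside G carries nearly all the plan's mass of G, and there the
    plan and p n nearly agree. What p n puts on the rest of G is only known to be nonnegative, hence
    the one-sided inequality. *)
Lemma cluster_plan_open (s : seq (set (E * E))) (e : R) (N : nat) : 0 < e ->
  (forall G, G \in s -> open G) ->
  exists2 n, (N <= n)%N &
    forall G, G \in s -> (cluster_plan G <= p n G + e%:E)%E.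
Proof.
move=> e0 os; have e2 : 0 < e / 2 by rewrite divr_gt0.
have /choice[S SP] : forall G, exists S : set (E * E), G \in s ->
    [/\ measurable S, S `<=` G, (cluster_plan (G `\` S) < (e / 2)%:E)%E &
       cluster_plan S = (cluster_mass S)%:E].
  move=> G; have [Gs|nGs] := boolP (G \in s); last by exists set0.
  have [t [mt tG Pt]] := open_rectangles_approx cluster_plan (os G Gs) e2.
  exists (\big[setU/set0]_(r <- t) (r.1 `*` r.2)) => _; split=> //.
    rewrite big_seq_cond; apply: bigsetU_measurable => r /andP[rt _].
    by have [? ?] := mt r rt; exact: measurableX.
  exact: cluster_plan_bigcup.
have [|n Nn nP] := @cluster_massP [seq S G | G <- s] _ N e2.
  by move=> _ /mapP[G /SP[? _ _ _] ->].
exists n => // G Gs; have [mS SG PS lS] := SP G Gs.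
have mG := measurable_open_prod (os G Gs).
have -> : cluster_plan G = (cluster_plan (G `\` S G) + cluster_plan (S G))%E.
  rewrite -measureU //=; last 2 first.
  - exact: measurableD.
  - by rewrite setDKI.
  by rewrite setUC setDUK.
have PSG : (p n (S G) <= p n G)%E by apply: le_measure; rewrite ?inE.
rewrite lS; have := nP (S G) (map_f _ Gs); rewrite ltr_norml => /andP[pl _].
have pG : (p n (S G) = (fine (p n (S G)))%:E)%E by rewrite fineK ?fin_num_measure.
apply: (@le_trans _ _ ((e / 2)%:E + (fine (p n (S G)) + e / 2)%:E)%E).
  by apply: leeD; [exact: ltW|rewrite lee_fin; lra].
apply: (@le_trans _ _ (p n (S G) + e%:E)%E); last by rewrite leeD2r.
by rewrite pG -!EFinD lee_fin; lra.
Qed.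

End ClusterPlan.

(* Layer-cake approximation of c by a sum of indicators of {h j < c}: for a continuous
   cost these sets are open, which is all the cluster plan controls. *)
Section Staircase.
Context {R : realType}.
Implicit Types (c h : R) (K : nat).

Definition staircase h K c : R := \sum_(j < K) h * (j.+1%:R * h < c)%R%:R.

Lemma staircaseS h K c :
  staircase h K.+1 c = staircase h K c + h * (K.+1%:R * h < c)%R%:R.
Proof. by rewrite /staircase big_ord_recr. Qed.

Lemma staircase_full h K c : 0 < h -> K%:R * h < c -> staircase h K c = K%:R * h.
Proof.
move=> h0; elim: K => [|K IHK] Kc; first by rewrite /staircase big_ord0 mul0r.
rewrite staircaseS Kc mulr1 IHK; first by rewrite -natr1; ring.
by apply: le_lt_trans Kc; rewrite ler_pM2r // ler_nat.
Qed.

Lemma staircase_le h K c : 0 < h -> 0 <= c -> staircase h K c <= c.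
Proof.
move=> h0 c0; elim: K => [|K IHK]; first by rewrite /staircase big_ord0.
have [Kc|Kc] := ltP (K.+1%:R * h) c; first by rewrite staircase_full // ltW.
by rewrite staircaseS ltNge Kc mulr0 addr0.
Qed.

Lemma staircase_ge h K c : 0 < h -> 0 <= c ->
  Num.min c (K%:R * h) <= staircase h K c + h.
Proof.
move=> h0 c0; elim: K => [|K IHK].
  by rewrite /staircase big_ord0 mul0r ge_min add0r (ltW h0) orbT.
have [Kc|Kc] := ltP (K.+1%:R * h) c.
  by rewrite staircase_full // lerDl ltW.
rewrite staircaseS ltNge Kc mulr0 addr0.
have [cK|cK] := ltP (K%:R * h) c.
  by rewrite staircase_full // -[X in _ + X]mul1r -mulrDl natr1.
by move: IHK; rewrite min_l.
Qed.

End Staircase.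

Section OptimalPlan.
Context {R : realType} {d : nat}.
Local Notation E := 'rV[R]_d.
Implicit Types (mu nu : probability E R) (pi : probability (E * E)%type R).

Lemma sqnorm_ge0 (x : E) : 0 <= sqnorm x.
Proof. by apply: sumr_ge0 => i _; rewrite -expr2 sqr_ge0. Qed.

Lemma measurable_cost : measurable_fun [set: E * E] (fun z => sqnorm (z.1 - z.2)).
Proof.
apply: measurable_sqnorm; apply: measurable_funB_rV; [exact: measurable_fst|exact: measurable_snd].
Qed.

Lemma continuous_cost : continuous (fun z : E * E => sqnorm (z.1 - z.2)).
Proof.
move=> z; rewrite /sqnorm /dot.
apply: (@cvg_big _ _ _ _ _ (@add_continuous R^o)) => i _.
have c : {for z, continuous (fun x : E * E => (x.1 - x.2) 0 i)}.
  have -> : (fun x : E * E => (x.1 - x.2) 0 i) = (fun x => x.1 0 i - x.2 0 i).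
    by apply/funext => x; rewrite !mxE.
  apply: (@cvgB _ R^o).
    exact: (@continuous_comp _ _ _ (@fst E E) (fun x : E => x 0 i) z cvg_fst
      (@coord_continuous _ _ _ 0 i _)).
  exact: (@continuous_comp _ _ _ (@snd E E) (fun x : E => x 0 i) z cvg_snd
    (@coord_continuous _ _ _ 0 i _)).
exact: (@cvgM R _ _ _ _ _ _ _ c c).
Qed.

Lemma open_cost_gt (t : R) : open [set z : E * E | t < sqnorm (z.1 - z.2)].
Proof.
apply: (@open_comp _ _ (fun z : E * E => sqnorm (z.1 - z.2)) [set r | t < r]).
  by move=> z _; exact: continuous_cost.
exact: open_gt.
Qed.

Lemma product_coupling mu nu : coupling mu nu (mu \x nu)%E.
Proof.
move=> A mA; rewrite /pushforward -setXT -setTX.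
split.
  by rewrite -[RHS]mule1 -(probability_setT nu); exact: product_measure1E.
by rewrite -[RHS]mul1e -(probability_setT mu); exact: product_measure1E.
Qed.

Lemma measurable_cost_gt (t : R) :
  measurable [set z : E * E | t < sqnorm (z.1 - z.2)].
Proof. exact: (measurable_open_prod (@open_cost_gt t)). Qed.

Lemma staircase_indic (h : R) K (z : E * E) :
  staircase h K (sqnorm (z.1 - z.2)) = \sum_(j < K)
    h * \1_[set z : E * E | j.+1%:R * h < sqnorm (z.1 - z.2)] z.
Proof.
apply: eq_bigr => j _; rewrite indicE; congr (_ * _); congr (_%:R); congr nat_of_bool.
by apply/idP/idP => [H|/set_mem//]; exact/mem_set.
Qed.

Lemma measurable_staircase (h : R) K :
  measurable_fun [set: E * E] (fun z => staircase h K (sqnorm (z.1 - z.2))).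
Proof.
under eq_fun do rewrite staircase_indic.
apply: measurable_sum => j; apply: measurable_funM => //.
by apply: measurable_indic; exact: measurable_cost_gt.
Qed.

Lemma integral_staircase pi (h : R) K : 0 < h ->
  (\int[pi]_z (staircase h K (sqnorm (z.1 - z.2)))%:E =
   \sum_(j < K) h%:E * pi [set z | (j.+1%:R * h < sqnorm (z.1 - z.2))%R])%E.
Proof.
move=> h0; under eq_integral do rewrite staircase_indic -sumEFin.
have mG := measurable_cost_gt.
rewrite ge0_integral_sum //.
- apply: eq_bigr => j _; under eq_integral do rewrite EFinM.
  rewrite ge0_integralZl ?integral_indic ?setIT //.
  - by apply/measurable_EFinP; exact: measurable_indic.
  - by rewrite lee_fin ltW.
- by move=> j; apply/measurable_EFinP; apply: measurable_funM.
- by move=> j z _; rewrite lee_fin mulr_ge0 // ltW.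
Qed.

(* One half of the portmanteau theorem, with a cluster point instead of a limit. *)
Definition open_le (P : probability (E * E)%type R)
    (p : nat -> probability (E * E)%type R) :=
  forall (s : seq (set (E * E))) (e : R) (N : nat), 0 < e ->
    (forall G, G \in s -> open G) ->
    exists2 n, (N <= n)%N & forall G, G \in s -> (P G <= p n G + e%:E)%E.

(** Truncation at M leaves finitely many layers, so only finitely many open sets have to be
    controlled at a common index. *)
Lemma open_le_cost_min P (p : nat -> probability (E * E)%type R) (w M : R) :
  open_le P p -> 0 <= M ->
  (forall n, transport_cost (p n) <= (w + n.+1%:R^-1)%:E)%E ->
  (\int[P]_z (Num.min (sqnorm (z.1 - z.2)) M)%:E <= w%:E)%E.
Proof.
(* One share for the layer-cake error, one for the masses of the open sets, one for the excess
   1/(n+1) of the costs over w. *)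
move=> Pp M0 pw; apply/lee_addgt0Pr => /= e e0; set h := e / 3.
have h0 : 0 < h by rewrite divr_gt0.
pose K := (Num.truncn (M / h)).+1.
have MK : M <= K%:R * h by rewrite -ler_pdivrMr // ltW // truncnS_gt.
have Kh0 : 0 < K%:R * h by rewrite mulr_gt0.
have [N hN] : exists N : nat, N.+1%:R^-1 < h.
  by have /ltr_add_invr [N] := h0; rewrite add0r => ?; exists N.
pose G j := [set z : E * E | j.+1%:R * h < sqnorm (z.1 - z.2)].
(* An error 1/K per open set, weighted by the step h and summed over the K layers, amounts to h. *)
have eta0 : 0 < h / (K%:R * h) by rewrite divr_gt0.
have [|n Nn nP] := Pp [seq G j | j <- iota 0 K] _ N eta0.
  by move=> _ /mapP[j _ ->]; exact: open_cost_gt.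
have mstair : measurable_fun setT (fun z : E * E => (staircase h K (sqnorm (z.1 - z.2)))%:E).
  by apply/measurable_EFinP; exact: measurable_staircase.
have stair0 (z : E * E) : (0 <= (staircase h K (sqnorm (z.1 - z.2)))%:E)%E.
  by rewrite lee_fin sumr_ge0 // => j _; rewrite mulr_ge0 // ltW.
apply: (@le_trans _ _ (\int[P]_z
    ((staircase h K (sqnorm (z.1 - z.2)))%:E + h%:E))%E).
  apply: ge0_le_integral => //.
  - by move=> z _; rewrite lee_fin le_min sqnorm_ge0.
  - by apply/measurable_EFinP; apply: measurable_minr => //; exact: measurable_cost.
  - exact: emeasurable_funD.
  - move=> z _; rewrite -EFinD lee_fin.
    apply: le_trans (staircase_ge _ h0 (sqnorm_ge0 _)).
    by rewrite le_min ge_min lexx ge_min MK orbT.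
rewrite ge0_integralD //; last by move=> z _; rewrite lee_fin ltW.
have -> : (\int[P]_z h%:E = h%:E)%E.
  transitivity (h%:E * P setT)%E; first exact: integral_cst.
  by rewrite probability_setT mule1.
rewrite integral_staircase //.
apply: (@le_trans _ _ (\sum_(j < K) (h%:E * p n (G j) + (h * (h / (K%:R * h)))%:E) + h%:E)%E).
  apply: leeD => //; apply: lee_sum => j _.
  have -> : (h%:E * p n (G j) + (h * (h / (K%:R * h)))%:E =
      h%:E * (p n (G j) + (h / (K%:R * h))%:E))%E.
    by rewrite ge0_muleDr // lee_fin ltW.
  rewrite lee_pmul2l // ?lte_fin //; apply: (nP (G j)).
  by apply: (map_f G); rewrite mem_iota /=.
rewrite big_split /= -(integral_staircase _ _ h0).
have -> : (\sum_(j < K) (h * (h / (K%:R * h)))%:E = h%:E :> \bar R)%E.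
  rewrite sumEFin sumr_const card_ord -mulr_natl; congr EFin; field.
  by rewrite gt_eqF //= pnatr_eq0.
have -> : (w%:E + e%:E = w%:E + h%:E + h%:E + h%:E)%E.
  by rewrite -!EFinD /h; congr EFin; field.
rewrite leeD2r // leeD2r //.
apply: (@le_trans _ _ (transport_cost (p n))).
  apply: ge0_le_integral => //.
  - by apply/measurable_EFinP; exact: measurable_cost.
  - by move=> z _; rewrite lee_fin staircase_le // sqnorm_ge0.
apply: (le_trans (pw n)); rewrite -EFinD lee_fin lerD2l.
apply: le_trans (ltW hN); rewrite lef_pV2 ?posrE ?ltr0n // ler_nat //.
Qed.

(** Lower semicontinuity of the cost, by monotone convergence in the truncation level. *)
Lemma open_le_cost P (p : nat -> probability (E * E)%type R) (w : R) :
  open_le P p -> (forall n, transport_cost (p n) <= (w + n.+1%:R^-1)%:E)%E ->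
  (transport_cost P <= w%:E)%E.
Proof.
move=> Pp pw; pose g n (z : E * E) := (Num.min (sqnorm (z.1 - z.2)) n%:R)%:E.
have -> : transport_cost P =
    (\int[P]_z (limn (g^~ z)))%E.
  apply: eq_integral => z _; apply/esym/cvg_lim => //.
  apply: cvg_near_cst; exists (Num.truncn (sqnorm (z.1 - z.2))).+1 => // n /= Nn.
  rewrite /g min_l //; apply: (le_trans (ltW (truncnS_gt _))).
  by rewrite ler_nat.
have mg n : measurable_fun setT (g n).
  by apply/measurable_EFinP; apply: measurable_minr => //; exact: measurable_cost.
have g0 n z : setT z -> (0 <= g n z)%E.
  by move=> _; rewrite lee_fin le_min sqnorm_ge0 /=.
have gm z : setT z -> {homo g^~ z : n m / (n <= m)%N >-> (n <= m)%E}.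
  move=> _ n m nm; rewrite lee_fin le_min ge_min lexx /= ge_min ler_nat nm orbT //.
have cvgg := @cvg_monotone_convergence _ _ _ P _ measurableT g mg g0 gm.
rewrite -(cvg_lim _ cvgg) //; apply: lime_le; first by apply/cvg_ex; eexists; exact: cvgg.
by apply: nearW => n; exact: open_le_cost_min pw.
Qed.

Lemma exists_optimal_coupling mu nu : exists pi, optimal_coupling mu nu pi.
Proof.
have W0 : (0 <= W2sq mu nu)%E.
  apply: le_ereal_inf_tmp => _ [pi _ <-]; apply: integral_ge0 => z _.
  by rewrite lee_fin sqnorm_ge0.
have [Wfin|] := boolP (W2sq mu nu \is a fin_num); last first.
  (* An infinite infimum is attained by every coupling, in particular by the product. *)
  rewrite ge0_fin_numE // -leNgt leye_eq => /eqP Woo.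
  exists (mu \x nu)%E; split; first exact: product_coupling.
  apply/eqP; rewrite Woo -leye_eq -Woo; apply: ereal_inf_lbound.
  by exists (mu \x nu)%E => //; exact: product_coupling.
have /choice[p pP] : forall n, exists pi, coupling mu nu pi /\
    (transport_cost pi <= (fine (W2sq mu nu) + n.+1%:R^-1)%:E)%E.
  move=> n; have n0 : 0 < n.+1%:R^-1 :> R by rewrite invr_gt0.
  have [_ [pi cpi <-] piW] := lb_ereal_inf_adherent n0 Wfin.
  by exists pi; split=> //; rewrite EFinD fineK // ltW.
have cp n : coupling mu nu (p n) by have [] := pP n.
exists (cluster_plan cp); split; first exact: cluster_plan_coupling.
apply/eqP; rewrite eq_le; apply/andP; split; last first.
  by apply: ereal_inf_lbound; exists (cluster_plan cp) => //; exact: cluster_plan_coupling.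
rewrite -(fineK Wfin); apply: open_le_cost => [s e N|n].
  exact: cluster_plan_open.
by have [] := pP n.
Qed.

End OptimalPlan.

(** * Laws, densities and relative entropy *)

(** Serves for entropy integrands, whose integral may be infinite: positive and negative parts are
    compared separately, and subtraction of extended reals is monotone in all cases. *)
Lemma le_integral_measurable {dT} {T : measurableType dT} {R : realType}
    (P : probability T R) (f g : T -> \bar R) :
  measurable_fun [set: T] f -> measurable_fun [set: T] g ->
  (forall x, f x <= g x)%E -> (\int[P]_x f x <= \int[P]_x g x)%E.
Proof.
move=> mf mg fg; rewrite integralE [in leRHS]integralE; apply: leeB.
  apply: ge0_le_integral => //; [exact: measurable_funepos|exact: measurable_funepos|].
  by move=> x _; rewrite !funeposE ge_max !le_max fg lexx orbT.
apply: ge0_le_integral => //; [exact: measurable_funeneg|exact: measurable_funeneg|].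
by move=> x _; rewrite !funenegE ge_max !le_max leeN2 fg lexx orbT.
Qed.

Section Laws.
Context {d1 d2} {T1 : measurableType d1} {T2 : measurableType d2} {R : realType}.

Definition has_law (P : probability T1 R) (t : T1 -> T2) (Q : probability T2 R) :=
  forall A, measurable A -> Q A = P (t @^-1` A).

Variables (P : probability T1 R) (t : T1 -> T2).
Hypothesis mt : measurable_fun [set: T1] t.

Lemma exists_law : exists Q, has_law P t Q.
Proof.
pose X : {mfun T1 >-> T2} := HB.pack t (isMeasurableFun.Build _ _ _ _ _ mt).
by exists (distribution P X).
Qed.

Variables (Q : probability T2 R).
Hypothesis lawQ : has_law P t Q.

Lemma law_ge0_integral (f : T2 -> \bar R) :
  measurable_fun [set: T2] f -> (forall y, 0 <= f y)%E ->
  (\int[Q]_y f y = \int[P]_x f (t x))%E.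
Proof.
move=> mf f0; rewrite -[RHS](@ge0_integral_pushforward _ _ _ _ _ _ mt P setT) //.
by apply: eq_measure_integral => A mA _; exact: lawQ.
Qed.

Lemma law_integral (f : T2 -> \bar R) : measurable_fun [set: T2] f ->
  (\int[Q]_y f y = \int[P]_x f (t x))%E.
Proof.
move=> mf; rewrite integralE [RHS]integralE.
congr (_ - _)%E.
  rewrite (law_ge0_integral (measurable_funepos mf) (funepos_ge0 f)).
  by apply: eq_integral => x _; rewrite !funeposE.
rewrite (law_ge0_integral (measurable_funeneg mf) (funeneg_ge0 f)).
by apply: eq_integral => x _; rewrite !funenegE.
Qed.

Lemma law_integrable (f : T2 -> \bar R) : measurable_fun [set: T2] f ->
  Q.-integrable [set: T2] f -> P.-integrable [set: T1] (f \o t).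
Proof.
move=> mf /integrableP[_ fQ]; apply/integrableP; split.
  exact: measurableT_comp.
rewrite law_ge0_integral in fQ => //; exact: measurableT_comp.
Qed.

End Laws.

(** Uniqueness of the Radon-Nikodym derivative identifies p with the chosen derivative almost
    everywhere, which transports its change of variables formula. Taking Q sigma-finite covers
    Lebesgue measure as well. *)
Lemma ge0_integral_density {dT} {T : measurableType dT} {R : realType}
    (Q : {sigma_finite_measure set T -> \bar R}) (P : {finite_measure set T -> \bar R})
    (p : T -> R) : measurable_fun [set: T] p -> (forall x, 0 <= p x) ->
  Q.-integrable [set: T] (EFin \o p) ->
  (forall A, measurable A -> P A = (\int[Q]_(x in A) (p x)%:E)%E) ->
  forall h : T -> \bar R, measurable_fun [set: T] h -> (forall x, 0 <= h x)%E ->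
    (\int[P]_x h x = \int[Q]_x (h x * (p x)%:E))%E.
Proof.
move=> mp p0 ip PE h mh h0.
have PQ : P `<< Q.
  apply/null_content_dominatesP => A mA QA; rewrite PE //; apply: null_set_integral => //.
  by apply: measurable_funTS; exact/measurable_EFinP.
rewrite -(Radon_Nikodym_SigmaFinite.change_of_variables PQ) //.
apply: ge0_ae_eq_integral => //.
- apply: emeasurable_funM => //.
  by have /integrableP[] := Radon_Nikodym_SigmaFinite.f_integrable PQ.
- by apply: emeasurable_funM => //; exact/measurable_EFinP.
- by move=> x _; rewrite mule_ge0 // Radon_Nikodym_SigmaFinite.f_ge0.
- by move=> x _; rewrite mule_ge0 // lee_fin.
apply: ae_eqe_mul2l; apply: integral_ae_eq => //.
- exact: Radon_Nikodym_SigmaFinite.f_integrable.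
- exact/measurable_EFinP.
- by move=> A _ mA; rewrite -Radon_Nikodym_SigmaFinite.f_integral //; exact: PE.
Qed.

Section Density.
Context {dT} {T : measurableType dT} {R : realType}.

(** Stated on integrals rather than on masses, so that it rewrites an integral in one step. *)
Definition has_density (Q : probability T R) (p : T -> R) (P : probability T R) :=
  forall h : T -> \bar R, measurable_fun [set: T] h -> (forall x, 0 <= h x)%E ->
    (\int[P]_x h x = \int[Q]_x (h x * (p x)%:E))%E.

Section Construction.
Variables (Q : probability T R) (p : T -> R).
Hypothesis mp : measurable_fun [set: T] p.
Hypothesis p0 : forall x, 0 <= p x.
Hypothesis p1 : (\int[Q]_x (p x)%:E = 1)%E.

Definition density_measure (A : set T) : \bar R := (\int[Q]_(x in A) (p x)%:E)%E.

Let density0 : density_measure set0 = 0%E.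
Proof. by rewrite /density_measure integral_set0. Qed.

Let density_ge0 A : (0 <= density_measure A)%E.
Proof. by apply: integral_ge0 => x _; rewrite lee_fin. Qed.

Let integrable_p : Q.-integrable [set: T] (EFin \o p).
Proof.
apply/integrableP; split; first exact/measurable_EFinP.
under eq_integral do rewrite /= ger0_norm //.
by rewrite p1 ltry.
Qed.

Let density_sigma_additive : semi_sigma_additive density_measure.
Proof.
move=> /= A mA tA mUA.
rewrite /density_measure/= integral_bigcup//=; last first.
  by apply: (integrableS _ _ (@subsetT _ _)) => //; exact: integrable_p.
apply: is_cvg_ereal_nneg_natsum_cond => n _ _.
by apply: integral_ge0 => /= x ?; rewrite lee_fin.
Qed.

HB.instance Definition _ := isMeasure.Build _ _ _
  density_measure density0 density_ge0 density_sigma_additive.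

Let density_setT : density_measure [set: _] = 1%E.
Proof. exact: p1. Qed.

HB.instance Definition _ :=
  Measure_isProbability.Build _ _ _ density_measure density_setT.

Lemma exists_density : exists P, has_density Q p P.
Proof.
exists density_measure => h mh h0.
by apply: (ge0_integral_density (Q := Q) (P := density_measure)) => //; exact: integrable_p.
Qed.

End Construction.

Variables (Q : probability T R) (p : T -> R) (P : probability T R).
Hypothesis mp : measurable_fun [set: T] p.
Hypothesis p0 : forall x, 0 <= p x.
Hypothesis densP : has_density Q p P.

Lemma density_integrable (h : T -> \bar R) : measurable_fun [set: T] h ->
  P.-integrable [set: T] h -> Q.-integrable [set: T] (fun x => h x * (p x)%:E)%E.
Proof.
move=> mh /integrableP[_ hP]; apply/integrableP; split.
  by apply: emeasurable_funM => //; exact/measurable_EFinP.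
rewrite densP in hP => //; last exact: measurableT_comp.
by under eq_integral do rewrite abseM [X in (_ * X)%E]gee0_abs ?lee_fin //.
Qed.

Lemma density_integral (h : T -> \bar R) : measurable_fun [set: T] h ->
  (\int[P]_x h x = \int[Q]_x (h x * (p x)%:E))%E.
Proof.
move=> mh; rewrite integralE [RHS]integralE.
rewrite !densP //; do ?[exact: measurable_funeneg|exact: measurable_funepos].
congr (_ - _)%E; apply: eq_integral => x _.
  by rewrite !funeposE maxe_pMl ?lee_fin // mul0e.
by rewrite !funenegE maxe_pMl ?lee_fin // mul0e mulNe.
Qed.

Lemma density_dominates : P `<< Q.
Proof.
apply/null_content_dominatesP => A mA QA.
have -> : P A = (\int[P]_x (\1_A x)%:E)%E by rewrite integral_indic // setIT.
rewrite densP //; last by apply/measurable_EFinP; exact: measurable_indic.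
under eq_integral do rewrite muleC.
have -> : (fun x => (p x)%:E * (\1_A x)%:E)%E = (EFin \o p) \_ A.
  by rewrite epatch_indic.
rewrite -integral_mkcond; apply: null_set_integral => //.
by apply: measurable_funTS; exact/measurable_EFinP.
Qed.

End Density.

Lemma measurable_lne {R : realType} : measurable_fun [set: \bar R] (@lne R).
Proof.
apply: (measurability _ (ErealGenOInfty.measurableE R)) => // _ [_ [a ->] <-].
rewrite setTI.
have -> : @lne R @^-1` `]a%:E, +oo[%classic = `](expR a)%:E, +oo[%classic.
  apply/seteqP; split=> x /=; rewrite !in_itv /= !andbT; case: x => [r| |] //=.
    case: ifP => [//|/negbT]; rewrite -ltNge => r0.
    by rewrite !lte_fin -(ltr_expR a) lnK.
  - by rewrite !ltry.
  - rewrite !lte_fin => ar; have r0 : 0 < r := lt_trans (expR_gt0 _) ar.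
    by rewrite leNgt r0 /= lte_fin -ltr_expR lnK.
  - by rewrite !ltry.
exact: emeasurable_itv.
Qed.

(** [KL] is built on a derivative fixed only almost everywhere. A finite nonnegative version
    replaces it without changing the integral, since null sets of N are null for P. *)
Lemma KL_density {dT} {T : measurableType dT} {R : realType} (P N : probability T R) :
  P `<< N -> exists r : T -> R,
    [/\ measurable_fun [set: T] r, forall x, 0 <= r x, has_density N r P &
        KL P N = (\int[P]_x lne (r x)%:E)%E].
Proof.
move=> PN; pose F := Radon_Nikodym_SigmaFinite.f P N.
have FE x : F x = (fine (F x))%:E.
  by rewrite fineK // Radon_Nikodym_SigmaFinite.f_fin_num.
have mF : measurable_fun setT F.
  by have /integrableP[] := Radon_Nikodym_SigmaFinite.f_integrable PN.
exists (fine \o F); split.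
- by apply: measurableT_comp => //; exact: measurable_fine.
- by move=> x /=; rewrite fine_ge0 // Radon_Nikodym_SigmaFinite.f_ge0.
- move=> h mh h0; rewrite -(Radon_Nikodym_SigmaFinite.change_of_variables PN) //.
  by apply: eq_integral => x _; rewrite /= -FE.
- rewrite /KL asboolT //; apply: ae_eq_integral => //.
  + apply: measurableT_comp; first exact: measurable_lne.
    exact: (measurable_int N (@Radon_Nikodym_integrable _ _ _ (charge_of_finite_measure P) N PN)).
  + apply: measurableT_comp; first exact: measurable_lne.
    by under eq_fun do rewrite -FE.
  + apply: (null_dominates_ae_eq measurableT PN).
    have := ae_eq_Radon_Nikodym_SigmaFinite PN measurableT.
    by apply: filterS => x Hx _; rewrite [(fine \o F) x]/= -FE; congr lne; exact/esym/Hx.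
Qed.

Section TransportBounds.
Context {R : realType} {d : nat}.
Local Notation E := 'rV[R]_d.
Local Notation prob := (probability E R).
Local Notation plan := (probability (E * E)%type R).
Implicit Types (mu nu : prob) (pi : plan) (eps : R).

Lemma coupling_fst mu nu pi : coupling mu nu pi -> has_law pi fst mu.
Proof. by move=> c A /c[<-]. Qed.

Lemma coupling_snd mu nu pi : coupling mu nu pi -> has_law pi snd nu.
Proof. by move=> c A /c[_ <-]. Qed.

Lemma dotC (x y : E) : dot x y = dot y x.
Proof. by apply: eq_bigr => i _; rewrite mulrC. Qed.

Lemma dotDl (x y z : E) : dot (x + y) z = dot x z + dot y z.
Proof. by rewrite -big_split; apply: eq_bigr => i _; rewrite mxE mulrDl. Qed.

Lemma dotNl (x z : E) : dot (- x) z = - dot x z.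
Proof. by rewrite -sumrN; apply: eq_bigr => i _; rewrite mxE mulNr. Qed.

Lemma dotZl a (x z : E) : dot (a *: x) z = a * dot x z.
Proof. by rewrite mulr_sumr; apply: eq_bigr => i _; rewrite mxE mulrA. Qed.

Lemma dotDr (x y z : E) : dot z (x + y) = dot z x + dot z y.
Proof. by rewrite dotC dotDl !(dotC z). Qed.

Lemma dotNr (x z : E) : dot z (- x) = - dot z x.
Proof. by rewrite dotC dotNl dotC. Qed.

Lemma dotZr a (x z : E) : dot z (a *: x) = a * dot z x.
Proof. by rewrite dotC dotZl dotC. Qed.

Definition dotE := (dotDl, dotNl, dotZl, dotDr, dotNr, dotZr).

Lemma sqnormB_le (x y : E) : sqnorm (x - y) <= 2 * sqnorm x + 2 * sqnorm y.
Proof.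
have := sqnorm_ge0 (x + y); rewrite /sqnorm !dotE (dotC y x); lra.
Qed.

Lemma integrable_le {dT} {T : measurableType dT} (P : probability T R) (u v : T -> R) :
  measurable_fun [set: T] u -> (forall x, `|u x| <= v x) ->
  P.-integrable [set: T] (EFin \o v) -> P.-integrable [set: T] (EFin \o u).
Proof.
move=> mu uv; apply: le_integrable => //; first exact/measurable_EFinP.
by move=> x _ /=; rewrite lee_fin (le_trans (uv x)) // ler_norm.
Qed.

Lemma P2_integrable mu : P2 mu -> mu.-integrable [set: E] (fun x => (sqnorm x)%:E).
Proof.
move=> P2mu; apply/integrableP; split.
  by apply/measurable_EFinP; exact: measurable_sqnorm.
by under eq_integral do rewrite /= ger0_norm ?sqnorm_ge0 //.
Qed.

Lemma coupling_integrable_fst mu nu pi (f : E -> R) : coupling mu nu pi ->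
  measurable_fun [set: E] f -> mu.-integrable [set: E] (EFin \o f) ->
  pi.-integrable [set: E * E] (fun z => (f z.1)%:E).
Proof.
move=> c mf fi; apply: (law_integrable measurable_fst (coupling_fst c) _ fi).
exact/measurable_EFinP.
Qed.

Lemma coupling_integrable_snd mu nu pi (f : E -> R) : coupling mu nu pi ->
  measurable_fun [set: E] f -> nu.-integrable [set: E] (EFin \o f) ->
  pi.-integrable [set: E * E] (fun z => (f z.2)%:E).
Proof.
move=> c mf fi; apply: (law_integrable measurable_snd (coupling_snd c) _ fi).
exact/measurable_EFinP.
Qed.

Lemma coupling_cost_integrable mu nu pi : P2 mu -> P2 nu -> coupling mu nu pi ->
  pi.-integrable [set: E * E] (fun z => (sqnorm (z.1 - z.2))%:E).
Proof.
move=> pmu pnu c; apply: (@integrable_le _ _ _ _ (fun z => 2 * sqnorm z.1 + 2 * sqnorm z.2)).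
- exact: measurable_cost.
- by move=> z; rewrite ger0_norm ?sqnorm_ge0 // sqnormB_le.
have i1 := coupling_integrable_fst c (measurable_sqnorm (@measurable_id _ _ setT)) (P2_integrable pmu).
have i2 := coupling_integrable_snd c (measurable_sqnorm (@measurable_id _ _ setT)) (P2_integrable pnu).
apply: (eq_integrable _ (fun z => 2%:E * (sqnorm z.1)%:E + 2%:E * (sqnorm z.2)%:E)%E) => //.
by apply: integrableD => //; exact: integrableZl.
Qed.

End TransportBounds.

Section RelativeEntropy.
Context {R : realType}.

Lemma integral_cst1 {dT} {T : measurableType dT} (P : probability T R) (c : R) :
  (\int[P]_x c%:E = c%:E)%E.
Proof.
transitivity (c%:E * P setT)%E; first exact: integral_cst.
by rewrite probability_setT mule1.
Qed.

Lemma integrable_cst {dT} {T : measurableType dT} (P : probability T R) (c : R) :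
  P.-integrable [set: T] (fun=> c%:E).
Proof.
apply/integrableP; split; first exact: measurable_cst.
by under eq_integral do rewrite /=; rewrite integral_cst1 ltry.
Qed.

Lemma probability_integral {dT} {T : measurableType dT} (P : probability T R) (A : set T) :
  measurable A -> P A = (\int[P]_x (\1_A x)%:E)%E.
Proof. by move=> mA; rewrite integral_indic // setIT. Qed.

(* The easy half of the Donsker-Varadhan variational formula. *)
Lemma KL_ge {dT} {T : measurableType dT} (P N : probability T R) (phi : T -> R) :
  P `<< N -> measurable_fun [set: T] phi -> P.-integrable [set: T] (EFin \o phi) ->
  (\int[N]_x (expR (phi x))%:E <= 1)%E -> (\int[P]_x (phi x)%:E <= KL P N)%E.
Proof.
move=> PN mphi iphi N1; have [r [mr r0 dr ->]] := KL_density PN.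
(* This is exp(phi)/r where r is positive; its P-integral is at most the N-integral of exp(phi),
   hence at most 1. *)
pose k x := if 0 < r x then expR (phi x - ln (r x)) else 0.
have mrpos : measurable_fun setT (fun x => 0 < r x).
  by apply: measurable_fun_ltr.
have mk : measurable_fun setT k.
  apply: measurable_fun_ifT => //; apply: measurableT_comp => //.
  by apply: measurable_funB => //; exact: (measurableT_comp (@measurable_ln R) mr).
have k0 x : 0 <= k x by rewrite /k; case: ifP => // _; rewrite expR_ge0.
have kP : (\int[P]_x (k x)%:E <= 1)%E.
  rewrite dr //; last exact/measurable_EFinP.
  apply: le_trans N1; apply: ge0_le_integral => //.
  - by move=> x _; rewrite mule_ge0 ?lee_fin.
  - by apply/measurable_EFinP; exact: measurable_funM.
  - by apply/measurable_EFinP; exact: measurableT_comp.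
  - move=> x _; rewrite -EFinM lee_fin /k; case: ifPn => [rx|_].
      by rewrite expRB lnK ?posrE // divfK // gt_eqF.
    by rewrite mul0r expR_ge0.
have ik : P.-integrable setT (EFin \o k).
  apply/integrableP; split; first exact/measurable_EFinP.
  under eq_integral do rewrite /= ger0_norm //.
  by apply: (le_lt_trans kP); exact: ltry.
(* The inequality exp t >= 1 + t at t = phi - ln r reads ln r >= phi + 1 - k, and int k <= 1 makes
   the right side integrate to at least int phi. *)
pose H x := phi x + 1 - k x.
have mH : measurable_fun setT H.
  by apply: measurable_funB => //; exact: measurable_funD.
have iphi1 : P.-integrable setT (fun x => (phi x)%:E + 1%:E)%E.
  by apply: integrableD => //; exact: integrable_cst.
have HE x : (H x)%:E = ((phi x)%:E + 1%:E - (k x)%:E)%E by [].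
have intH : (\int[P]_x (phi x)%:E <= \int[P]_x (H x)%:E)%E.
  under [leRHS]eq_integral do rewrite HE.
  rewrite integralB // integralD //; last exact: integrable_cst.
  rewrite integral_cst1.
  rewrite -(fineK (integrable_fin_num measurableT iphi)).
  rewrite -(fineK (integrable_fin_num measurableT ik)) in kP *.
  by move: kP; rewrite -!EFinD !lee_fin; lra.
apply: (le_trans intH).
(* Where r vanishes its logarithm is -oo and the pointwise bound fails; that set is P-null, so the
   value there may be replaced by H. *)
pose theta x := if 0 < r x then ln (r x) else H x.
have mtheta : measurable_fun setT theta.
  apply: measurable_fun_ifT => //.
  exact: (measurableT_comp (@measurable_ln R) mr).
have -> : (\int[P]_x lne (r x)%:E = \int[P]_x (theta x)%:E)%E.
  apply: ae_eq_integral => //.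
  - apply: measurableT_comp; first exact: measurable_lne.
    exact/measurable_EFinP.
  - exact/measurable_EFinP.
  have mr0 : measurable [set x | r x <= 0].
    have -> : [set x | r x <= 0] = (fun x => 0 < r x) @^-1` [set false].
      by apply/seteqP; split=> x /=; rewrite leNgt; [exact: negbTE|move=> ->].
    by rewrite -[X in measurable X]setTI; exact: mrpos.
  exists [set x | r x <= 0]; split => //.
    transitivity (\int[P]_x (\1_[set x | r x <= 0] x)%:E)%E.
      by rewrite integral_indic // setIT.
    rewrite dr //; last by apply/measurable_EFinP; exact: measurable_indic.
    apply: integral0_eq => x _; rewrite indicE.
    have [|] := boolP (x \in _); last by rewrite mul0e.
    rewrite inE /= => rx; have -> : r x = 0 by apply/eqP; rewrite eq_le rx r0.
    by rewrite mule0.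
  move=> x /= nx; rewrite leNgt; apply/negP => rx; apply: nx => _.
  by rewrite /theta rx leNgt rx.
apply: le_integral_measurable; [exact/measurable_EFinP|exact/measurable_EFinP|].
move=> x; rewrite lee_fin /theta; case: ifPn => // rx.
rewrite /H /k rx; have := expR_ge1Dx (phi x - ln (r x)); lra.
Qed.

(* Data processing: t maps the pair (P, Q) to (G, N). *)
Lemma KL_law_le {d1 d2} {Z : measurableType d1} {T : measurableType d2}
    (Q P : probability Z R) (p : Z -> R) (t : Z -> T) (G N : probability T R) :
  measurable_fun [set: Z] p -> (forall z, 0 < p z) -> has_density Q p P ->
  measurable_fun [set: Z] t -> has_law P t G -> has_law Q t N ->
  P.-integrable [set: Z] (fun z => (ln (p z))%:E) ->
  (KL G N <= \int[P]_z (ln (p z))%:E)%E.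
Proof.
move=> mp p0 dP mt lG lN ip.
have PQ : P `<< Q by apply: (density_dominates mp) => // z; exact: ltW.
have GN : G `<< N.
  apply/null_content_dominatesP => A mA NA.
  have QA : Q (t @^-1` A) = 0 by rewrite -(lN A mA).
  have mtA : measurable (t @^-1` A) by rewrite -[X in measurable X]setTI; exact: mt.
  transitivity (P (t @^-1` A)); first exact: (lG A mA).
  by move/null_content_dominatesP : PQ; exact.
have [r [mr r0 dr ->]] := KL_density GN.
have mrt : measurable_fun setT (fun z => r (t z)) by exact: measurableT_comp.
(* The density of G over N, read through t, divided by p. Its P-integral is 1, so ln (r (t z)) <= ln
   (p z) + k z - 1 integrates to the claim. *)
pose k z := r (t z) * expR (- ln (p z)).
have k0 z : 0 <= k z by rewrite mulr_ge0 // expR_ge0.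
have mk : measurable_fun setT k.
  apply: measurable_funM => //; apply: measurableT_comp => //.
  by apply: measurableT_comp => //; exact: (measurableT_comp (@measurable_ln R) mp).
have kP : (\int[P]_z (k z)%:E = 1)%E.
  rewrite dP //; last exact/measurable_EFinP.
  have -> : (\int[Q]_z ((k z)%:E * (p z)%:E) = \int[Q]_z (r (t z))%:E)%E.
    by apply: eq_integral => z _; rewrite -EFinM /k expRN lnK ?posrE // divfK // gt_eqF.
  rewrite -(law_ge0_integral mt lN (f := fun y => (r y)%:E)) //; last exact/measurable_EFinP.
  rewrite -(@integral_cst1 _ _ G 1).
  by rewrite dr //; apply: eq_integral => y _; rewrite mul1e.
have ik : P.-integrable setT (EFin \o k).
  apply/integrableP; split; first exact/measurable_EFinP.
  under eq_integral do rewrite /= ger0_norm //.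
  by rewrite kP ltry.
have mlnr : measurable_fun [set: T] (fun y => lne (r y)%:E).
  by apply: measurableT_comp; [exact: measurable_lne|exact/measurable_EFinP].
rewrite (law_integral mt lG) //.
have -> : (\int[P]_z (ln (p z))%:E = \int[P]_z ((ln (p z))%:E + (k z)%:E - 1%:E))%E.
  rewrite integralB //; [|exact: integrableD|exact: integrable_cst].
  by rewrite integralD // kP integral_cst1 addeK.
apply: le_integral_measurable.
- exact: (measurableT_comp mlnr mt).
- apply: (measurable_int P); apply: integrableB => //; last exact: integrable_cst.
  exact: integrableD.
move=> z; have [rz|rz] := ltP 0 (r (t z)); last first.
  by rewrite le0_lneNy ?lee_fin // leNye.
rewrite lne_EFin // -!EFinD lee_fin /k.
rewrite -[X in X * expR _](@lnK R) ?posrE // -expRD.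
have := expR_ge1Dx (ln (r (t z)) - ln (p z)); lra.
Qed.

End RelativeEntropy.

(** * Duality bounds for entropic transport *)

Section OTBounds.
Context {R : realType} {d : nat}.
Local Notation E := 'rV[R]_d.
Local Notation prob := (probability E R).
Local Notation plan := (probability (E * E)%type R).
Implicit Types (pi : plan) (eps : R).

(** Weak duality: the variational bound for the entropy is applied to the exponent (f + g -
    cost)/eps. Integrability under every coupling lets the cost cancel. *)
Lemma OT_ge_dual eps (nu1 nu2 : prob) (f g : E -> R) : 0 < eps ->
  P2 nu1 -> P2 nu2 -> measurable_fun [set: E] f -> measurable_fun [set: E] g ->
  nu1.-integrable [set: E] (EFin \o f) -> nu2.-integrable [set: E] (EFin \o g) ->
  (\int[nu1 \x nu2]_z
     (expR (eps^-1 * (f z.1 + g z.2 - sqnorm (z.1 - z.2))))%:E <= 1)%E ->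
  (\int[nu1]_x (f x)%:E + \int[nu2]_y (g y)%:E <= OT eps nu1 nu2)%E.
Proof.
move=> eps0 p1 p2 mf mg jf jg N1; apply: le_ereal_inf_tmp => _ [pi c <-].
have jc := coupling_cost_integrable p1 p2 c.
have j1 := coupling_integrable_fst c mf jf.
have j2 := coupling_integrable_snd c mg jg.
have C0 : (0 <= transport_cost pi)%E.
  by apply: integral_ge0 => z _; rewrite lee_fin sqnorm_ge0.
(* A plan that is not absolutely continuous has infinite entropy, which its nonnegative cost cannot
   offset. *)
have [PN|nPN] := pselect (pi `<< (nu1 \x nu2)%E); last first.
  rewrite /KL asboolF // gt0_muley ?lte_fin // addey ?leey //.
  by rewrite gt_eqF // (lt_le_trans _ C0).
pose phi (z : E * E) := eps^-1 * (f z.1 + g z.2 - sqnorm (z.1 - z.2)).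
have j12 := integrableD measurableT j1 j2.
have j12c := integrableB measurableT j12 jc.
have jphi : pi.-integrable setT (EFin \o phi).
  apply: (eq_integrable measurableT _ _ _ (integrableZl measurableT eps^-1 j12c)).
  by [].
have mphi : measurable_fun setT phi.
  by apply/measurable_EFinP; exact: measurable_int jphi.
have KLphi := KL_ge PN mphi jphi N1.
have phiE : (\int[pi]_z (phi z)%:E = eps^-1%:E *
    (\int[nu1]_x (f x)%:E + \int[nu2]_y (g y)%:E - transport_cost pi))%E.
  rewrite (law_integral measurable_fst (coupling_fst c)); last exact/measurable_EFinP.
  rewrite (law_integral measurable_snd (coupling_snd c)); last exact/measurable_EFinP.
  by rewrite -integralD // -integralB // -integralZl.
have Cfin := integrable_fin_num measurableT jc.
have ffin := integrable_fin_num measurableT jf.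
have gfin := integrable_fin_num measurableT jg.
have := lee_wpmul2l (ltW eps0 : (0 <= eps%:E)%E) KLphi.
rewrite phiE muleA -EFinM mulfV ?gt_eqF // mul1e => H.
apply: (@le_trans _ _ (transport_cost pi +
  (\int[nu1]_x (f x)%:E + \int[nu2]_y (g y)%:E - transport_cost pi))%E); last by rewrite leeD2l.
by rewrite [leRHS]addeC subeK.
Qed.

(* Draw (x, x') from the plan p (mu1 x mu2), then y and y' from the disintegrations of
   pi1 and pi2; the law of (y, y') is a coupling of nu1 and nu2, and by data processing
   its entropy relative to nu1 x nu2 is at most that of p. *)
Section Competitor.
Variables (mu1 mu2 nu1 nu2 : prob) (pi1 pi2 : plan) (p : E * E -> R).
Hypothesis c1 : coupling mu1 nu1 pi1.
Hypothesis c2 : coupling mu2 nu2 pi2.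
Hypothesis mp : measurable_fun [set: E * E] p.
Hypothesis p0 : forall z, 0 < p z.
Hypothesis p1 : forall x, (\int[mu2]_y (p (x, y))%:E = 1)%E.
Hypothesis p2 : forall y, (\int[mu1]_x (p (x, y))%:E = 1)%E.

Let Q : probability ((E * E) * (E * E))%type R := (pi1 \x pi2)%E.
Let q (z : (E * E) * (E * E)) := p (z.1.1, z.2.1).

Let mq : measurable_fun setT q.
Proof.
apply: measurableT_comp => //; apply: measurable_fun_pair.
  exact: (measurableT_comp measurable_fst measurable_fst).
exact: (measurableT_comp measurable_fst measurable_snd).
Qed.

Let q1 w : (\int[pi2]_w' (q (w, w'))%:E = 1)%E.
Proof.
rewrite -(p1 w.1) (law_integral measurable_fst (coupling_fst c2)) //.
by apply/measurable_EFinP; exact: (measurable_fun_pair2 w.1 mp).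
Qed.

Let q2 w' : (\int[pi1]_w (q (w, w'))%:E = 1)%E.
Proof.
rewrite -(p2 w'.1) (law_integral measurable_fst (coupling_fst c1)) //.
by apply/measurable_EFinP; exact: (measurable_fun_pair1 w'.1 mp).
Qed.

(** Weighting pi1 x pi2 by p(x, x') performs the gluing without constructing disintegrations; the
    marginals remain pi1 and pi2 because p integrates to 1 in each variable. *)
Lemma exists_glued_plan : exists P : probability ((E * E) * (E * E))%type R,
  [/\ has_density (pi1 \x pi2)%E (fun z => p (z.1.1, z.2.1)) P,
      has_law P fst pi1 & has_law P snd pi2].
Proof.
have q0 z : 0 <= q z by rewrite ltW // /q.
have tot : (\int[Q]_z (q z)%:E = 1)%E.
  transitivity (\int[pi1]_w fubini_F pi2 (EFin \o q) w)%E.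
    by apply: fubini_tonelli1 => //; exact/measurable_EFinP.
  by under eq_integral do rewrite /fubini_F q1; rewrite integral_cst1.
have [P dP] := exists_density mq q0 tot.
exists P; split=> // A mA.
- apply/esym; transitivity (\int[P]_z (\1_A z.1)%:E)%E.
    apply: (probability_integral P); rewrite -[X in measurable X]setTI.
    exact: measurable_fst.
  have mI : measurable_fun setT (\1_A : _ -> R) by exact: measurable_indic.
  rewrite dP //; last first.
    by apply/measurable_EFinP; exact: (measurableT_comp mI measurable_fst).
  rewrite -[LHS]/(\int[Q]_x (\1_A x.1 * q x)%:E)%E.
  transitivity (\int[pi1]_w fubini_F pi2 (fun z => (\1_A z.1 * q z)%:E) w)%E.
    apply: fubini_tonelli1.
      apply/measurable_EFinP; apply: measurable_funM => //.
      exact: (measurableT_comp mI measurable_fst).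
    by move=> z; rewrite lee_fin mulr_ge0.
  rewrite (probability_integral pi1 mA).
  apply: eq_integral => w _; rewrite /fubini_F /=; under eq_integral do rewrite EFinM.
  rewrite ge0_integralZl ?q1 ?mule1 ?lee_fin //.
  - by apply/measurable_EFinP; exact: (measurable_fun_pair2 w mq).
  - by move=> w' _; rewrite lee_fin.
- apply/esym; transitivity (\int[P]_z (\1_A z.2)%:E)%E.
    apply: (probability_integral P); rewrite -[X in measurable X]setTI.
    exact: measurable_snd.
  have mI : measurable_fun setT (\1_A : _ -> R) by exact: measurable_indic.
  rewrite dP //; last first.
    by apply/measurable_EFinP; exact: (measurableT_comp mI measurable_snd).
  rewrite -[LHS]/(\int[Q]_x (\1_A x.2 * q x)%:E)%E.
  transitivity (\int[pi2]_w fubini_G pi1 (fun z => (\1_A z.2 * q z)%:E) w)%E.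
    apply: fubini_tonelli2.
      apply/measurable_EFinP; apply: measurable_funM => //.
      exact: (measurableT_comp mI measurable_snd).
    by move=> z; rewrite lee_fin mulr_ge0.
  rewrite (probability_integral pi2 mA).
  apply: eq_integral => w _; rewrite /fubini_G /=; under eq_integral do rewrite EFinM.
  rewrite ge0_integralZl ?q2 ?mule1 ?lee_fin //.
  - by apply/measurable_EFinP; exact: (measurable_fun_pair1 w mq).
  - by move=> w' _; rewrite lee_fin.
Qed.

Lemma OT_le_glued eps (P : probability ((E * E) * (E * E))%type R) : 0 < eps ->
  has_density (pi1 \x pi2)%E (fun z => p (z.1.1, z.2.1)) P ->
  has_law P fst pi1 -> has_law P snd pi2 ->
  P.-integrable [set: (E * E) * (E * E)] (fun z => (ln (p (z.1.1, z.2.1)))%:E) ->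
  (OT eps nu1 nu2 <= \int[P]_z (sqnorm (z.1.2 - z.2.2))%:E +
     eps%:E * \int[P]_z (ln (p (z.1.1, z.2.1)))%:E)%E.
Proof.
move=> eps0 dP l1 l2 jp.
pose t (z : (E * E) * (E * E)) := (z.1.2, z.2.2).
have mt : measurable_fun setT t.
  apply: measurable_fun_pair.
    exact: (measurableT_comp measurable_snd measurable_fst).
  exact: (measurableT_comp measurable_snd measurable_snd).
have [G lG] := exists_law P mt.
have msnd (A : set E) : measurable A -> measurable (snd @^-1` A : set (E * E)).
  by move=> mA; rewrite -[X in measurable X]setTI; exact: measurable_snd.
have cG : coupling nu1 nu2 G.
  move=> A mA; rewrite /pushforward; split.
    rewrite lG; last by rewrite -[X in measurable X]setTI; exact: measurable_fst.
    by rewrite (coupling_snd c1) // l1 //; exact: msnd.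
  rewrite lG; last by rewrite -[X in measurable X]setTI; exact: measurable_snd.
  by rewrite (coupling_snd c2) // l2 //; exact: msnd.
(* Under pi1 x pi2 the two end points are independent, so the map producing the competitor also
   sends the reference measure to nu1 x nu2. *)
have lN : has_law Q t (nu1 \x nu2)%E.
  have [N lN] := exists_law Q mt.
  move=> A mA; rewrite -(lN A mA); apply: (@product_measure_unique _ _ _ _ R nu1 nu2 N) => // B C mB mC.
  transitivity (Q ((snd @^-1` B) `*` (snd @^-1` C))).
    exact: (lN _ (measurableX mB mC)).
  apply: etrans (product_measure1E pi1 pi2 (msnd _ mB) (msnd _ mC)) _.
  by congr (_ * _)%E; apply/esym; [exact: (coupling_snd c1)|exact: (coupling_snd c2)].
apply: (@le_trans _ _ (transport_cost G + eps%:E * KL G (nu1 \x nu2)%E)%E).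
  by apply: ereal_inf_lbound; exists G.
apply: leeD.
  rewrite /transport_cost (law_ge0_integral mt lG) //.
    by apply/measurable_EFinP; exact: measurable_cost.
  by move=> y; rewrite lee_fin sqnorm_ge0.
apply: lee_wpmul2l; first by rewrite lee_fin ltW.
by apply: (KL_law_le (Q := Q) mq _ dP mt lG lN jp) => z; exact: p0.
Qed.

End Competitor.

End OTBounds.

(** * Schrodinger potentials *)

Section ExponentialBounds.
Context {R : realType}.
Implicit Types s t u : R.

Lemma norm_le_expRDN t : `|t| <= expR t + expR (- t).
Proof.
have := expR_ge1Dx t; have := expR_ge1Dx (- t).
have := expR_gt0 t; have := expR_gt0 (- t).
rewrite ler_norml => *; apply/andP; split; lra.
Qed.

Lemma expR_norm_le t : expR `|t| <= expR t + expR (- t).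
Proof.
have [t0|t0] := leP 0 t; first by rewrite ger0_norm // lerDl expR_ge0.
by rewrite ltr0_norm // lerDr expR_ge0.
Qed.

Lemma sqr_le_expR t : t ^+ 2 <= 4 * expR `|t|.
Proof.
have t0 := normr_ge0 t; rewrite -real_normK ?num_real //.
have -> : expR `|t| = expR (`|t| / 2) ^+ 2 by rewrite -expRM_natr divfK.
have := expR_ge1Dx (`|t| / 2) => h.
have : (`|t| / 2) ^+ 2 <= expR (`|t| / 2) ^+ 2.
  by rewrite lerXn2r ?nnegrE ?expR_ge0 //; lra.
rewrite exprMn; lra.
Qed.

Lemma expR_taylor1_le u : expR u - 1 - u <= u ^+ 2 * expR `|u|.
Proof.
have e1 : expR u - 1 <= u * expR u.
  have := expR_ge1Dx (- u); rewrite -(ler_pM2r (expR_gt0 u)) -expRD addNr expR0; lra.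
have e2 := expR_ge1Dx u.
have e3 : 1 <= expR `|u| by rewrite -expR0 ler_expR.
have [u0|u0] := leP 0 u.
  rewrite ger0_norm // expr2 -mulrA.
  have : u * (expR u - 1) <= u * (u * expR u) by rewrite ler_wpM2l.
  lra.
have : u * (expR u - 1) <= u * u by rewrite ler_wnM2l ?(ltW u0) //; lra.
have : u ^+ 2 * 1 <= u ^+ 2 * expR `|u| by rewrite ler_wpM2l ?sqr_ge0.
rewrite expr2; lra.
Qed.

(** For s <= 1/2, exp |s t| uses up only half of the exponent of exp |t|; the other half dominates
    t^2, with the factor 16 because (t/2)^2 <= 4 exp(|t|/2). The square of s stays outside. *)
Lemma expR_taylor1_scale_le s t : 0 <= s -> s <= 1 / 2 ->
  expR (s * t) - 1 - s * t <= 16 * s ^+ 2 * (expR t + expR (- t)).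
Proof.
move=> s0 s1; apply: (le_trans (expR_taylor1_le _)).
have t0 := normr_ge0 t.
have h1 : expR `|s * t| <= expR (`|t| / 2).
  by rewrite ler_expR normrM (ger0_norm s0) mulrC ler_wpM2l // -div1r.
have h2 : t ^+ 2 <= 16 * expR (`|t| / 2).
  have := sqr_le_expR (t / 2); rewrite normrM (ger0_norm (_ : 0 <= 2^-1)) //.
  rewrite exprMn; lra.
have h3 : expR (`|t| / 2) * expR (`|t| / 2) = expR `|t| by rewrite -expRD -splitr.
have h4 := expR_norm_le t.
have -> : 16 * s ^+ 2 * (expR t + expR (- t)) = s ^+ 2 * (16 * (expR t + expR (- t))).
  by ring.
rewrite exprMn -mulrA ler_wpM2l ?sqr_ge0 //.
apply: (@le_trans _ _ (16 * expR (`|t| / 2) * expR (`|t| / 2))).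
  by apply: ler_pM => //; rewrite ?sqr_ge0 ?expR_ge0.
rewrite -mulrA h3; lra.
Qed.

End ExponentialBounds.

Section Subgaussian.
Context {R : realType} {d : nat}.
Local Notation E := 'rV[R]_d.
Implicit Types (mu nu : probability E R).

Definition subgaussian nu := exists k lam : R, 0 <= lam /\
  forall a : E, (\int[nu]_x (expR (dot a x))%:E <= (expR (k + lam * sqnorm a))%:E)%E.

Lemma measurable_dotl (a : E) : measurable_fun [set: E] (dot a).
Proof. exact: (measurable_dot (measurable_cst a) (@measurable_id _ _ setT)). Qed.

Lemma measurable_expR_dot (a : E) : measurable_fun [set: E] (fun x => expR (dot a x)).
Proof. by apply: measurableT_comp => //; exact: measurable_dotl. Qed.

Lemma integrable_ge0 {dT} {T : measurableType dT} (P : probability T R) (u : T -> R) :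
  measurable_fun [set: T] u -> (forall x, 0 <= u x) -> (\int[P]_x (u x)%:E < +oo)%E ->
  P.-integrable [set: T] (EFin \o u).
Proof.
move=> mu u0 uoo; apply/integrableP; split; first exact/measurable_EFinP.
by under eq_integral do rewrite /= ger0_norm //.
Qed.

Lemma subgaussian_integrable nu (a : E) : subgaussian nu ->
  nu.-integrable [set: E] (fun x => (expR (dot a x))%:E).
Proof.
move=> [k [lam [_ sg]]]; apply: integrable_ge0 => //.
- exact: measurable_expR_dot.
- by apply: (le_lt_trans (sg a)); exact: ltry.
Qed.

Lemma dot_delta (x : E) i : dot (delta_mx 0 i) x = x 0 i.
Proof.
rewrite /dot (bigD1 i) //= mxE !eqxx mul1r big1 ?addr0 // => j ji.
by rewrite mxE eqxx (negbTE ji) mul0r.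
Qed.

Lemma sqnorm_le_expR (x : E) : sqnorm x <= \sum_(i < d)
  4 * (expR (dot (delta_mx 0 i) x) + expR (dot (- delta_mx 0 i) x)).
Proof.
apply: ler_sum => i _; rewrite dotNl dot_delta -expr2.
by apply: (le_trans (sqr_le_expR _)); rewrite ler_pM2l // expR_norm_le.
Qed.

Lemma subgaussian_P2 nu : subgaussian nu -> P2 nu.
Proof.
move=> sg; have H : nu.-integrable setT (fun x => (sqnorm x)%:E).
  apply: (@integrable_le _ _ _ _ _ (fun x => \sum_(i < d)
    4 * (expR (dot (delta_mx 0 i) x) + expR (dot (- delta_mx 0 i) x)))).
  - exact: (measurable_sqnorm (@measurable_id _ _ setT)).
  - by move=> x; rewrite ger0_norm ?sqnorm_ge0 //; exact: sqnorm_le_expR.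
  apply: (eq_integrable measurableT (fun x => \sum_(i < d)
     (4%:E * ((expR (dot (delta_mx 0 i) x))%:E + (expR (dot (- delta_mx 0 i) x))%:E)))%E).
    by move=> x _ /=; rewrite -sumEFin.
  apply: integrable_sum => // i _; apply: integrableZl => //.
  by apply: integrableD => //; exact: subgaussian_integrable.
have /integrableP[_] := H.
by under eq_integral do rewrite gee0_abs ?lee_fin ?sqnorm_ge0 //.
Qed.

End Subgaussian.

Section GibbsKernel.
Context {R : realType} {d : nat}.
Local Notation E := 'rV[R]_d.
Implicit Types (eps : R) (f g : E -> R) (nu : probability E R) (x y z v : E).

Definition gibbs eps f g (z : E * E) : R :=
  expR (eps^-1 * (f z.1 + g z.2 - sqnorm (z.1 - z.2))).

Lemma gibbs_gt0 eps f g (z : E * E) : 0 < gibbs eps f g z.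
Proof. exact: expR_gt0. Qed.

Lemma measurable_gibbs eps f g : measurable_fun [set: E] f ->
  measurable_fun [set: E] g -> measurable_fun [set: E * E] (gibbs eps f g).
Proof.
move=> mf mg; apply: measurableT_comp => //; apply: measurable_funM => //.
apply: measurable_funB; last exact: measurable_cost.
by apply: measurable_funD; apply: measurableT_comp.
Qed.

Lemma sqnormN x : sqnorm (- x) = sqnorm x.
Proof. by rewrite /sqnorm !dotE opprK. Qed.

Lemma sqnormBC x y : sqnorm (x - y) = sqnorm (y - x).
Proof. by rewrite -sqnormN opprB. Qed.

Lemma sqnormD x y : sqnorm (x + y) = sqnorm x + 2 * dot x y + sqnorm y.
Proof. rewrite /sqnorm !dotE (dotC y x); ring. Qed.

Lemma sqnormB x y : sqnorm (x - y) = sqnorm x - 2 * dot x y + sqnorm y.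
Proof. rewrite /sqnorm !dotE (dotC y x); ring. Qed.

Lemma sqnormZ a x : sqnorm (a *: x) = a ^+ 2 * sqnorm x.
Proof. rewrite /sqnorm !dotE; ring. Qed.

Lemma gibbsC eps f g x y : gibbs eps f g (x, y) = gibbs eps g f (y, x).
Proof. by rewrite /gibbs /= sqnormBC (addrC (f x)). Qed.

Section Conditional.
Variables (eps : R) (f g : E -> R) (nu : probability E R).
Hypothesis eps0 : 0 < eps.
Hypothesis mf : measurable_fun [set: E] f.
Hypothesis mg : measurable_fun [set: E] g.
Hypothesis g1 : forall x, (\int[nu]_y (gibbs eps f g (x, y))%:E = 1)%E.

Let measurable_slice x : measurable_fun [set: E] (fun y => gibbs eps f g (x, y)).
Proof. exact: (measurable_fun_pair2 x (measurable_gibbs eps mf mg)). Qed.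

Let exists_cond x : exists P, has_density nu (fun y => gibbs eps f g (x, y)) P.
Proof. by apply: exists_density => // y; exact/ltW/gibbs_gt0. Qed.

Definition cond x : probability E R := sval (cid (exists_cond x)).

Lemma cond_density x : has_density nu (fun y => gibbs eps f g (x, y)) (cond x).
Proof. exact: (svalP (cid (exists_cond x))). Qed.

Definition cumulant x v : R := sqnorm v + 2 * dot x v + f x - f (x + v).

(** Moving x to x + v changes |x-y|^2 by a term affine in y, so the kernel at x + v is the kernel at
    x times exp(2<v,y>/eps), up to a factor constant in y; its total mass 1 evaluates the
    integral. *)
Lemma cond_mgf x v :
  (\int[cond x]_y (expR (2 / eps * dot v y))%:E = (expR (cumulant x v / eps))%:E)%E.
Proof.
have mexp : measurable_fun setT (fun y => expR (2 / eps * dot v y)).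
  by apply: measurableT_comp => //; apply: measurable_funM => //; exact: measurable_dotl.
rewrite cond_density; [|exact/measurable_EFinP|by move=> y; rewrite lee_fin expR_ge0].
have -> : (\int[nu]_y ((expR (2 / eps * dot v y))%:E * (gibbs eps f g (x, y))%:E) =
    \int[nu]_y ((expR (cumulant x v / eps))%:E * (gibbs eps f g (x + v, y))%:E))%E.
  apply: eq_integral => y _; rewrite -!EFinM -!expRD; congr (expR _)%:E.
  rewrite /= /cumulant (_ : x + v - y = x - y + v); last by rewrite addrAC.
  rewrite [sqnorm (x - y + v)]sqnormD dotDl dotNl (dotC y v).
  by field; rewrite gt_eqF.
rewrite ge0_integralZl //; last 2 first.
- exact/measurable_EFinP.
- by move=> y _; exact/ltW/gibbs_gt0.
by rewrite g1 mule1.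
Qed.

Lemma cond_integrable_expR x (a : E) :
  (cond x).-integrable [set: E] (fun y => (expR (dot a y))%:E).
Proof.
apply: integrable_ge0 => //; first exact: measurable_expR_dot.
have := cond_mgf x ((eps / 2) *: a).
have e1 : 2 / eps * (eps / 2) = 1 by field; rewrite gt_eqF.
under eq_integral do rewrite dotZl mulrA e1 mul1r.
by move=> ->; exact: ltry.
Qed.

Lemma cond_integrable_dot x (a : E) :
  (cond x).-integrable [set: E] (fun y => (dot a y)%:E).
Proof.
apply: (@integrable_le _ _ _ _ _ (fun y => expR (dot a y) + expR (dot (- a) y))).
- exact: measurable_dotl.
- by move=> y; rewrite dotNl; exact: norm_le_expRDN.
exact: (integrableD measurableT (cond_integrable_expR x a) (cond_integrable_expR x (- a))).
Qed.

Definition cond_mean x : E :=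
  \row_i fine (\int[cond x]_y (dot (delta_mx 0 i) y)%:E)%E.

Lemma dot_cond_mean x (a : E) :
  (\int[cond x]_y (dot a y)%:E = (dot a (cond_mean x))%:E)%E.
Proof.
have -> : (\int[cond x]_y (dot a y)%:E = \int[cond x]_y
    (\sum_(i < d) ((a 0 i)%:E * (dot (delta_mx 0 i) y)%:E)))%E.
  apply: eq_integral => y _; rewrite [in LHS]/dot -sumEFin.
  by apply: eq_bigr => i _; rewrite dot_delta EFinM.
have ji i := cond_integrable_dot x (delta_mx 0 i).
rewrite integral_sum //; last by move=> i; exact: integrableZl.
rewrite [in RHS]/dot -[RHS]sumEFin; apply: eq_bigr => i _.
by rewrite integralZl // /cond_mean mxE EFinM fineK // integrable_fin_num.
Qed.

(** Jensen's inequality, by integrating the tangent of exp at c, the mean of the exponent. *)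
Lemma cumulant_ge x v : 2 * dot v (cond_mean x) <= cumulant x v.
Proof.
pose c := 2 / eps * dot v (cond_mean x).
have jv := cond_integrable_dot x (2 / eps *: v).
have jv' : (cond x).-integrable setT (
  fun y => (expR c)%:E * ((1 - c)%:E + (dot (2 / eps *: v) y)%:E))%E.
  by apply: integrableZl => //; apply: integrableD => //; exact: integrable_cst.
have jc : (cond x).-integrable setT (fun=> (1 - c)%:E) by exact: integrable_cst.
have H : (\int[cond x]_y ((expR c)%:E * ((1 - c)%:E + (dot (2 / eps *: v) y)%:E)) <=
    \int[cond x]_y (expR (dot (2 / eps *: v) y))%:E)%E.
  apply: le_integral => //; first exact: cond_integrable_expR.
  move=> y _; rewrite -EFinD -EFinM lee_fin.
  set t := dot _ y.
  have -> : expR t = expR c * expR (t - c) by rewrite -expRD; congr expR; ring.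
  by rewrite ler_pM2l ?expR_gt0 //; have := expR_ge1Dx (t - c); lra.
move: H; rewrite integralZl //; last by apply: integrableD.
rewrite integralD // integral_cst1 dot_cond_mean dotZl -/c.
have -> : (\int[cond x]_y (expR (dot (2 / eps *: v) y))%:E =
    \int[cond x]_y (expR (2 / eps * dot v y))%:E)%E.
  by apply: eq_integral => y _; rewrite dotZl.
rewrite cond_mgf -EFinD -EFinM subrK mulr1 lee_fin ler_expR /c.
by rewrite ler_pdivlMr // mulrAC divfK ?gt_eqF.
Qed.

Lemma potential_semiconcave x v :
  f (x + v) - f x <= sqnorm v + dot (2 *: (x - cond_mean x)) v.
Proof.
have := cumulant_ge x v; rewrite /cumulant !dotE (dotC (cond_mean x)); lra.
Qed.

(** ln z <= z - 1 bounds the cumulant by the moment generating function, whose second-order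
    remainder along s u is at most s^2 times exponential moments at u and -u. These are again given
    by cumulants, so bounds on f at x and at x + u, x - u are enough. *)
Lemma cumulant_le x (s : R) (u : E) : 0 <= s -> s <= 1 / 2 ->
  cumulant x (s *: u) - 2 * dot (s *: u) (cond_mean x) <=
  eps * (16 * s ^+ 2 * (expR (cumulant x u / eps) + expR (cumulant x (- u) / eps))).
Proof.
move=> s0 s1; set A := cumulant x (s *: u).
have ju := cond_integrable_dot x (2 / eps *: u).
have jsu := cond_integrable_expR x (2 / eps *: (s *: u)).
have je := cond_integrable_expR x (2 / eps *: u).
have jeN := cond_integrable_expR x (2 / eps *: (- u)).
have j1 : (cond x).-integrable setT (fun=> 1%:E) by exact: integrable_cst.
have jsd := integrableZl measurableT s ju.
have jB := integrableB measurableT (integrableB measurableT jsu j1) jsd.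
have jU := integrableZl measurableT (16 * s ^+ 2) (integrableD measurableT je jeN).
have H := le_integral measurableT jB jU.
have {}H : (\int[cond x]_y ((expR (dot (2 / eps *: (s *: u)) y))%:E - 1%:E -
      s%:E * (dot (2 / eps *: u) y)%:E) <=
    \int[cond x]_y ((16 * s ^+ 2)%:E * ((expR (dot (2 / eps *: u) y))%:E +
      (expR (dot (2 / eps *: (- u)) y))%:E)))%E.
  apply: H => y _ /=; rewrite -!EFinD -!EFinM lee_fin.
  have := expR_taylor1_scale_le (dot (2 / eps *: u) y) s0 s1.
  by rewrite !dotE !mulrN mulrCA.
have mgf v : (\int[cond x]_y (expR (dot (2 / eps *: v) y))%:E = (expR (cumulant x v / eps))%:E)%E.
  by rewrite -cond_mgf; apply: eq_integral => y _; rewrite dotZl.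
move: H; rewrite integralB //; last exact: (integrableB measurableT jsu j1).
rewrite integralB // integralZl // integralZl //; last exact: (integrableD measurableT je jeN).
rewrite integralD // !mgf integral_cst1 dot_cond_mean -/A -!EFinD lee_fin => H.
have := expR_ge1Dx (A / eps).
rewrite !dotE in H *.
have -> : A - 2 * (s * dot u (cond_mean x)) =
  eps * (A / eps - s * (2 / eps * dot u (cond_mean x))) by field; rewrite gt_eqF.
rewrite ler_pM2l //; lra.
Qed.

End Conditional.
End GibbsKernel.

(** * Semiconcave functions of quadratic growth *)

Section Tame.
Context {R : realType} {d : nat}.
Local Notation E := 'rV[R]_d.
Implicit Types (f : E -> R) (xi : E -> E) (x y u v : E).

Lemma dot_le_sqnorm (lam : R) x y : 0 < lam ->
  dot x y <= (2 * lam)^-1 * sqnorm x + lam / 2 * sqnorm y.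
Proof.
move=> lam0; have := sqnorm_ge0 (lam^-1 *: x - y).
rewrite sqnormB sqnormZ dotZl -(ler_pM2l (_ : 0 < lam / 2)) ?divr_gt0 // mulr0.
have -> : lam / 2 * (lam^-1 ^+ 2 * sqnorm x - 2 * (lam^-1 * dot x y) + sqnorm y) =
   (2 * lam)^-1 * sqnorm x - dot x y + lam / 2 * sqnorm y.
  by field; rewrite gt_eqF.
lra.
Qed.

Lemma dot_le_half x y : dot x y <= (sqnorm x + sqnorm y) / 2.
Proof. by have := sqnorm_ge0 (x - y); rewrite sqnormB; lra. Qed.

Lemma sqnormD_le x y : sqnorm (x + y) <= 2 * sqnorm x + 2 * sqnorm y.
Proof. by rewrite -[y]opprK; have := sqnormB_le x (- y); rewrite sqnormN opprK. Qed.

Lemma sqnorm_eq0 x : sqnorm x = 0 -> x = 0.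
Proof.
move=> /eqP; rewrite psumr_eq0 => [/allP x0|i _]; last by rewrite -expr2 sqr_ge0.
apply/rowP => i; rewrite mxE; apply/eqP; rewrite -sqrf_eq0 expr2.
by apply: x0; rewrite mem_index_enum.
Qed.

Lemma sqnorm0 : sqnorm (0 : E) = 0.
Proof. by rewrite /sqnorm /dot big1 // => i _; rewrite mxE mul0r. Qed.

(** The slack in the semiconcavity inequality, that is |v|^2 minus the first-order Taylor error.
    Being nonnegative on the functions considered, it can be integrated and bounded without a prior
    integrability proof. *)
Definition taylor_defect f xi x v : R :=
  sqnorm v + dot (xi x) v - (f (x + v) - f x).

(** What is retained of a potential once the kernel is left behind. That [xi] is the gradient
    follows from the two bounds on the defect. The last clause is uniform for bounded x only,
    because its constant grows with the cumulants of the conditional law. *)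
Record tame f xi : Prop := Tame {
  tame_measurable : measurable_fun [set: E] f;
  tame_quadratic : exists2 C : R, 0 <= C & forall x, `|f x| <= C * (1 + sqnorm x);
  tame_semiconcave : forall x v, 0 <= taylor_defect f xi x v;
  tame_local : forall M : R, exists2 G : R, 0 <= G & forall x v,
    sqnorm x <= M -> sqnorm v <= 1 -> taylor_defect f xi x v <= G * sqnorm v }.

Section TameTheory.
Variables (f : E -> R) (xi : E -> E).
Hypothesis tf : tame f xi.

Lemma tame_growth : exists2 C : R, 0 <= C & forall x, sqnorm (xi x) <= C * (1 + sqnorm x).
Proof.
have [C C0 fC] := tame_quadratic tf.
(* Semiconcavity is tested along -s xi(x): this gains s |xi|^2 and loses s^2 (1 + 2C) |xi|^2, and
   the present s makes the loss half of the gain. *)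
pose s : R := (2 * (1 + 2 * C))^-1.
have s0 : 0 < s by rewrite invr_gt0; lra.
exists (2 / s * (3 * C)) => [|x]; first by rewrite !mulr_ge0 // invr_ge0 ltW.
have := tame_semiconcave tf x (- s *: xi x).
rewrite /taylor_defect sqnormZ dotZr sqrrN -/(sqnorm (xi x)) => h.
have := fC x; have := fC (x + - s *: xi x).
rewrite !ler_norml => /andP[h1 _] /andP[_ h2].
have h3 : sqnorm (x + - s *: xi x) <= 2 * sqnorm x + 2 * (s ^+ 2 * sqnorm (xi x)).
  by apply: (le_trans (sqnormD_le _ _)); rewrite sqnormZ sqrrN.
have h4 : C * (1 + sqnorm (x + - s *: xi x)) <=
    C * (1 + (2 * sqnorm x + 2 * (s ^+ 2 * sqnorm (xi x)))).
  by rewrite ler_wpM2l // lerD2l.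
have hs : s * (1 + 2 * C) = 2^-1 by rewrite /s; field; rewrite gt_eqF //; lra.
set X := sqnorm (xi x) in h h1 h2 h3 h4 *.
have h5 : s * X - s * (s * (1 + 2 * C)) * X <= C * (2 + 3 * sqnorm x) by nra.
rewrite hs in h5.
have x0 := sqnorm_ge0 x.
have h6 : s / 2 * X <= 3 * C * (1 + sqnorm x) by nra.
rewrite -(ler_pM2l (_ : 0 < s / 2)); last by rewrite divr_gt0.
have -> : s / 2 * (2 / s * (3 * C) * (1 + sqnorm x)) = 3 * C * (1 + sqnorm x).
  by field; rewrite gt_eqF.
exact: h6.
Qed.

(** Semiconcavity read backwards from x + v bounds the defect by 2|v|^2 + <xi x - xi(x+v), v>;
    Young's inequality and the growth of xi conclude. The free lam trades the coefficient of |v|^2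
    against that of 1 + |x|^2. *)
Lemma tame_global : exists2 C : R, 0 <= C & forall (lam : R) x v, 1 <= lam ->
  taylor_defect f xi x v <= (C + lam) * sqnorm v + C / lam * (1 + sqnorm x).
Proof.
have [C C0 xiC] := tame_growth; exists (2 + 2 * C) => [|lam x v lam1]; first lra.
have lam0 : 0 < lam by lra.
have h1 := tame_semiconcave tf (x + v) (- v).
rewrite /taylor_defect sqnormN addrK dotNr in h1.
have h2 := dot_le_sqnorm (xi x) v lam0.
have h3 := dot_le_sqnorm (- xi (x + v)) v lam0.
rewrite sqnormN dotNl in h3.
have hx := xiC x; have hxv := xiC (x + v).
have h4 := sqnormD_le x v.
have x0 := sqnorm_ge0 x; have v0 := sqnorm_ge0 v.
set k := (2 * lam)^-1 in h2 h3.
have k0 : 0 < k by rewrite invr_gt0; lra.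
have kE : k = lam^-1 / 2 by rewrite /k; field; rewrite gt_eqF.
have l1 : lam^-1 <= 1 by rewrite invf_le1.
have h5 : k * sqnorm (xi x) <= k * (C * (1 + sqnorm x)) by rewrite ler_pM2l.
have h6 : k * sqnorm (xi (x + v)) <= k * (C * (1 + (2 * sqnorm x + 2 * sqnorm v))).
  rewrite ler_pM2l //; apply: (le_trans hxv); rewrite ler_wpM2l //; lra.
rewrite /taylor_defect.
have il0 : 0 < lam^-1 by rewrite invr_gt0.
rewrite kE in h2 h3 h5 h6.
have h7 : lam^-1 * C * sqnorm v <= C * sqnorm v.
  by rewrite -mulrA ler_piMl // mulr_ge0.
have h8 : 0 <= lam^-1 * C * sqnorm x by rewrite !mulr_ge0 // ltW.
have h9 : 0 <= lam^-1 * sqnorm x by rewrite !mulr_ge0 // ltW.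
have h10 : 0 <= lam^-1 * C by rewrite !mulr_ge0 // ltW.
have h11 : 0 <= C * sqnorm v by rewrite mulr_ge0.
lra.
Qed.

End TameTheory.
End Tame.

Section PotentialTame.
Context {R : realType} {d : nat}.
Local Notation E := 'rV[R]_d.
Implicit Types (x y u v : E).
Variables (eps : R) (f g : E -> R) (nu : probability E R).
Hypothesis eps0 : 0 < eps.
Hypothesis mf : measurable_fun [set: E] f.
Hypothesis mg : measurable_fun [set: E] g.
Hypothesis g1 : forall x, (\int[nu]_y (gibbs eps f g (x, y))%:E = 1)%E.

Let m := cond_mean mf mg g1.

(** The upper bound is semiconcavity at 0. For the lower one, the bound on g cancels the |y|^2 of
    the cost in the kernel and leaves the exponential of a linear form, which the subgaussian bound
    integrates; total mass 1 then keeps f x from being too negative. *)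
Lemma potential_quadratic (zeta : E) : subgaussian nu ->
  (forall y, g y - g 0 <= sqnorm y + dot zeta y) ->
  exists2 C : R, 0 <= C & forall x, `|f x| <= C * (1 + sqnorm x).
Proof.
move=> [k [lam [lam0 sg]]] gz.
have ie0 : 0 < eps^-1 by rewrite invr_gt0.
pose z : E := 2 *: (0 - m 0).
exists (`|f 0| + `|g 0| + 2 + sqnorm z + eps * `|k| +
        lam * eps^-1 * (2 * sqnorm zeta + 8)) => [|x].
  by rewrite !addr_ge0 // ?mulr_ge0 ?addr_ge0 ?mulr_ge0 ?sqnorm_ge0 // ltW.
have x0 := sqnorm_ge0 x.
have z0 := sqnorm_ge0 z; have ze0 := sqnorm_ge0 zeta.
have lo : - (g 0) + sqnorm x - eps * k - lam * eps^-1 * (2 * sqnorm zeta + 8 * sqnorm x) <= f x.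
  pose a : E := eps^-1 *: (zeta + 2 *: x).
  pose c := eps^-1 * (f x + g 0 - sqnorm x).
  have : (\int[nu]_y (gibbs eps f g (x, y))%:E <=
          (expR c)%:E * \int[nu]_y (expR (dot a y))%:E)%E.
    have me : measurable_fun [set: E] (fun y => (expR (dot a y))%:E).
      by apply/measurable_EFinP; exact: measurable_expR_dot.
    have mgx : measurable_fun [set: E] (fun y => (gibbs eps f g (x, y))%:E).
      apply/measurable_EFinP.
      exact: (measurable_fun_pair2 x (measurable_gibbs eps mf mg)).
    rewrite -ge0_integralZl //.
    apply: ge0_le_integral => //.
    - by move=> y _; rewrite lee_fin expR_ge0.
    - by apply: emeasurable_funM.
    move=> y _; rewrite -EFinM lee_fin -expRD ler_expR /a /c dotZl -mulrDr.
    rewrite ler_pM2l //= sqnormB dotDl dotZl; have := gz y; lra.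
  rewrite g1 => h.
  have : (1 <= (expR c)%:E * (expR (k + lam * sqnorm a))%:E)%E.
    by apply: (le_trans h); rewrite lee_pmul2l // ?lte_fin ?expR_gt0.
  rewrite -EFinM lee_fin -expRD -[X in X <= _](expR0 R) ler_expR => h2.
  have h3 : sqnorm a <= eps^-1 ^+ 2 * (2 * sqnorm zeta + 8 * sqnorm x).
    rewrite /a sqnormZ ler_wpM2l ?sqr_ge0 //.
    by apply: (le_trans (sqnormD_le _ _)); rewrite sqnormZ; lra.
  have h4 : 0 <= c + (k + lam * (eps^-1 ^+ 2 * (2 * sqnorm zeta + 8 * sqnorm x))).
    by apply: (le_trans h2); rewrite lerD2l lerD2l ler_wpM2l.
  rewrite -(pmulr_rge0 _ eps0) in h4.
  have e1 : eps * (c + (k + lam * (eps^-1 ^+ 2 * (2 * sqnorm zeta + 8 * sqnorm x)))) =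
     f x + g 0 - sqnorm x + eps * k + lam * eps^-1 * (2 * sqnorm zeta + 8 * sqnorm x).
    by rewrite /c; field; rewrite gt_eqF.
  rewrite e1 in h4; lra.
have up := potential_semiconcave eps0 mf mg g1 0 x.
rewrite add0r -/m -/z in up.
have h := dot_le_half z x.
have f0 : f 0 <= `|f 0| by exact: ler_norm.
have g0 : g 0 <= `|g 0| by exact: ler_norm.
have k0 : eps * k <= eps * `|k| by rewrite ler_wpM2l ?ler_norm // ltW.
have e2 : 0 <= eps * `|k| by rewrite mulr_ge0 // ltW.
have l0 : 0 <= lam * eps^-1 by rewrite mulr_ge0 // ltW.
have fp := normr_ge0 (f 0); have gp := normr_ge0 (g 0).
have L1 : 0 <= lam * eps^-1 * sqnorm zeta by rewrite mulr_ge0.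
have L2 : 0 <= lam * eps^-1 * sqnorm x by rewrite mulr_ge0.
have L3 : 0 <= lam * eps^-1 * sqnorm zeta * sqnorm x by rewrite mulr_ge0.
have L4 : 0 <= `|f 0| * sqnorm x by rewrite mulr_ge0.
have L5 : 0 <= `|g 0| * sqnorm x by rewrite mulr_ge0.
have L6 : 0 <= eps * `|k| * sqnorm x by rewrite mulr_ge0.
have L7 : 0 <= sqnorm z * sqnorm x by rewrite mulr_ge0.
by rewrite ler_norml; apply/andP; split; lra.
Qed.

Definition potential_gradient x : E := 2 *: (x - m x).

Lemma potential_tame (C : R) : 0 <= C -> (forall x, `|f x| <= C * (1 + sqnorm x)) ->
  tame f potential_gradient.
Proof.
move=> C0 fC.
have defE x v : taylor_defect f potential_gradient x v =
    cumulant f x v - 2 * dot v (m x).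
  rewrite /taylor_defect /cumulant /potential_gradient dotZl dotDl dotNl (dotC (m x)); ring.
split => //; first by exists C.
- move=> x v; rewrite defE subr_ge0; exact: cumulant_ge.
(* Bounds the cumulant at any u with |u|^2 = 4; the summands account for |u|^2, 2<x,u>, f x and
   -f(x+u), in this order. *)
move=> M; pose A := 4 + (M + 4) + C * (1 + M) + C * (9 + 2 * M).
exists (8 * eps * expR (A / eps)) => [|x v xM v1].
  by rewrite !mulr_ge0 ?expR_ge0 // ltW.
rewrite defE.
have [v0|v0] := eqVneq (sqnorm v) 0.
  rewrite v0 (sqnorm_eq0 v0) /cumulant /= !addr0 sqnorm0.
  have d0 y : dot (0 : E) y = 0 by rewrite -(scale0r 0) dotZl mul0r.
  by rewrite dotC !d0; lra.
have vp : 0 < sqnorm v by rewrite lt_neqAle eq_sym v0 sqnorm_ge0.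
(* v is written s u with |u| = 2 fixed: s^2 = |v|^2/4 carries the quadratic smallness, and |v| <= 1
   gives s <= 1/2. *)
pose s := Num.sqrt (sqnorm v) / 2.
have sp : 0 < s by rewrite divr_gt0 // sqrtr_gt0.
have s2 : s ^+ 2 = sqnorm v / 4.
  by rewrite expr_div_n sqr_sqrtr ?ltW // expr2; lra.
have s1 : s <= 1 / 2.
  rewrite ler_pM2r // ?invr_gt0 // -(sqrtr1 R); exact: ler_wsqrtr.
pose u : E := s^-1 *: v.
have uv : s *: u = v by rewrite scalerA mulfV ?scale1r // gt_eqF.
have u4 : sqnorm u = 4.
  by rewrite sqnormZ exprVn s2; field; rewrite gt_eqF.
have := cumulant_le eps0 mf mg g1 x u (ltW sp) s1.
rewrite uv -/m => h; apply: (le_trans h).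
have cu w : sqnorm w = 4 -> cumulant f x w <= A.
  move=> w4; rewrite /cumulant /A.
  have := fC x; have := fC (x + w); rewrite !ler_norml => /andP[a1 _] /andP[_ a2].
  have a3 : C * (1 + sqnorm x) <= C * (1 + M) by rewrite ler_wpM2l // lerD2l.
  have a4 : C * (1 + sqnorm (x + w)) <= C * (9 + 2 * M).
    by rewrite ler_wpM2l //; have := sqnormD_le x w; lra.
  have := dot_le_half x w; lra.
have e w : sqnorm w = 4 -> expR (cumulant f x w / eps) <= expR (A / eps).
  by move=> w4; rewrite ler_expR ler_pM2r ?invr_gt0 // cu.
have eu := e _ u4; have eN : expR (cumulant f x (- u) / eps) <= expR (A / eps).
  by apply: e; rewrite sqnormN.
have -> : 8 * eps * expR (A / eps) * sqnorm v =
    eps * (16 * s ^+ 2 * (expR (A / eps) + expR (A / eps))) by rewrite s2; field.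
rewrite ler_pM2l // ler_wpM2l ?mulr_ge0 ?sqr_ge0 //; lra.
Qed.

End PotentialTame.

(** * Gradients and integrated Taylor defects *)

Section TameGradient.
Context {R : realType} {d : nat}.
Local Notation E := 'rV[R]_d.

(** At v = h e_i the defect lies between 0 and G h^2, so the difference quotient is within (1 +
    G)|h| of the coordinate of xi. *)
Lemma tame_derivative (f : E -> R) (xi : E -> E) x i : tame f xi ->
  (fun h : R => h^-1 *: (f (h *: delta_mx 0 i + x) - f x)) @ 0^' --> xi x 0 i.
Proof.
move=> tf; have [G G0 GP] := tame_local tf (sqnorm x).
apply/cvgrPdist_le => /= e e0.
pose r := Num.min 1 (e / (1 + G)).
have r0 : 0 < r by rewrite lt_min ltr01 divr_gt0 //; lra.
near=> h.
have h0 : h != 0 by near: h; exact: nbhs_dnbhs_neq.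
have hr : `|h| <= r.
  near: h; apply: dnbhs0_le; exact: r0.
have sqh : sqnorm (h *: delta_mx 0 i : E) = h ^+ 2.
  by rewrite sqnormZ /sqnorm dot_delta mxE !eqxx mulr1.
have h1 : h ^+ 2 <= 1.
  by rewrite -(real_normK (num_real h)) expr_le1 // (le_trans hr) // ge_min lexx.
have lo := tame_semiconcave tf x (h *: delta_mx 0 i).
have up := GP x (h *: delta_mx 0 i) (lexx _).
rewrite sqh in up; have {}up := up h1.
rewrite /taylor_defect sqh dotZr in lo up.
have dE : dot (xi x) (delta_mx 0 i) = xi x 0 i by rewrite dotC dot_delta.
rewrite dE in lo up.
rewrite [h *: _ + x]addrC; move: lo up; set D := f _ - f x => lo up.
rewrite -(ler_pM2l (_ : 0 < `|h|)) ?normr_gt0 // -normrM.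
have -> : h * (xi x 0 i - h^-1 *: D) = h * xi x 0 i - D.
  by rewrite mulrBr /GRing.scale /= mulrA mulfV // mul1r.
apply: (@le_trans _ _ ((1 + G) * h ^+ 2)).
  have := sqr_ge0 h; rewrite ler_norml; set a := _ * xi _ _ _ in lo up *.
  move=> h2; have := mulr_ge0 G0 h2.
  by move: (h ^+ 2) h2 lo up => k h2 lo up Gk; apply/andP; split; lra.
rewrite -(real_normK (num_real h)) expr2 mulrCA ler_wpM2l //.
have := hr; rewrite le_min => /andP[_].
by rewrite ler_pdivlMr ?(mulrC (1 + G)) // ltr_wpDr.
Unshelve. all: by end_near.
Qed.

End TameGradient.

Section TameIntegral.
Context {R : realType} {d : nat}.
Local Notation E := 'rV[R]_d.

Lemma gradient_tameB (f1 f2 : E -> R) (xi1 xi2 : E -> E) :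
  tame f1 xi1 -> tame f2 xi2 ->
  gradient (fun x => f1 x - f2 x) = fun x => xi1 x - xi2 x.
Proof.
move=> t1 t2; apply/funext => x; apply/rowP => i.
rewrite /gradient mxE [RHS]mxE [in RHS]mxE /derive.
apply: cvg_lim => //.
apply: cvg_trans (cvgB (tame_derivative (x := x) (i := i) t1)
  (tame_derivative (x := x) (i := i) t2)).
by apply: near_eq_cvg; near=> h; rewrite /= /GRing.scale /=; rewrite !fctE; ring.
Unshelve. all: by end_near.
Qed.

(** The conditional laws behind a potential gradient are chosen point by point, so measurability is
    read off f, through difference quotients with steps 1/(n+1). *)
Lemma tame_gradient_measurable (f : E -> R) (xi : E -> E) :
  tame f xi -> measurable_fun [set: E] xi.
Proof.
move=> tf; apply: measurable_fun_rV => i.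
pose u n (x : E) := n.+1%:R * (f (x + n.+1%:R^-1 *: delta_mx 0 i) - f x) : R.
apply: (@measurable_fun_cvg _ _ _ _ u) => [n|x _].
  apply: measurable_funM => //; apply: measurable_funB; last exact: tame_measurable tf.
  apply: measurableT_comp (tame_measurable tf) _.
  by apply: measurable_funD_rV => //; exact: measurable_id.
have /cvgr_dnbhsP /(_ harmonic) := tame_derivative (x := x) (i := i) tf.
have -> : (fun n => (harmonic n)^-1 *: (f (harmonic n *: delta_mx 0 i + x) - f x)) = u ^~ x.
  by apply/funext => n; rewrite /u /harmonic invrK (addrC x).
by apply; split => [n|]; [rewrite /harmonic /= invr_eq0 | exact: cvg_harmonic].
Qed.

Lemma measurable_tail (M : R) :
  measurable_fun [set: E] (fun x => (1 + sqnorm x) * \1_[set x : E | M < sqnorm x] x).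
Proof.
have ms : measurable_fun [set: E] (sqnorm : E -> R).
  exact: (measurable_sqnorm (@measurable_id _ _ _)).
apply: measurable_funM; first exact: measurable_funD.
apply: measurable_indic; rewrite -[X in measurable X]setTI.
have -> : [set x : E | M < sqnorm x] = sqnorm @^-1` `]M, +oo[%classic.
  by apply/seteqP; split => x /=; rewrite in_itv /= andbT.
exact: ms.
Qed.

Lemma P2_tail (mu : probability E R) (tau : R) : P2 mu -> 0 < tau ->
  exists2 M : R, 0 <= M &
    (\int[mu]_x ((1 + sqnorm x) * \1_[set x | M < sqnorm x] x)%:E <= tau%:E)%E.
Proof.
move=> mu2 tau0; pose F (n : nat) (x : E) : R :=
  (1 + sqnorm x) * \1_[set x | n%:R < sqnorm x] x.
have mF n : measurable_fun [set: E] (F n) by exact: measurable_tail.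
have ij : mu.-integrable setT (fun x : E => (1 + sqnorm x)%:E).
  exact: (integrableD measurableT (integrable_cst mu 1) (P2_integrable mu2)).
have F0 n x : 0 <= F n x by rewrite mulr_ge0 // addr_ge0 // sqnorm_ge0.
have : (\int[mu]_x (F n x)%:E)%E @[n --> \oo] --> (\int[mu]_x (fun _ : E => 0) x)%E.
  apply: (dominated_cvg measurableT (g := fun x : E => (1 + sqnorm x)%:E)) => //.
- by move=> n; exact/measurable_EFinP.
- move=> x _; apply: cvg_near_cst; near=> n.
  rewrite /F indicE memNset ?mulr0 //=; apply/negP; rewrite -leNgt.
  by near: n; exact: nbhs_infty_ger.
- move=> n x _; rewrite lee_fin ger0_norm // ler_piMr // ?addr_ge0 ?sqnorm_ge0 //.
rewrite integral0 => h.
have [n hn] : exists n, (\int[mu]_x (F n x)%:E <= tau%:E)%E.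
  have /fine_cvgP[hf hc] := h.
  have /cvgrPdist_le/(_ _ tau0) hd := hc.
  have [n [hn1 hn2]] := @filter_ex _ _ _ _ (filterI hf hd).
  exists n; rewrite -(fineK hn1) lee_fin; move: hn2 => /=.
  by rewrite sub0r normrN; apply: le_trans; exact: ler_norm.
by exists n%:R.
Unshelve. all: by end_near.
Qed.

Lemma measurable_taylor_defect (f : E -> R) (xi : E -> E) : tame f xi ->
  measurable_fun [set: E * E] (fun z => taylor_defect f xi z.1 (z.2 - z.1)).
Proof.
move=> tf; have mf := tame_measurable tf.
have mxi := tame_gradient_measurable tf.
have mB : measurable_fun [set: E * E] (fun z : E * E => z.2 - z.1).
  exact: measurable_funB_rV.
apply: measurable_funB; first apply: measurable_funD.
- exact: measurable_sqnorm.
- by apply: measurable_dot => //; apply: measurableT_comp mxi _.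
apply: measurable_funB; last exact: measurableT_comp mf _.
under eq_fun do rewrite addrC subrK.
exact: measurableT_comp mf _.
Qed.

(* On {|x|^2 <= M} the defect is O(|v|^2).  On the complement the bound of tame_global
   is used with lam = eta / (2 w), which turns a tail of mass (eta/2)^2 into eta w. *)
Lemma tame_remainder (mu : probability E R) (f : E -> R) (xi : E -> E) (eta : R) :
  P2 mu -> tame f xi -> 0 < eta ->
  exists2 K : R, 0 <= K & forall (nu : probability E R) pi (w : R),
    P2 nu -> coupling mu nu pi -> 0 <= w -> transport_cost pi = (w ^+ 2)%:E ->
    (\int[pi]_z (taylor_defect f xi z.1 (z.2 - z.1))%:E <= (K * w ^+ 2 + eta * w)%:E)%E.
Proof.
move=> mu2 tf eta0.
have [C C0 CP] := tame_global tf.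
(* C times this tail is at most (eta/2)^2; the 1 in 1 + C covers C = 0. *)
have tau0 : 0 < (eta / 2) ^+ 2 / (1 + C) by rewrite divr_gt0 ?exprn_gt0 ?divr_gt0 // ltr_pwDl.
have [M M0 tail] := P2_tail mu2 tau0.
have [G G0 GP] := tame_local tf M.
pose K1 := G + C + 1 + C * (1 + M).
have CM0 : 0 <= C * (1 + M) by rewrite mulr_ge0 // addr_ge0.
exists (K1 + 1) => [|nu pi w nu2 cpl w0 wE]; first by rewrite /K1; lra.
pose T (x : E) : R := (1 + sqnorm x) * \1_[set x | M < sqnorm x] x.
have T0 x : 0 <= T x by rewrite mulr_ge0 // addr_ge0 // sqnorm_ge0.
(* Three regimes: large x uses the global bound; bounded x with |v| <= 1 the local one; bounded x
   with |v| > 1 the global one with lam = 1, whose constant term is absorbed by |v|^2. *)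
have pw (lam : R) x v : 1 <= lam -> taylor_defect f xi x v <=
    (K1 + lam) * sqnorm v + C / lam * T x.
  move=> lam1; have v0 := sqnorm_ge0 v; have lam0 : 0 < lam by lra.
  have Cl0 : 0 <= C / lam by rewrite divr_ge0 // ltW.
  rewrite /T indicE; have [xM|xM] := ltP M (sqnorm x).
    rewrite mem_set //= mulr1; apply: (le_trans (CP _ x v lam1)).
    by rewrite lerD2r ler_wpM2r // lerD2r /K1; lra.
  rewrite memNset /=; last by apply/negP; rewrite -leNgt.
  rewrite !mulr0 addr0.
  have [v1|v1] := leP (sqnorm v) 1.
    by apply: (le_trans (GP _ _ xM v1)); rewrite ler_wpM2r // /K1; lra.
  apply: (le_trans (CP _ x v (lexx 1))); rewrite divr1.
  have h1 : C * (1 + sqnorm x) <= C * (1 + M) * sqnorm v.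
    apply: (@le_trans _ _ (C * (1 + M))); first by rewrite ler_wpM2l // lerD2l.
    by rewrite ler_peMr // ltW.
  have -> : (K1 + lam) * sqnorm v = (C + 1) * sqnorm v + C * (1 + M) * sqnorm v +
     (G + lam) * sqnorm v by rewrite /K1; ring.
  have : 0 <= (G + lam) * sqnorm v by rewrite mulr_ge0 // addr_ge0 // ltW.
  lra.
have mT : measurable_fun [set: E] T by exact: measurable_tail.
have int_le (lam : R) : 1 <= lam ->
    (\int[pi]_z (taylor_defect f xi z.1 (z.2 - z.1))%:E <=
     ((K1 + lam) * w ^+ 2 + lam^-1 * (eta / 2) ^+ 2)%:E)%E.
  move=> lam1; have lam0 : 0 < lam by lra.
  have Cl0 : 0 <= C / lam by rewrite divr_ge0 // ltW.
  have Kl0 : 0 <= K1 + lam by rewrite /K1; lra.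
  apply: (@le_trans _ _ (\int[pi]_z ((K1 + lam)%:E * (sqnorm (z.1 - z.2))%:E +
      (C / lam)%:E * (T z.1)%:E))%E).
    apply: ge0_le_integral => //.
    - by move=> z _; rewrite lee_fin; exact: tame_semiconcave tf _ _.
    - by apply/measurable_EFinP; exact: measurable_taylor_defect.
    - apply/measurable_EFinP; apply: measurable_funD.
        by apply: measurable_funM => //; exact: measurable_cost.
      apply: measurable_funM => //; exact: (measurableT_comp mT).
    - by move=> z _; rewrite -!EFinM -EFinD lee_fin sqnormBC; exact: pw.
  rewrite ge0_integralD //; last 4 first.
  - by move=> z _; rewrite -EFinM lee_fin mulr_ge0 // sqnorm_ge0.
  - apply/measurable_EFinP; apply: measurable_funM => //; exact: measurable_cost.
  - by move=> z _; rewrite -EFinM lee_fin mulr_ge0.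
  - apply/measurable_EFinP; apply: measurable_funM => //; exact: (measurableT_comp mT).
  rewrite ge0_integralZl //; last 2 first.
  - apply/measurable_EFinP; exact: measurable_cost.
  - by move=> z _; rewrite lee_fin sqnorm_ge0.
  rewrite ge0_integralZl //; last 2 first.
  - by apply/measurable_EFinP; exact: (measurableT_comp mT).
  - by move=> z _; rewrite lee_fin T0.
  have -> : (\int[pi]_z (T z.1)%:E = \int[mu]_x (T x)%:E)%E.
    apply/esym; apply: (law_ge0_integral _ (coupling_fst cpl) (f := EFin \o T)) => //.
    exact/measurable_EFinP.
  rewrite -[(\int[pi]_x (sqnorm (x.1 - x.2))%:E)%E]/(transport_cost pi) wE.
  rewrite [leRHS](_ : _ = (K1 + lam)%:E * (w ^+ 2)%:E + (lam^-1 * (eta / 2) ^+ 2)%:E)%E //.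
  apply: leeD2l.
  apply: (@le_trans _ _ ((C / lam)%:E * ((eta / 2) ^+ 2 / (1 + C))%:E)%E).
    by rewrite lee_wpmul2l // lee_fin.
  rewrite -EFinM lee_fin.
  have -> : C / lam * ((eta / 2) ^+ 2 / (1 + C)) = lam^-1 * (eta / 2) ^+ 2 * (C / (1 + C)).
    by field; rewrite !gt_eqF // ltr_pwDl.
  have h0 : 0 <= lam^-1 * (eta / 2) ^+ 2.
    by rewrite mulr_ge0 ?sqr_ge0 // invr_ge0 ltW.
  rewrite ler_piMr //.
  by rewrite ler_pdivrMr ?mul1r ?ltr_pwDl // lerDr.
have [wlt|wge] := ltP w (eta / 2); last first.
  (* For w >= eta/2 the value lam = 1 is enough, since (eta/2)^2 <= (eta/2) w; it accounts for the 1
     in K1 + 1. *)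
  apply: (le_trans (int_le 1 (lexx _))).
  rewrite lee_fin lerD2l invr1 mul1r expr2.
  have : eta / 2 * (eta / 2) <= eta / 2 * w by rewrite ler_pM2l // divr_gt0.
  have := mulr_ge0 (ltW eta0) w0; lra.
have [w_eq0|wn0] := eqVneq w 0.
  rewrite w_eq0 expr0n /= !mulr0 addr0.
  apply/lee_addgt0Pr => e e0; rewrite add0e.
  have := int_le (1 + (eta / 2) ^+ 2 / e).
  rewrite w_eq0 expr0n /= mulr0 add0r => /(_ _)/le_trans; apply.
    by rewrite lerDl divr_ge0 ?sqr_ge0 // ltW.
  rewrite lee_fin -ler_pdivlMl ?invr_gt0 ?invrK; last first.
    by rewrite ltr_pwDl // divr_ge0 ?sqr_ge0 // ltW.
  rewrite mulrDl mul1r divfK ?gt_eqF // lerDr ltW //.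
have wp : 0 < w by rewrite lt_neqAle eq_sym wn0.
have l1 : 1 <= eta / 2 / w by rewrite ler_pdivlMr // mul1r ltW.
apply: (le_trans (int_le _ l1)); rewrite lee_fin.
have -> : (K1 + eta / 2 / w) * w ^+ 2 + (eta / 2 / w)^-1 * (eta / 2) ^+ 2 =
   K1 * w ^+ 2 + eta * w.
  by field; rewrite !gt_eqF.
by rewrite lerD2r; have := sqr_ge0 w; clearbody K1; lra.
Qed.

End TameIntegral.

(** * Gaussian measures *)

Section Gaussian.
Context {R : realType}.

(** Completing the square turns exp(s x) times the standard density into exp(s^2/2) times the
    density centred at s. *)
Lemma normal_mgf (s : R) :
  (\int[normal_prob (0 : R) 1]_x (expR (s * x))%:E = (expR (s ^+ 2 / 2))%:E)%E.
Proof.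
have ms : measurable_fun [set: R] (fun x => expR (s * x)).
  by apply: measurableT_comp => //; exact: measurable_funM.
transitivity (\int[lebesgue_measure]_x ((expR (s * x))%:E * (normal_pdf (0 : R) 1 x)%:E))%E.
  apply: (ge0_integral_density (Q := lebesgue_measure) (P := normal_prob (0 : R) 1)) => //.
  - exact: measurable_normal_pdf.
  - by move=> x; exact: normal_pdf_ge0.
  - exact: integrable_normal_pdf.
  - exact/measurable_EFinP.
transitivity (\int[lebesgue_measure]_x ((expR (s ^+ 2 / 2))%:E * (normal_pdf s 1 x)%:E))%E.
  apply: eq_integral => x _; rewrite -!EFinM /normal_pdf oner_eq0.
  congr (_%:E); rewrite mulrCA [RHS]mulrCA /normal_fun -!expRD.
  by congr (_ * expR _); field.
rewrite ge0_integralZl //; last 2 first.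
- by apply/measurable_EFinP; exact: measurable_normal_pdf.
- by move=> x _; rewrite lee_fin normal_pdf_ge0.
by rewrite integral_normal_pdf mule1.
Qed.

Context {d : nat}.
Local Notation E := 'rV[R]_d.

Lemma standard_gaussian_coord (gamma : probability E R) i :
  standard_gaussian gamma ->
  has_law (T2 := measurableTypeR R) gamma (fun x => x 0 i) (normal_prob (0 : R) 1).
Proof.
move=> sg V mV.
pose A (j : 'I_d) : set R := if j == i then V else setT.
have mA j : measurable (A j) by rewrite /A; case: ifP.
have AE : [set x : E | forall j, A j (x 0 j)] = (fun x : E => x 0 i) @^-1` V.
  apply/seteqP; split => x /= => [/(_ i)|xV j]; first by rewrite /A eqxx.
  by rewrite /A; case: eqP => [->|].
apply/esym; rewrite -AE; apply: (etrans (sg A mA)).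
rewrite (bigD1 i) //= big1 => [|j ji]; first by rewrite mule1 {1}/A eqxx.
rewrite /A (negbTE ji); exact: (@probability_setT _ _ _ (normal_prob (0 : R) 1)).
Qed.

Lemma dot_sqr_le (a b : E) : dot a b ^+ 2 <= sqnorm a * sqnorm b.
Proof.
have [b0|b0] := eqVneq (sqnorm b) 0.
  by rewrite (sqnorm_eq0 b0) dotC -(scale0r 0) dotZl mul0r expr0n /= mulr_ge0 // sqnorm_ge0.
have bp : 0 < sqnorm b by rewrite lt_neqAle eq_sym b0 sqnorm_ge0.
have := sqnorm_ge0 (a - (dot a b / sqnorm b) *: b).
rewrite sqnormB sqnormZ dotZr.
rewrite -(pmulr_rge0 _ bp) (_ : sqnorm b * _ = sqnorm a * sqnorm b - dot a b ^+ 2).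
  by rewrite subr_ge0.
by field.
Qed.

(** <a,x> is the mean of the d numbers d a_i x_i, so one of them is at least as large. This reduces
    the bound to one-dimensional marginals. *)
Lemma expR_dot_le (a x : E) : (0 < d)%N ->
  expR (dot a x) <= \sum_(i < d) expR (d%:R * a 0 i * x 0 i).
Proof.
move=> d0.
have [i hi] : exists i, dot a x <= d%:R * a 0 i * x 0 i.
  apply/not_existsP => H.
  have : \sum_(i < d) (d%:R * a 0 i * x 0 i) < \sum_(i < d) dot a x.
    apply: ltr_sum => [|i _]; last by rewrite ltNge; apply/negP/H.
    by apply/hasP; exists (Ordinal d0); rewrite ?mem_index_enum.
  have -> : \sum_(i < d) (d%:R * a 0 i * x 0 i) = d%:R * dot a x.
    by rewrite /dot mulr_sumr; apply: eq_bigr => i _; rewrite mulrA.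
  by rewrite sumr_const card_ord mulr_natl ltxx.
rewrite (bigD1 i) //=; apply: (@le_trans _ _ (expR (d%:R * a 0 i * x 0 i))).
  by rewrite ler_expR.
by rewrite lerDl sumr_ge0 // => j _; exact: expR_ge0.
Qed.

Lemma standard_gaussian_subgaussian (gamma : probability E R) : (0 < d)%N ->
  standard_gaussian gamma -> subgaussian gamma.
Proof.
(* The coefficient d^2/2 comes from the normal moment generating function at d a_i; the number d of
   summands is absorbed by d <= exp d. *)
move=> d0 sg; exists (d%:R), (d%:R ^+ 2 / 2); split; first by rewrite divr_ge0 ?sqr_ge0.
move=> a.
have mi i : measurable_fun [set: E] (fun x => (expR (d%:R * a 0 i * x 0 i))%:E).
  apply/measurable_EFinP; apply: measurableT_comp => //.
  by apply: measurable_funM => //; apply: measurable_fun_coord; exact: measurable_id.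
apply: (@le_trans _ _ (\int[gamma]_x (\sum_(i < d) (expR (d%:R * a 0 i * x 0 i))%:E))%E).
  apply: ge0_le_integral => //.
  - by apply/measurable_EFinP; exact: measurable_expR_dot.
  - exact: emeasurable_sum.
  - by move=> x _; rewrite sumEFin lee_fin expR_dot_le.
rewrite ge0_integral_sum //.
have le1 i : (\int[gamma]_x (expR (d%:R * a 0 i * x 0 i))%:E <=
    (expR (d%:R ^+ 2 / 2 * sqnorm a))%:E)%E.
  have <- : (\int[normal_prob (0 : R) 1]_t (expR (d%:R * a 0 i * t))%:E =
     \int[gamma]_x (expR (d%:R * a 0 i * x 0 i))%:E)%E.
    apply: (law_ge0_integral _ (standard_gaussian_coord i sg)
      (f := fun t => (expR (d%:R * a 0 i * t))%:E)) => //.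
    - by apply: measurable_fun_coord; exact: measurable_id.
    - apply/measurable_EFinP; apply: measurableT_comp => //; exact: measurable_funM.
  rewrite normal_mgf lee_fin ler_expR exprMn mulrAC ler_wpM2l //.
  rewrite /sqnorm /dot (bigD1 i) //= -expr2 lerDl sumr_ge0 // => j _.
  by rewrite -expr2 sqr_ge0.
apply: (@le_trans _ _ (\sum_(i < d) (expR (d%:R ^+ 2 / 2 * sqnorm a))%:E)%E).
  exact: lee_sum.
rewrite sumEFin lee_fin sumr_const card_ord expRD -[leLHS]mulr_natl ler_wpM2r ?expR_ge0 //.
by have := expR_ge1Dx (d%:R : R); lra.
Qed.

Lemma gaussian_subgaussian (mu : probability E R) : (0 < d)%N ->
  gaussian mu -> subgaussian mu.
Proof.
move=> d0 [gamma [sg [m [M muE]]]].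
have [k [lam [lam0 gk]]] := standard_gaussian_subgaussian d0 sg.
(* The squared Frobenius norm of M; Cauchy-Schwarz row by row gives |a M^T|^2 <= C |a|^2. *)
pose C := \sum_(i < d) sqnorm (row i M).
exists (sqnorm m / 2 + k), (2^-1 + lam * C); split.
  rewrite addr_ge0 // mulr_ge0 // sumr_ge0 // => i _; exact: sqnorm_ge0.
move=> a.
have maff : measurable_fun [set: E] (fun z : E => m + z *m M).
  apply: measurable_fun_rV => i.
  under eq_fun do rewrite !mxE.
  apply: measurable_funD => //; apply: measurable_sum => j.
  by apply: measurable_funM => //; apply: measurable_fun_coord; exact: measurable_id.
have law : has_law gamma (fun z : E => m + z *m M) mu by move=> A mA; exact: muE.
rewrite (law_ge0_integral maff law); last 2 first.
- by apply/measurable_EFinP; exact: measurable_expR_dot.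
- by move=> x; rewrite lee_fin expR_ge0.
have dotM z : dot a (m + z *m M) = dot a m + dot (a *m M^T) z.
  rewrite dotC dotDl (dotC m); congr (_ + _); rewrite /dot.
  under eq_bigr do rewrite mxE mulr_suml.
  rewrite exchange_big; apply: eq_bigr => i _ /=; rewrite mxE mulr_suml.
  by apply: eq_bigr => j _; rewrite mxE; ring.
under eq_integral do rewrite dotM expRD EFinM.
rewrite ge0_integralZl //; last by apply/measurable_EFinP; exact: measurable_expR_dot.
apply: (@le_trans _ _ ((expR (dot a m))%:E * (expR (k + lam * sqnorm (a *m M^T)))%:E)%E).
  by rewrite lee_pmul2l // lte_fin expR_gt0.
rewrite -EFinM lee_fin -expRD ler_expR.
have h : sqnorm (a *m M^T) <= C * sqnorm a.
  rewrite {1}/sqnorm /dot mulr_suml; apply: ler_sum => i _.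
  have -> : (a *m M^T) 0 i = dot a (row i M).
    by rewrite mxE; apply: eq_bigr => j _; rewrite !mxE.
  by rewrite -expr2 mulrC; exact: dot_sqr_le.
have h2 := dot_le_half a m.
have h3 : lam * sqnorm (a *m M^T) <= lam * (C * sqnorm a) by rewrite ler_wpM2l.
clearbody C; lra.
Qed.

End Gaussian.

(** * Bounds through the potentials *)

Section PotentialBounds.
Context {R : realType} {d : nat}.
Local Notation E := 'rV[R]_d.
Local Notation prob := (probability E R).
Local Notation plan := (probability (E * E)%type R).
Implicit Types (mu nu : prob) (pi : plan) (f g : E -> R) (xi : E -> E).

(** A finite f x excludes the values 0 and +oo of the integral, at which the logarithm is infinite;
    otherwise the logarithm can be inverted. *)
Lemma transform_gibbs eps f g nu x : 0 < eps -> measurable_fun [set: E] g ->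
  (f x)%:E = sinkhorn_transform eps g nu x ->
  (\int[nu]_y (gibbs eps f g (x, y))%:E = 1)%E.
Proof.
move=> eps0 mg; rewrite /sinkhorn_transform; set I := (\int[nu]_y _)%E => fI.
have mI : measurable_fun [set: E] (fun y => (expR (eps^-1 * (g y - sqnorm (y - x))))%:E).
  apply/measurable_EFinP; apply: measurableT_comp => //; apply: measurable_funM => //.
  apply: measurable_funB => //; apply: measurable_sqnorm.
  by apply: measurable_funB_rV => //; exact: measurable_id.
transitivity ((expR (eps^-1 * f x))%:E * I)%E.
  rewrite /I -ge0_integralZl //.
  apply: eq_integral => y _; rewrite -EFinM -expRD /gibbs /= sqnormBC.
  by congr (expR _)%:E; ring.
have : (0 <= I)%E by apply: integral_ge0 => y _; rewrite lee_fin expR_ge0.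
case: I fI => [r|//|] /=.
- case: ifPn => [r0|]; first by rewrite gt0_muleNy ?lte_fin.
  rewrite -ltNge => r0 [->] _; rewrite -EFinM; congr _%:E.
  rewrite mulrN mulrA mulVf ?gt_eqF // mul1r expRN lnK ?posrE // mulVf //.
  by rewrite gt_eqF.
- by rewrite gt0_muley ?lte_fin.
- by move=> _; rewrite leeNy_eq.
Qed.

Lemma tame_integrable mu f xi : P2 mu -> tame f xi ->
  mu.-integrable [set: E] (EFin \o f).
Proof.
move=> mu2 tf; have [C C0 fC] := tame_quadratic tf.
apply: (@integrable_le _ _ _ _ _ (fun x => C * (1 + sqnorm x))) => //.
  exact: tame_measurable tf.
exact: (integrableZl measurableT C
  (integrableD measurableT (integrable_cst mu 1) (P2_integrable mu2))).
Qed.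

Lemma tame_gradient_integrable mu f xi : P2 mu -> tame f xi ->
  mu.-integrable [set: E] (fun x => (sqnorm (xi x))%:E).
Proof.
move=> mu2 tf; have [C C0 fC] := tame_growth tf.
apply: (@integrable_le _ _ _ _ _ (fun x => C * (1 + sqnorm x))) => //.
- exact: (measurable_sqnorm (tame_gradient_measurable tf)).
- by move=> x; rewrite ger0_norm ?sqnorm_ge0.
exact: (integrableZl measurableT C
  (integrableD measurableT (integrable_cst mu 1) (P2_integrable mu2))).
Qed.

Lemma integrable_dot {dT} {T : measurableType dT} (P : probability T R) (u v : T -> E) :
  measurable_fun [set: T] u -> measurable_fun [set: T] v ->
  P.-integrable [set: T] (fun t => (sqnorm (u t))%:E) ->
  P.-integrable [set: T] (fun t => (sqnorm (v t))%:E) ->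
  P.-integrable [set: T] (fun t => (dot (u t) (v t))%:E).
Proof.
move=> mu mv ju jv.
apply: (@integrable_le _ _ _ _ _ (fun t => sqnorm (u t) + sqnorm (v t))).
- exact: measurable_dot.
- move=> t; have := dot_le_half (u t) (v t); have := dot_le_half (- u t) (v t).
  have := sqnorm_ge0 (u t); have := sqnorm_ge0 (v t).
  by rewrite sqnormN dotNl ler_norml => *; apply/andP; split; lra.
exact: (integrableD measurableT ju jv).
Qed.

Lemma measurable_displacement : measurable_fun [set: E * E] (fun z : E * E => z.2 - z.1).
Proof. exact: measurable_funB_rV. Qed.

Lemma displacement_integrable mu nu pi : P2 mu -> P2 nu -> coupling mu nu pi ->
  pi.-integrable [set: E * E] (fun z => (sqnorm (z.2 - z.1))%:E).
Proof.
move=> mu2 nu2 c; under eq_fun do rewrite sqnormBC.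
exact: coupling_cost_integrable mu2 nu2 c.
Qed.

Lemma coupling_dot_integrable mu nu pi xi : P2 mu -> P2 nu -> coupling mu nu pi ->
  measurable_fun [set: E] xi -> mu.-integrable [set: E] (fun x => (sqnorm (xi x))%:E) ->
  pi.-integrable [set: E * E] (fun z => (dot (xi z.1) (z.2 - z.1))%:E).
Proof.
move=> mu2 nu2 c mxi jxi; apply: integrable_dot.
- exact: (measurableT_comp mxi measurable_fst).
- exact: measurable_displacement.
- apply: (coupling_integrable_fst (f := fun x => sqnorm (xi x)) c) => //.
  exact: measurable_sqnorm.
- exact: displacement_integrable mu2 nu2 c.
Qed.

(** The kernel has mass 1 in y for every single x, so it integrates to 1 against any first marginal;
    this lets mu vary while f and g stay fixed. *)
Lemma OT_ge_potentials eps nu1 nu2 f g xi zeta : 0 < eps -> P2 nu1 -> P2 nu2 ->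
  tame f xi -> tame g zeta ->
  (forall x, \int[nu2]_y (gibbs eps f g (x, y))%:E = 1)%E ->
  (\int[nu1]_x (f x)%:E + \int[nu2]_y (g y)%:E <= OT eps nu1 nu2)%E.
Proof.
move=> eps0 h1 h2 tf tg k1.
have mf := tame_measurable tf; have mg := tame_measurable tg.
apply: OT_ge_dual => //; [exact: tame_integrable tf|exact: tame_integrable tg|].
rewrite le_eqVlt; apply/orP; left; apply/eqP.
transitivity (\int[nu1]_x fubini_F nu2 (EFin \o gibbs eps f g) x)%E.
  apply: fubini_tonelli1; first by apply/measurable_EFinP; exact: measurable_gibbs.
  by move=> z; rewrite lee_fin ltW // gibbs_gt0.
by under eq_integral do rewrite /fubini_F k1; rewrite integral_cst1.
Qed.

Lemma OT_ge0 eps nu1 nu2 : 0 < eps -> P2 nu1 -> P2 nu2 -> (0 <= OT eps nu1 nu2)%E.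
Proof.
move=> eps0 h1 h2.
have := @OT_ge_dual _ _ eps nu1 nu2 (fun=> 0) (fun=> 0) eps0 h1 h2.
rewrite !integral0 adde0; apply=> //; try exact: integrable_cst.
apply: (@le_trans _ _ (\int[(nu1 \x nu2)%E]_z 1)%E).
  apply: ge0_le_integral => //.
  - apply/measurable_EFinP; apply: measurableT_comp => //; apply: measurable_funM => //.
    by apply: measurable_funB => //; exact: measurable_cost.
  - move=> z _; rewrite lee_fin -[leRHS]expR0 ler_expR add0r sub0r mulrN oppr_le0.
    by rewrite mulr_ge0 ?sqnorm_ge0 // invr_ge0 ltW.
by rewrite integral_cst1.
Qed.

(** The constant density 1 gives an independent competitor, of zero entropy and with cost controlled
    by the second moments. *)
Lemma OT_fin_num eps nu1 nu2 : 0 < eps -> P2 nu1 -> P2 nu2 ->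
  OT eps nu1 nu2 \is a fin_num.
Proof.
move=> eps0 h1 h2; rewrite ge0_fin_numE ?OT_ge0 //.
pose p (_ : E * E) : R := 1.
have c1 := product_coupling nu1 nu1; have c2 := product_coupling nu2 nu2.
have p0 z : 0 < p z by exact: ltr01.
have p1 (nu : prob) : (\int[nu]_y (1 : R)%:E = 1)%E by exact: integral_cst1.
have mp : measurable_fun setT p by exact: measurable_cst.
have [P [dP l1 l2]] := exists_glued_plan c1 c2 mp p0 (fun=> p1 nu2) (fun=> p1 nu1).
have jl : P.-integrable setT (fun z : (E * E) * (E * E) => (ln (p (z.1.1, z.2.1)))%:E).
  under eq_fun do rewrite /p ln1; exact: integrable_cst.
apply: (le_lt_trans (OT_le_glued c1 c2 mp p0 eps0 dP l1 l2 jl)).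
rewrite [X in (_ + _ * X)%E](_ : _ = 0)%E ?mule0 ?adde0; last first.
  by under eq_integral do rewrite /p ln1; exact: integral0.
have j1 := coupling_integrable_snd c1 (measurable_sqnorm (@measurable_id _ _ _)) (P2_integrable h1).
have j2 := coupling_integrable_snd c2 (measurable_sqnorm (@measurable_id _ _ _)) (P2_integrable h2).
have jj : P.-integrable setT (fun z => (2 * sqnorm z.1.2 + 2 * sqnorm z.2.2)%:E).
  have i1 := law_integrable measurable_fst l1 (measurable_int _ j1) j1.
  have i2 := law_integrable measurable_snd l2 (measurable_int _ j2) j2.
  exact: (integrableD measurableT (integrableZl measurableT 2 i1) (integrableZl measurableT 2 i2)).
have jc : P.-integrable setT (fun z => (sqnorm (z.1.2 - z.2.2))%:E).
  apply: (@integrable_le _ _ _ _ _ _ _ _ jj).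
    by apply: measurable_sqnorm; apply: measurable_funB_rV; apply: measurableT_comp.
  by move=> z; rewrite ger0_norm ?sqnorm_ge0 // sqnormB_le.
by rewrite ltey_eq integrable_fin_num.
Qed.

End PotentialBounds.

(** * Upper bound from a displaced entropic plan *)

Section PotentialCompetitor.
Context {R : realType} {d : nat}.
Local Notation E := 'rV[R]_d.
Local Notation prob := (probability E R).
Local Notation plan := (probability (E * E)%type R).

(* The gaps dot v m - dot x' v have zero mean under the glued plan, m being the
   conditional mean of x' given x. *)
Lemma displaced_cost_le (x x' v v' m m' : E) :
  sqnorm (x - x' + (v - v')) - sqnorm (x - x') <=
  dot (2 *: (x - m)) v + 2 * sqnorm v + (dot (2 *: (x' - m')) v' + 2 * sqnorm v') +
  (2 * (dot v m - dot x' v) + 2 * (dot v' m' - dot x v')).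
Proof.
rewrite sqnormD; have := sqnormB_le v v'.
rewrite (dotC v m) (dotC v' m') !dotZl !dotDl !dotNl !dotDr !dotNr; lra.
Qed.

(** The share of one marginal in the bound for the competitor; the coefficient 2 comes from |v -
    v'|^2 <= 2|v|^2 + 2|v'|^2. *)
Definition first_order (f : E -> R) (xi : E -> E) (z : E * E) : R :=
  f z.1 + dot (xi z.1) (z.2 - z.1) + 2 * sqnorm (z.2 - z.1).

(** The growth of the conditional mean is inherited from that of the gradient, m being recovered as
    x - xi(x)/2. *)
Lemma tame_mean_integrable (mu nu : prob) (pi : plan) (f : E -> R) (m : E -> E) :
  P2 mu -> P2 nu -> coupling mu nu pi -> tame f (fun x => 2 *: (x - m x)) ->
  pi.-integrable setT (fun w => (dot (w.2 - w.1) (m w.1))%:E).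
Proof.
move=> mu2 nu2 c tf.
have ja := coupling_dot_integrable mu2 nu2 c (@measurable_id _ _ _) (P2_integrable mu2).
have jb := coupling_dot_integrable mu2 nu2 c (tame_gradient_measurable tf)
  (tame_gradient_integrable mu2 tf).
have := integrableB measurableT ja (integrableZl measurableT (2^-1 : R) jb).
apply: eq_ind; congr (integrable _ _ _); apply/funext => w.
by rewrite -EFinM; congr (_%:E); set v := w.2 - w.1; rewrite (dotC v) dotZl dotDl dotNl; field.
Qed.

Lemma first_order_integrable (mu nu : prob) (pi : plan) (f : E -> R) (xi : E -> E) :
  P2 mu -> P2 nu -> coupling mu nu pi -> tame f xi ->
  pi.-integrable setT (fun w => (first_order f xi w)%:E).
Proof.
move=> mu2 nu2 c tf.
have ja := coupling_integrable_fst c (tame_measurable tf) (tame_integrable mu2 tf).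
have jb := coupling_dot_integrable mu2 nu2 c (tame_gradient_measurable tf)
  (tame_gradient_integrable mu2 tf).
have jc := integrableZl measurableT (2 : R) (displacement_integrable mu2 nu2 c).
exact: (integrableD measurableT (integrableD measurableT ja jb) jc).
Qed.

Variables (eps : R) (mu1 mu2 nu1 nu2 : prob) (pi1 pi2 : plan) (f g : E -> R).
Hypothesis eps0 : 0 < eps.
Hypothesis mu1_P2 : P2 mu1.
Hypothesis mu2_P2 : P2 mu2.
Hypothesis nu1_P2 : P2 nu1.
Hypothesis nu2_P2 : P2 nu2.
Hypothesis c1 : coupling mu1 nu1 pi1.
Hypothesis c2 : coupling mu2 nu2 pi2.
Hypothesis mf : measurable_fun [set: E] f.
Hypothesis mg : measurable_fun [set: E] g.
Hypothesis k1 : forall x, (\int[mu2]_y (gibbs eps f g (x, y))%:E = 1)%E.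
Hypothesis k2 : forall y, (\int[mu1]_x (gibbs eps g f (y, x))%:E = 1)%E.

Let xi := potential_gradient mf mg k1.
Let zeta := potential_gradient mg mf k2.

Hypothesis tf : tame f xi.
Hypothesis tg : tame g zeta.

Let q (z : (E * E) * (E * E)) := gibbs eps f g (z.1.1, z.2.1).

Let mq : measurable_fun [set: (E * E) * (E * E)] q.
Proof.
apply: measurableT_comp; first exact: measurable_gibbs.
by apply: measurable_fun_pair; apply: measurableT_comp.
Qed.

Let q0 z : 0 <= q z.
Proof. exact/ltW/gibbs_gt0. Qed.

Section Glued.
Variable P : probability ((E * E) * (E * E))%type R.
Hypothesis dP : has_density (pi1 \x pi2)%E (fun z => gibbs eps f g (z.1.1, z.2.1)) P.
Hypothesis l1 : has_law P fst pi1.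
Hypothesis l2 : has_law P snd pi2.

Let j1 (h : E * E -> R) : measurable_fun setT h -> pi1.-integrable setT (EFin \o h) ->
  P.-integrable setT (fun z => (h z.1)%:E).
Proof.
move=> mh jh; apply: (law_integrable measurable_fst l1 _ jh).
exact/measurable_EFinP.
Qed.

Let j2 (h : E * E -> R) : measurable_fun setT h -> pi2.-integrable setT (EFin \o h) ->
  P.-integrable setT (fun z => (h z.2)%:E).
Proof.
move=> mh jh; apply: (law_integrable measurable_snd l2 _ jh).
exact/measurable_EFinP.
Qed.

Let cross1_integrable : P.-integrable setT (fun z => (dot z.2.1 (z.1.2 - z.1.1))%:E).
Proof.
apply: integrable_dot.
- exact: measurableT_comp.
- by apply: measurable_funB_rV; apply: measurableT_comp.
- apply: (j2 (h := fun z => sqnorm z.1)); first exact: measurable_sqnorm.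
  apply: (coupling_integrable_fst (f := sqnorm) c2); last exact: P2_integrable.
  exact: (measurable_sqnorm (@measurable_id _ _ _)).
- apply: (j1 (h := fun z => sqnorm (z.2 - z.1))).
    exact: (measurable_sqnorm measurable_displacement).
  exact: displacement_integrable c1.
Qed.

Let cross2_integrable : P.-integrable setT (fun z => (dot z.1.1 (z.2.2 - z.2.1))%:E).
Proof.
apply: integrable_dot.
- exact: measurableT_comp.
- by apply: measurable_funB_rV; apply: measurableT_comp.
- apply: (j1 (h := fun z => sqnorm z.1)); first exact: measurable_sqnorm.
  apply: (coupling_integrable_fst (f := sqnorm) c1); last exact: P2_integrable.
  exact: (measurable_sqnorm (@measurable_id _ _ _)).
- apply: (j2 (h := fun z => sqnorm (z.2 - z.1))).
    exact: (measurable_sqnorm measurable_displacement).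
  exact: displacement_integrable c2.
Qed.

(** Given the first pair (x, y), the second one enters only through its starting point x', whose
    conditional law is [cond] at x; Fubini's theorem then replaces x' by its mean. *)
Let cross1 : (\int[P]_z (dot z.2.1 (z.1.2 - z.1.1))%:E =
  \int[pi1]_w (dot (w.2 - w.1) (cond_mean mf mg k1 w.1))%:E)%E.
Proof.
have jc := cross1_integrable; have mc := measurable_int _ jc.
rewrite (density_integral q0 dP mc).
have jq := density_integrable mq q0 dP mc jc.
apply: (etrans (esym (integral12_prod_meas1 jq))).
apply: eq_integral => w _; rewrite /fubini_F /=.
rewrite -(dot_cond_mean eps0) (density_integral _ (cond_density mf mg k1 w.1)); last 2 first.
- by move=> y; exact/ltW/gibbs_gt0.
- by apply/measurable_EFinP; exact: measurable_dotl.
rewrite (law_integral measurable_fst (coupling_fst c2)).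
  by apply: eq_integral => w' _ /=; rewrite dotC.
apply: emeasurable_funM.
  by apply/measurable_EFinP; exact: measurable_dotl.
apply/measurable_EFinP.
exact: (measurable_fun_pair2 w.1 (measurable_gibbs eps mf mg)).
Qed.

Let cross2 : (\int[P]_z (dot z.1.1 (z.2.2 - z.2.1))%:E =
  \int[pi2]_w (dot (w.2 - w.1) (cond_mean mg mf k2 w.1))%:E)%E.
Proof.
have jc := cross2_integrable; have mc := measurable_int _ jc.
rewrite (density_integral q0 dP mc).
have jq := density_integrable mq q0 dP mc jc.
apply: (etrans (esym (integral21_prod_meas1 jq))).
apply: eq_integral => w _; rewrite /fubini_G /=.
rewrite -(dot_cond_mean eps0) (density_integral _ (cond_density mg mf k2 w.1)); last 2 first.
- by move=> y; exact/ltW/gibbs_gt0.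
- by apply/measurable_EFinP; exact: measurable_dotl.
rewrite (law_integral measurable_fst (coupling_fst c1)).
  by apply: eq_integral => w' _ /=; rewrite dotC /q gibbsC.
apply: emeasurable_funM.
  by apply/measurable_EFinP; exact: measurable_dotl.
apply/measurable_EFinP.
exact: (measurable_fun_pair2 w.1 (measurable_gibbs eps mg mf)).
Qed.

Let mean1_integrable := tame_mean_integrable (m := cond_mean mf mg k1) mu1_P2 nu1_P2 c1 tf.

Let mean2_integrable := tame_mean_integrable (m := cond_mean mg mf k2) mu2_P2 nu2_P2 c2 tg.

Let gap1 (z : (E * E) * (E * E)) : R :=
  2 * (dot (z.1.2 - z.1.1) (cond_mean mf mg k1 z.1.1) - dot z.2.1 (z.1.2 - z.1.1)).

Let gap2 (z : (E * E) * (E * E)) : R :=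
  2 * (dot (z.2.2 - z.2.1) (cond_mean mg mf k2 z.2.1) - dot z.1.1 (z.2.2 - z.2.1)).

Let P_mean1 : P.-integrable setT
  (fun z => (dot (z.1.2 - z.1.1) (cond_mean mf mg k1 z.1.1))%:E).
Proof. exact: (law_integrable measurable_fst l1 (measurable_int _ mean1_integrable)
  mean1_integrable). Qed.

Let P_mean2 : P.-integrable setT
  (fun z => (dot (z.2.2 - z.2.1) (cond_mean mg mf k2 z.2.1))%:E).
Proof. exact: (law_integrable measurable_snd l2 (measurable_int _ mean2_integrable)
  mean2_integrable). Qed.

Let gap1_integrable : P.-integrable setT (EFin \o gap1).
Proof. exact: (integrableZl measurableT 2 (integrableB measurableT P_mean1 cross1_integrable)). Qed.

Let gap2_integrable : P.-integrable setT (EFin \o gap2).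
Proof. exact: (integrableZl measurableT 2 (integrableB measurableT P_mean2 cross2_integrable)). Qed.

Let gap1_integral : (\int[P]_z (gap1 z)%:E = 0)%E.
Proof.
rewrite (integralZl measurableT (integrableB measurableT P_mean1 cross1_integrable)).
rewrite (integralB_EFin measurableT P_mean1 cross1_integrable) cross1.
rewrite (law_integral measurable_fst l1 (measurable_int _ mean1_integrable)).
by rewrite subee ?mule0 // (integrable_fin_num measurableT P_mean1).
Qed.

Let gap2_integral : (\int[P]_z (gap2 z)%:E = 0)%E.
Proof.
rewrite (integralZl measurableT (integrableB measurableT P_mean2 cross2_integrable)).
rewrite (integralB_EFin measurableT P_mean2 cross2_integrable) cross2.
rewrite (law_integral measurable_snd l2 (measurable_int _ mean2_integrable)).
by rewrite subee ?mule0 // (integrable_fin_num measurableT P_mean2).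
Qed.

Let lnq z : eps * ln (q z) = f z.1.1 + g z.2.1 - sqnorm (z.1.1 - z.2.1).
Proof. by rewrite /q /gibbs expRK /= mulrA divff ?gt_eqF // mul1r. Qed.

Let lnq_integrable : P.-integrable setT (fun z => (ln (q z))%:E).
Proof.
have jf := j1 (measurableT_comp mf measurable_fst)
  (coupling_integrable_fst c1 mf (tame_integrable mu1_P2 tf)).
have jg := j2 (measurableT_comp mg measurable_fst)
  (coupling_integrable_fst c2 mg (tame_integrable mu2_P2 tg)).
have msq := measurable_sqnorm (@measurable_id _ E [set: E]).
have jx := j1 (measurableT_comp msq measurable_fst)
  (coupling_integrable_fst c1 msq (P2_integrable mu1_P2)).
have jy := j2 (measurableT_comp msq measurable_fst)
  (coupling_integrable_fst c2 msq (P2_integrable mu2_P2)).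
have jc : P.-integrable setT (fun z => (sqnorm (z.1.1 - z.2.1))%:E).
  apply: (@integrable_le _ _ _ _ _ (fun z => 2 * sqnorm z.1.1 + 2 * sqnorm z.2.1)).
  - by apply: measurable_sqnorm; apply: measurable_funB_rV; apply: measurableT_comp.
  - by move=> z; rewrite ger0_norm ?sqnorm_ge0 // sqnormB_le.
  - exact: (integrableD measurableT (integrableZl measurableT 2 jx) (integrableZl measurableT 2 jy)).
have := integrableZl measurableT (eps^-1 : R)
  (integrableB measurableT (integrableD measurableT jf jg) jc).
apply: eq_ind; congr (integrable _ _ _); apply/funext => z /=.
by rewrite -!EFinD -EFinM; congr (_%:E); rewrite -lnq mulrA mulVf ?gt_eqF // mul1r.
Qed.

Let cost_integrable : P.-integrable setT (fun z => (sqnorm (z.1.2 - z.2.2))%:E).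
Proof.
have msq := measurable_sqnorm (@measurable_id _ E [set: E]).
have jx := j1 (measurableT_comp msq measurable_snd)
  (coupling_integrable_snd c1 msq (P2_integrable nu1_P2)).
have jy := j2 (measurableT_comp msq measurable_snd)
  (coupling_integrable_snd c2 msq (P2_integrable nu2_P2)).
apply: (@integrable_le _ _ _ _ _ (fun z => 2 * sqnorm z.1.2 + 2 * sqnorm z.2.2)).
- by apply: measurable_sqnorm; apply: measurable_funB_rV; apply: measurableT_comp.
- by move=> z; rewrite ger0_norm ?sqnorm_ge0 // sqnormB_le.
- exact: (integrableD measurableT (integrableZl measurableT 2 jx) (integrableZl measurableT 2 jy)).
Qed.

(** eps ln q equals f + g minus the cost before displacement, so only the increment of the cost has
    to be bounded. *)
Let competitor_le z : sqnorm (z.1.2 - z.2.2) + eps * ln (q z) <=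
  first_order f xi z.1 + first_order g zeta z.2 + (gap1 z + gap2 z).
Proof.
have rearr (a b A B C D F1 F2 G : R) : a - b <= A + B + (C + D) + G ->
  a + (F1 + F2 - b) <= F1 + A + B + (F2 + C + D) + G by lra.
rewrite lnq; apply: rearr.
have := displaced_cost_le z.1.1 z.2.1 (z.1.2 - z.1.1) (z.2.2 - z.2.1)
  (cond_mean mf mg k1 z.1.1) (cond_mean mg mf k2 z.2.1).
have -> : z.1.1 - z.2.1 + (z.1.2 - z.1.1 - (z.2.2 - z.2.1)) = z.1.2 - z.2.2.
  by apply/rowP => i; rewrite !mxE; ring.
exact.
Qed.

Let glued_bound :
  (\int[P]_z (sqnorm (z.1.2 - z.2.2))%:E + eps%:E * \int[P]_z (ln (q z))%:E <=
   \int[pi1]_w (first_order f xi w)%:E + \int[pi2]_w (first_order g zeta w)%:E)%E.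
Proof.
have ja := first_order_integrable mu1_P2 nu1_P2 c1 tf.
have jb := first_order_integrable mu2_P2 nu2_P2 c2 tg.
have ma := measurable_int _ ja; have mb := measurable_int _ jb.
have ia := law_integrable measurable_fst l1 ma ja.
have ib := law_integrable measurable_snd l2 mb jb.
rewrite (law_integral measurable_fst l1 ma) (law_integral measurable_snd l2 mb).
have jl := integrableZl measurableT (eps : R) lnq_integrable.
have jg := integrableD measurableT gap1_integrable gap2_integrable.
have jab := integrableD measurableT ia ib.
rewrite -(integralZl measurableT lnq_integrable) -(integralD measurableT cost_integrable jl).
rewrite -(integralD measurableT ia ib).
have g0 : (\int[P]_z ((EFin \o gap1) z + (EFin \o gap2) z) = 0)%E.
  by rewrite (integralD measurableT gap1_integrable gap2_integrable) gap1_integral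
    gap2_integral adde0.
rewrite -[leRHS]adde0 -g0 -(integralD measurableT jab jg).
apply: le_integral => //.
- exact: integrableD.
- exact: integrableD.
by move=> z _; rewrite -EFinM -!EFinD lee_fin; exact: competitor_le.
Qed.

Lemma OT_le_potentials_aux :
  (OT eps nu1 nu2 <= \int[pi1]_w (first_order f xi w)%:E +
                     \int[pi2]_w (first_order g zeta w)%:E)%E.
Proof.
apply: le_trans glued_bound.
by apply: (OT_le_glued c1 c2 (measurable_gibbs eps mf mg)) => // z; exact: gibbs_gt0.
Qed.

End Glued.

Lemma OT_le_potentials :
  (OT eps nu1 nu2 <= \int[pi1]_w (first_order f xi w)%:E +
                     \int[pi2]_w (first_order g zeta w)%:E)%E.
Proof.
have k2' y : (\int[mu1]_x (gibbs eps f g (x, y))%:E = 1)%E.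
  by rewrite -(k2 y); apply: eq_integral => x _; rewrite gibbsC.
have [P [dP l1 l2]] := exists_glued_plan c1 c2 (measurable_gibbs eps mf mg)
  (gibbs_gt0 eps f g) k1 k2'.
exact: (OT_le_potentials_aux dP l1 l2).
Qed.

End PotentialCompetitor.

(** * The subdifferential inequality *)

Section Subdifferential.
Context {R : realType} {d : nat}.
Local Notation E := 'rV[R]_d.
Local Notation prob := (probability E R).
Local Notation plan := (probability (E * E)%type R).

(** The two equations of the system feed each other: semiconcavity of g at 0 is the upper bound on g
    that the lower bound on f requires. *)
Lemma coupled_potential_tame eps (f g : E -> R) (mu nu : prob) (eps0 : 0 < eps)
    (mf : measurable_fun [set: E] f) (mg : measurable_fun [set: E] g)
    (k1 : forall x, (\int[nu]_y (gibbs eps f g (x, y))%:E = 1)%E) :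
  (forall y, (\int[mu]_x (gibbs eps g f (y, x))%:E = 1)%E) -> subgaussian nu ->
  tame f (potential_gradient mf mg k1).
Proof.
move=> k2 sg.
have [|C C0 fC] := potential_quadratic eps0 mf mg k1
    (zeta := 2 *: (0 - cond_mean mg mf k2 0)) sg.
  by move=> y; have := potential_semiconcave eps0 mg mf k2 0 y; rewrite add0r.
exact: potential_tame fC.
Qed.

(** Along the diagonal nothing moves, and the competitor bound becomes the upper half of duality at
    the base point. *)
Lemma diagonal_first_order (mu : prob) (f : E -> R) (xi : E -> E) :
  P2 mu -> tame f xi -> exists2 pi : plan, coupling mu mu pi &
    (\int[pi]_w (first_order f xi w)%:E = \int[mu]_x (f x)%:E)%E.
Proof.
move=> mu2 tf; have mD : measurable_fun [set: E] (fun x : E => (x, x)).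
  by apply: measurable_fun_pair; exact: measurable_id.
have [pi l] := exists_law mu mD.
have c : coupling mu mu pi.
  move=> A mA; rewrite /pushforward; split; rewrite l //.
    by rewrite -[X in measurable X]setTI; exact: measurable_fst.
  by rewrite -[X in measurable X]setTI; exact: measurable_snd.
exists pi => //; have jf := first_order_integrable mu2 mu2 c tf.
rewrite (law_integral mD l (measurable_int _ jf)); apply: eq_integral => x _.
by rewrite /first_order /= subrr sqnorm0 dotC -(scale0r 0) dotZl mul0r mulr0 !addr0.
Qed.

Lemma transport_cost_W2 (mu nu : prob) (pi : plan) : P2 mu -> P2 nu ->
  optimal_coupling mu nu pi -> transport_cost pi = (W2 mu nu ^+ 2)%:E.
Proof.
move=> mu2 nu2 [c cE]; rewrite /W2 -cE.
have jc := coupling_cost_integrable mu2 nu2 c.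
have c0 : (0 <= transport_cost pi)%E.
  by apply: integral_ge0 => z _; rewrite lee_fin sqnorm_ge0.
rewrite sqr_sqrtr ?fine_ge0 // fineK //; exact: (integrable_fin_num measurableT jc).
Qed.

Section Plan.
Variables (mu nu : prob) (pi : plan).
Hypothesis mu2 : P2 mu.
Hypothesis nu2 : P2 nu.
Hypothesis c : coupling mu nu pi.

Let transport_costE : (\int[pi]_z (sqnorm (z.2 - z.1))%:E)%E = transport_cost pi.
Proof. by apply: eq_integral => z _; rewrite sqnormBC. Qed.

Lemma first_order_integral (f : E -> R) (xi : E -> E) : tame f xi ->
  (\int[pi]_w (first_order f xi w)%:E = \int[mu]_x (f x)%:E +
     \int[pi]_z (dot (xi z.1) (z.2 - z.1))%:E + 2%:E * transport_cost pi)%E.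
Proof.
move=> tf.
have jf := coupling_integrable_fst c (tame_measurable tf) (tame_integrable mu2 tf).
have jd := coupling_dot_integrable mu2 nu2 c (tame_gradient_measurable tf)
  (tame_gradient_integrable mu2 tf).
have js := displacement_integrable mu2 nu2 c.
rewrite (integralD measurableT (integrableD measurableT jf jd) (integrableZl measurableT 2 js)).
rewrite (integralD measurableT jf jd) (integralZl measurableT js) transport_costE.
congr (_ + _ + _)%E; apply/esym.
apply: (law_integral measurable_fst (coupling_fst c) (f := EFin \o f)).
by apply/measurable_EFinP; exact: tame_measurable tf.
Qed.

Lemma taylor_defect_integral (f : E -> R) (xi : E -> E) : tame f xi ->
  (\int[pi]_z (taylor_defect f xi z.1 (z.2 - z.1))%:E =
   transport_cost pi + \int[pi]_z (dot (xi z.1) (z.2 - z.1))%:E -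
   (\int[nu]_x (f x)%:E - \int[mu]_x (f x)%:E))%E.
Proof.
move=> tf; have mf := tame_measurable tf.
have jf := coupling_integrable_fst c mf (tame_integrable mu2 tf).
have jf2 := coupling_integrable_snd c mf (tame_integrable nu2 tf).
have jd := coupling_dot_integrable mu2 nu2 c (tame_gradient_measurable tf)
  (tame_gradient_integrable mu2 tf).
have js := displacement_integrable mu2 nu2 c.
have mef : measurable_fun [set: E] (EFin \o f) by exact/measurable_EFinP.
rewrite (law_integral measurable_fst (coupling_fst c) mef).
rewrite (law_integral measurable_snd (coupling_snd c) mef).
rewrite -transport_costE -(integralD measurableT js jd) -(integralB measurableT jf2 jf).
rewrite -(integralB measurableT (integrableD measurableT js jd) (integrableB measurableT jf2 jf)).
by apply: eq_integral => z _; rewrite /taylor_defect (addrC z.1) subrK.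
Qed.

End Plan.

Lemma fin_num_real (x : \bar R) : x \is a fin_num -> exists a, x = a%:E.
Proof. by move=> xf; exists (fine x); rewrite fineK. Qed.

End Subdifferential.

Theorem proposition3p5 (R : realType) (d : nat) (eps : R)
    (mu_star mu : probability 'rV[R]_d R) (f g f_mu : 'rV[R]_d -> R) :
  (1 <= d)%N -> 0 < eps ->
  gaussian mu_star -> gaussian mu ->
  schrodinger_potentials eps mu mu_star f g ->
  schrodinger_potentials eps mu mu f_mu f_mu ->
  wasserstein_subdifferential
    (fun nu => sinkhorn_divergence eps nu mu_star) mu
    (gradient (fun x => f x - f_mu x)).
Proof.
move=> d0 eps0 gs gm [mf mg fE gE] [mh _ hE _].
have sgs := gaussian_subgaussian d0 gs; have sgm := gaussian_subgaussian d0 gm.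
have mu2 := subgaussian_P2 sgm; have mus2 := subgaussian_P2 sgs.
have kf x := transform_gibbs eps0 mg (fE x).
have kg y := transform_gibbs eps0 mf (gE y).
have kh x := transform_gibbs eps0 mh (hE x).
(* From here on only tameness and the transport bounds matter, so the construction of the gradients
   is hidden behind existentials. *)
have [xf [xg [tf tg OTfg]]] : exists (xf xg : 'rV[R]_d -> 'rV[R]_d),
    [/\ tame f xf, tame g xg & forall pi1 pi2,
      coupling mu mu pi1 -> coupling mu_star mu_star pi2 ->
      (OT eps mu mu_star <= \int[pi1]_w (first_order f xf w)%:E +
                            \int[pi2]_w (first_order g xg w)%:E)%E].
  have tf := coupled_potential_tame eps0 mf mg kf kg sgs.
  have tg := coupled_potential_tame eps0 mg mf kg kf sgm.
  exists (potential_gradient mf mg kf), (potential_gradient mg mf kg).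
  split=> // pi1 pi2 c1 c2; exact: (OT_le_potentials eps0 mu2 mus2 mu2 mus2 c1 c2 tf tg).
have [xh th OTh] : exists2 xh : 'rV[R]_d -> 'rV[R]_d, tame f_mu xh &
    forall nu pi, P2 nu -> coupling mu nu pi ->
      (OT eps nu nu <= \int[pi]_w (first_order f_mu xh w)%:E +
                       \int[pi]_w (first_order f_mu xh w)%:E)%E.
  have th := coupled_potential_tame eps0 mh mh kh kh sgm.
  exists (potential_gradient mh mh kh) => // nu pi nu2 c.
  exact: (OT_le_potentials eps0 mu2 mu2 nu2 nu2 c c th th).
rewrite (gradient_tameB tf th).
have mxf := tame_gradient_measurable tf; have mxh := tame_gradient_measurable th.
have OTf (nu1 nu2 : probability 'rV[R]_d R) : P2 nu1 -> P2 nu2 ->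
    OT eps nu1 nu2 \is a fin_num by exact: OT_fin_num.
have [s sE] := fin_num_real (OTf _ _ mus2 mus2).
have [b bE] := fin_num_real (OTf _ _ mu2 mus2).
have [e eE] := fin_num_real (OTf _ _ mu2 mu2).
have [Ifm IfmE] := fin_num_real (integrable_fin_num measurableT (tame_integrable mu2 tf)).
have [Ihm IhmE] := fin_num_real (integrable_fin_num measurableT (tame_integrable mu2 th)).
have [Ig IgE] := fin_num_real (integrable_fin_num measurableT (tame_integrable mus2 tg)).
(* The base value OT(mu, mu_star) is subtracted in the end, so it needs an upper bound, supplied by
   diagonal plans. *)
have b_le : b <= Ifm + Ig.
  have [pi1 c1 i1] := diagonal_first_order mu2 tf.
  have [pi2 c2 i2] := diagonal_first_order mus2 tg.
  have := OTfg _ _ c1 c2.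
  by rewrite i1 i2 bE IfmE IgE -EFinD lee_fin.
have e_ge : Ihm + Ihm <= e.
  have := OT_ge_potentials eps0 mu2 mu2 th th kh.
  by rewrite IhmE eE -EFinD lee_fin.
split=> //.
- by rewrite /sinkhorn_divergence bE eE sE -!EFinM -!EFinB.
- split; first exact: measurable_funB_rV.
  have jxf := tame_gradient_integrable mu2 tf; have jxh := tame_gradient_integrable mu2 th.
  have jj := integrableD measurableT (integrableZl measurableT (2 : R) jxf)
    (integrableZl measurableT (2 : R) jxh).
  have jx : mu.-integrable setT (fun x => (sqnorm (xf x - xh x))%:E).
    apply: (@integrable_le _ _ _ _ _ _ _ _ jj).
      by apply: measurable_sqnorm; exact: measurable_funB_rV.
    by move=> x; rewrite ger0_norm ?sqnorm_ge0 // sqnormB_le.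
  by rewrite ltey_eq (integrable_fin_num measurableT jx).
(* The remainder is a function of nu given before any plan, so an optimal plan is chosen for every
   nu beforehand. *)
pose pi_ nu := sval (cid (exists_optimal_coupling mu nu)).
have piP nu : optimal_coupling mu nu (pi_ nu) by exact: (svalP (cid _)).
pose D nu := fine (\int[pi_ nu]_z (taylor_defect f xf z.1 (z.2 - z.1))%:E)%E.
(* The square of W2 is counted once positively, from the |v|^2 inside the defect of f, and twice
   negatively, from half of the self-transport error 4 W2^2. *)
exists (fun nu => - D nu - W2 mu nu ^+ 2).
  move=> eta eta0.
  have [K K0 KP] := tame_remainder mu2 tf (divr_gt0 eta0 (ltr0n _ 2)).
  (* Below this radius (K + 1) w^2 <= (eta/2) w; the other half of eta pays for the linear term in
     the bound on D. *)
  exists (eta / 2 / (K + 1)) => [|nu nu2]; first by rewrite !divr_gt0 // ltr_wpDl.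
  set w := W2 mu nu => w_lt.
  have w0 : 0 <= w by exact: sqrtr_ge0.
  have cE := transport_cost_W2 mu2 nu2 (piP nu).
  have D0 : 0 <= D nu.
    by rewrite fine_ge0 //; apply: integral_ge0 => z _; rewrite lee_fin (tame_semiconcave tf).
  have D_le : D nu <= K * w ^+ 2 + eta / 2 * w.
    have := KP nu _ w nu2 (piP nu).1 w0 cE.
    rewrite /D; case: (\int[_]_z _)%E => [r||] //=.
    have := mulr_ge0 K0 (sqr_ge0 w); have := mulr_ge0 (ltW eta0) w0; lra.
  have : (K + 1) * w * w <= eta / 2 * w.
    by rewrite ler_wpM2r // mulrC -ler_pdivlMr ?ltr_wpDl // ltW.
  have -> : `|- D nu - w ^+ 2| = D nu + w ^+ 2.
    by rewrite -opprD normrN ger0_norm // addr_ge0 // sqr_ge0.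
  rewrite -mulrA -expr2 mulrDl mul1r; lra.
move=> nu nu2; exists (pi_ nu) => //.
have [c _] := piP nu.
have cE := transport_cost_W2 mu2 nu2 (piP nu).
have [a aE] := fin_num_real (OTf _ _ nu2 mus2).
have [cc ccE] := fin_num_real (OTf _ _ nu2 nu2).
have [Ifn IfnE] := fin_num_real (integrable_fin_num measurableT (tame_integrable nu2 tf)).
have jf := coupling_dot_integrable mu2 nu2 c mxf (tame_gradient_integrable mu2 tf).
have jh := coupling_dot_integrable mu2 nu2 c mxh (tame_gradient_integrable mu2 th).
have [S SE] := fin_num_real (integrable_fin_num measurableT jf).
have [T TE] := fin_num_real (integrable_fin_num measurableT jh).
set w2 := W2 mu nu ^+ 2 in cE *.
have a_ge : Ifn + Ig <= a.
  have := OT_ge_potentials eps0 nu2 mus2 tf tg kf.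
  by rewrite IfnE IgE aE -EFinD lee_fin.
(* Both marginals are moved along the same plan, whence the factor 2, which the coefficient 1/2 of
   the divergence removes. *)
have c_le : cc <= 2 * (Ihm + T + 2 * w2).
  have := OTh _ _ nu2 c.
  rewrite (first_order_integral mu2 nu2 c th) ccE IhmE TE cE -EFinM -!EFinD lee_fin.
  lra.
have DE : D nu = w2 + S - (Ifn - Ifm).
  by rewrite /D (taylor_defect_integral mu2 nu2 c tf) cE SE IfnE IfmE.
have -> : (\int[pi_ nu]_z (dot (xf z.1 - xh z.1) (z.2 - z.1))%:E = (S - T)%:E)%E.
  rewrite EFinB -SE -TE -(integralB_EFin measurableT jf jh).
  by apply: eq_integral => z _; rewrite dotDl dotNl EFinB.
rewrite /sinkhorn_divergence aE bE ccE eE sE -!EFinM -!EFinB -!EFinD lee_fin DE.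
lra.
Qed.
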